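(* Consider the Adaptive Multilevel Splitting (AMS) algorithm for Markov chains described in the context, with any measurable reaction coordinate $\xi:\mathcal{S}\to\mathbb{R}$ satisfying $B\subset\xi^{-1}(]z_{\rm max},+\infty[)$, any number of replicas $n_{\rm rep}$ and any $k\in\{1,\dots,n_{\rm rep}-1\}$. Assume that the number of iterations $Q_{\rm iter}$ is almost surely finite. Then for any bounded measurable $\varphi:\mathcal{P}\to\mathbb{R}$, the AMS estimator $$\hat\varphi=\sum_{n\in I^{(Q_{\rm iter})}}G^{(n,Q_{\rm iter})}\,\varphi\big(X^{(n,Q_{\rm iter})}\big)$$ is an unbiased estimator of $\pi(\varphi)=\mathbb{E}(\varphi(X))$, i.e. $\mathbb{E}(\hat\varphi)=\pi(\varphi)$.
   Context: **Markov chain setting.** $\mathcal{S}$ is a Polish space, $P$ a Markov transition kernel on $\mathcal{S}$, $\tilde X=(\tilde X_t)_{t\in\mathbb{N}}$ a Markov chain with transition $P$ and deterministic initial condition $x_0\in\mathcal{S}$. $A,B\subset\mathcal{S}$ are disjoint Borel sets. $\mathcal{P}=\mathcal{S}^{\mathbb{N}}$ is the path space (product topology, Borel $\sigma$-field). For $x\in\mathcal{P}$, $\mathrm{T}_A(x)=\inf\{t\in\mathbb{N}:x_t\in A\}$ ($\inf\emptyset=+\infty$). $X_t=\tilde X_{t\wedge\mathrm{T}_A(\tilde X)}$ is the chain stopped at its entrance time in $A$, and $\pi=\mathrm{Law}(X)$, a probability on $\mathcal{P}$. *Reaction coordinate.* $\xi:\mathcal{S}\to\mathbb{R}$ is measurable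 and $z_{\rm max}\in\mathbb{R}$ satisfies $B\subset\xi^{-1}(]z_{\rm max},+\infty[)$. Maximum level of a path: $\Xi(x)=\sup_{t\in\mathbb{N}}\xi(x_{t\wedge\mathrm{T}_A(x)})\in\mathbb{R}\cup\{+\infty\}$. For $z\in\mathbb{R}$: $\mathrm{T}_z(x)=\inf\{t\in\mathbb{N},\,t\le\mathrm{T}_A(x):\xi(x_t)>z\}$. *Resampling kernel.* For $z\in\mathbb{R}$, $x\in\mathcal{P}$, $\pi_z(x,\cdot)$ is the law of the path $Y$ with $Y_t=x_t$ for $t\le\mathrm{T}_z(x)$, and, for $t>\mathrm{T}_z(x)$, $Y_t$ generated from $Y_{t-1}$ with the transition $P$, the path being stopped (kept constant) once it hits $A$. If $\mathrm{T}_z(x)=+\infty$, $Y_t=x_{t\wedge\mathrm{T}_A(x)}$ for all $t$. **AMS algorithm.** Parameters: $n_{\rm rep}$ and $k\in\{1,\dots,n_{\rm rep}-1\}$. All random draws are independent of everything previously generated, given their stated laws. *Initialization.* $(X^{(n,0)})_{1\le n\le n_{\rm rep}}$ i.i.d. with law $\pi$; $I^{(0)}=I^{(0)}_{\rm on}=\{1,\dots,n_{\rm rep}\}$, $I^{(0)}_{\rm off}=\emptyset$; $G^{(n,0)}=1/n_{\rm rep}$. Let $Z^{(0)}$ be the $k$-th order statistic (the $k$-th smallest value, counted with multiplicity) of $(\Xi(X^{(n,0)}))_{n\in I^{(0)}_{\rm on}}$; if all $n_{\rm rep}$ replicas satisfy $\Xi(X^{(n,0)})\le Z^{(0)}$,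 set instead $Z^{(0)}=+\infty$. *Iteration $q\ge0$.* Stopping criterion: if $Z^{(q)}>z_{\rm max}$, stop and set $Q_{\rm iter}=q$. So $Q_{\rm iter}=\inf\{q\ge0:Z^{(q)}>z_{\rm max}\}$. Otherwise: (1) Splitting: $I^{(q)}_{{\rm on},\le Z^{(q)}}=\{n\in I^{(q)}_{\rm on}:\Xi(X^{(n,q)})\le Z^{(q)}\}$, $I^{(q)}_{{\rm on},>Z^{(q)}}=\{n\in I^{(q)}_{\rm on}:\Xi(X^{(n,q)})>Z^{(q)}\}$ (nonempty), $K^{(q+1)}=\mathrm{card}\,I^{(q)}_{{\rm on},\le Z^{(q)}}$. New labels $I^{(q+1)}_{\rm new}=\{\mathrm{card}\,I^{(q)}+1,\dots,\mathrm{card}\,I^{(q)}+K^{(q+1)}\}$. The parents $P^{(q+1)}(n')$, $n'\in I^{(q+1)}_{\rm new}$, are i.i.d. uniform in $I^{(q)}_{{\rm on},>Z^{(q)}}$. Set $I^{(q+1)}_{\rm on}=I^{(q)}_{{\rm on},>Z^{(q)}}\sqcup I^{(q+1)}_{\rm new}$, $I^{(q+1)}_{\rm off}=I^{(q)}_{\rm off}\sqcup I^{(q)}_{{\rm on},\le Z^{(q)}}$, $I^{(q+1)}=I^{(q+1)}_{\rm on}\sqcup I^{(q+1)}_{\rm off}$. Weights: $G^{(n,q+1)}=G^{(n,q)}$ for $n\in I^{(q+1)}_{\rm off}$; $G^{(n,q+1)}=\frac{n_{\rm rep}-K^{(q+1)}}{n_{\rm rep}}G^{(n,q)}$ for $n\in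 I^{(q)}_{{\rm on},>Z^{(q)}}$; $G^{(n,q+1)}=G^{(P^{(q+1)}(n),q+1)}$ for $n\in I^{(q+1)}_{\rm new}$. (2) Resampling: $X^{(n,q+1)}=X^{(n,q)}$ for $n\in I^{(q)}$; for $n'\in I^{(q+1)}_{\rm new}$, $X^{(n',q+1)}$ is sampled from $\pi_{Z^{(q)}}(X^{(P^{(q+1)}(n'),q)},\cdot)$, independently for different $n'$. (3) Level computation: $Z^{(q+1)}$ is the $k$-th order statistic of $(\Xi(X^{(n,q+1)}))_{n\in I^{(q+1)}_{\rm on}}$; if all $n_{\rm rep}$ working replicas ($n\in I^{(q+1)}_{\rm on}$) satisfy $\Xi(X^{(n,q+1)})\le Z^{(q+1)}$, set instead $Z^{(q+1)}=+\infty$. Then increment $q$. *)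

(* Defs.v *)
From HB Require Import structures.
From mathcomp Require Import all_boot all_order all_algebra.
From mathcomp Require Import all_classical all_reals all_analysis.

Set Implicit Arguments.
Unset Strict Implicit.
Unset Printing Implicit Defensive.

Import Order.TTheory GRing.Theory Num.Theory.
Import numFieldNormedType.Exports.

Local Open Scope classical_set_scope.
Local Open Scope ring_scope.

(* The metric carried by S is one complete metric among others: only its
   topology is used below, through [borel] and [path_space]. *)
Definition polish (R : realType) (S : completePseudoMetricType R) : Prop :=
  hausdorff_space S /\ exists D : set S, countable D /\ dense D.

Notation borel S := (g_sigma_algebraType (@open S)).

(* The space of paths, with the Borel sigma-field of the product topology. *)
Notation path_space S := (g_sigma_algebraType (@open {ptws nat -> S})).

(* Infimum of a set of times; [None] stands for +oo. *)
Definition first_time (E : set nat) : option nat :=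
  if `[< exists t, E t >]
  then Some (xget 0%N [set t | E t /\ forall s, E s -> (t <= s)%N])
  else None.

Definition not_after (t : nat) (T : option nat) : bool :=
  if T is Some T0 then (t <= T0)%N else true.

Definition min_time (t : nat) (T : option nat) : nat :=
  if T is Some T0 then minn t T0 else t.

Section paths.
Context {R : realType} {S : Type} (A : set S) (xi : S -> R).
Implicit Types x : nat -> S.

Definition entrance_time x : option nat := first_time [set t | A (x t)].

Definition stopped x : nat -> S := fun t => x (min_time t (entrance_time x)).

Definition max_level x : \bar R :=
  ereal_sup (range (fun t : nat => (xi (stopped x t))%:E)).

Definition level_time (z : R) x : option nat :=
  first_time [set t | not_after t (entrance_time x) /\ z < xi (x t)].

End paths.

Section processes.
Context {R : realType} {S : ptopologicalType}.
Context {d : measure_display} {Omega : measurableType d}.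

Definition history (Y : nat -> Omega -> borel S) (t : nat) : set (set Omega) :=
  <<s [set E | exists s (D : set (borel S)),
         [/\ (s <= t)%N, measurable D & E = Y s @^-1` D]] >>.

(* Given the past up to time t, Y (t + 1) has law K (Y t). *)
Definition transition_at (m : {measure set Omega -> \bar R})
    (K : S -> set (borel S) -> \bar R) (Y : nat -> Omega -> borel S)
    (t : nat) : Prop :=
  forall (E : set Omega) (D : set (borel S)), history Y t E -> measurable D ->
    (m (E `&` Y t.+1 @^-1` D) = \int[m]_(w in E) K (Y t w) D)%E.

Definition markov_chain (m : {measure set Omega -> \bar R})
    (P : R.-pker (borel S) ~> (borel S)) (x0 : S)
    (Y : nat -> Omega -> borel S) : Prop :=
  [/\ forall t, measurable_fun setT (Y t),
      {ae m, forall w, Y 0%N w = x0} &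
      forall t, transition_at m (fun y D => P y D) Y t].

End processes.

Section resampling.
Context {R : realType} {S : ptopologicalType}.
Context (P : R.-pker (borel S) ~> (borel S)) (A : set (borel S)).
Context (xi : S -> R).

Definition stopped_transition (y : borel S) (D : set (borel S)) : \bar R :=
  if y \in A then \d_y D else P y D.

(* m is the law of the path Y resampled from x above level z: Y is the
   coordinate process of the path space under m. *)
Definition resampled_law (z : R) (x : path_space S)
    (m : {measure set (path_space S) -> \bar R}) : Prop :=
  if level_time A xi z x is Some T then
    {ae m, forall y : path_space S, forall t, (t <= T)%N -> y t = x t} /\
    forall t, (T <= t)%N ->
      transition_at m stopped_transition (fun s (y : path_space S) => y s) t
  else {ae m, forall y : path_space S, forall t, y t = stopped A x t}.

Definition resampling_kernel
    (piz : R.-pker (measurableTypeR R * path_space S)%type ~> (path_space S)) : Prop :=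
  forall (z : R) (x : path_space S), resampled_law z x (piz (z, x)).

End resampling.

(* Sets of labels are represented by duplicate-free lists. The values of
   [weight] and [replica] are meaningful only at the labels in [Ion] or [Ioff]. *)
Record ams_state (R : realType) (S : Type) := AmsState {
  Ion : seq nat;
  Ioff : seq nat;
  weight : nat -> R;
  replica : nat -> nat -> S }.

Section algorithm.
Context {R : realType} {S : Type} (A : set S) (xi : S -> R) (zmax : R).
Context (nrep k : nat).
Implicit Types s : ams_state R S.

Definition order_stat (v : seq (\bar R)) : \bar R :=
  nth +oo%E (sort (fun a b => (a <= b)%E) v) k.-1.

Definition level s : \bar R :=
  let Xi n := max_level A xi (replica s n) in
  let z := order_stat [seq Xi n | n <- Ion s] in
  if all (fun n => (Xi n <= z)%E) (Ion s) then +oo%E else z.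

Definition stops s : bool := (zmax%:E < level s)%E.

Definition killed s : seq nat :=
  [seq n <- Ion s | (max_level A xi (replica s n) <= level s)%E].

Definition survivors s : seq nat :=
  [seq n <- Ion s | (level s < max_level A xi (replica s n))%E].

Definition labels s : seq nat := Ion s ++ Ioff s.

(* No label is created once the stopping criterion is met. *)
Definition new_labels s : seq nat :=
  if stops s then [::] else iota (size (labels s)).+1 (size (killed s)).

Definition init_labels : seq nat := iota 1 nrep.

Definition ams_init (X : nat -> nat -> S) : ams_state R S :=
  {| Ion := init_labels;
     Ioff := [::];
     weight := fun=> nrep%:R^-1;
     replica := X |}.

(* One iteration, given the parents and the resampled paths of the new labels;
   the state is frozen once the stopping criterion is met. *)
Definition ams_step (parent : nat -> nat) (Y : nat -> nat -> S) s :
    ams_state R S :=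
  if stops s then s else
  let w n := if n \in survivors s
             then (nrep%:R - (size (killed s))%:R) / nrep%:R * weight s n
             else weight s n in
  {| Ion := survivors s ++ new_labels s;
     Ioff := Ioff s ++ killed s;
     weight := fun n => if n \in new_labels s then w (parent n) else w n;
     replica := fun n => if n \in new_labels s then Y n else replica s n |}.

Definition estimate (phi : (nat -> S) -> R) s : R :=
  \sum_(n <- labels s) weight s n * phi (replica s n).

End algorithm.

(* The draws of a run of the algorithm:
   - X0 n is the path of the initial replica n;
   - parent q n and Y q n are the parent and the path drawn at iteration q for
     the label n, when n is one of the labels created at that iteration. *)
Section run.
Context {R : realType} {S : ptopologicalType}.
Context (A : set (borel S)) (xi : S -> R) (zmax : R) (nrep k : nat).
Context {d : measure_display} {Omega : measurableType d}.
Context (X0 : nat -> Omega -> path_space S).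
Context (parent : nat -> nat -> Omega -> nat).
Context (Y : nat -> nat -> Omega -> path_space S).

Fixpoint ams_run (q : nat) (w : Omega) : ams_state R S :=
  if q is q'.+1
  then ams_step A xi zmax nrep k (fun n => parent q' n w) (fun n => Y q' n w)
         (ams_run q' w)
  else ams_init nrep (fun n => X0 n w).

Definition created (q : nat) (w : Omega) : seq nat :=
  new_labels A xi zmax k (ams_run q w).

Definition num_iter (w : Omega) : option nat :=
  first_time [set q | stops A xi zmax k (ams_run q w)].

(* The value 0 given on the event that the algorithm never stops is a dummy. *)
Definition ams_estimator (phi : path_space S -> R) (w : Omega) : R :=
  if num_iter w is Some q then estimate phi (ams_run q w) else 0.

(* The sigma-field of everything generated before iteration q. *)
Definition generated (q : nat) : set (set Omega) :=
  <<s [set E | exists n (C : set (path_space S)),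
         [/\ n \in init_labels nrep, measurable C & E = X0 n @^-1` C]]
      `|` [set E | exists r n p, (r < q)%N /\
             E = [set w | n \in created r w /\ parent r n w = p]]
      `|` [set E | exists r n (C : set (path_space S)),
             [/\ (r < q)%N, measurable C &
                 E = [set w | n \in created r w /\ C (Y r n w)]]] >>.

Record ams_draws (Pr : probability Omega R) (pi : probability (path_space S) R)
    (piz : R.-pker (measurableTypeR R * path_space S)%type ~> (path_space S)) : Prop := {
  measurable_init : forall n, measurable_fun setT (X0 n);
  measurable_parent : forall q n, measurable_fun setT (parent q n);
  measurable_resampled : forall q n, measurable_fun setT (Y q n);
  init_iid : forall C : nat -> set (path_space S), (forall n, measurable (C n)) ->
    Pr [set w | forall n, n \in init_labels nrep -> C n (X0 n w)] =
    (\prod_(n <- init_labels nrep) fine (pi (C n)))%:E;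
  (* Joint law, given everything generated before iteration q, of the parents
     and of the paths of the new labels n: independently for different n, the
     parent is uniform on the survivors and, given the parent p, the path has
     law pi_Z (X^(p), .). When iteration q takes place, the level is a real
     number, so that [fine] is harmless. *)
  step_law : forall q (E : set Omega) (p : nat -> nat) (C : nat -> set (path_space S)),
    generated q E -> (forall n, measurable (C n)) ->
    Pr (E `&` [set w | forall n, n \in created q w ->
                         parent q n w = p n /\ C n (Y q n w)]) =
    (\int[Pr]_(w in E)
      (let s := ams_run q w in
       let alive := survivors A xi k s in
       \prod_(n <- created q w)
         ((if p n \in alive then (size alive)%:R^-1 else 0) *
          fine (piz (fine (level A xi k s), replica s (p n) : path_space S) (C n))))%:E)%E
}.

End run.

(* Main.v *)
(* Record the run up to iteration q by its history h: the surviving labels, the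
   killed labels and the parents at each iteration. There are countably many
   histories, and on the event of a history the working replicas almost surely
   have the same deterministic weight c. The key invariant, proved by induction on h, is
   that on this event the law of the configuration does not change when one
   working replica is resampled above the last level. A new replica satisfies it
   because resampling is idempotent. An old one satisfies it because, given the
   other replicas, the history only says that this replica exceeds the last
   level, and resampling above a level that has been reached does not affect the
   draws made from it; the induction starts from pi piz_z = pi, the Markov
   property of the stopped chain.

   Let an iteration kill K of the nrep working replicas. Each of the K new paths
   has, by the invariant, the mean of phi over the nrep - K survivors, so that the
   new terms of the estimator, of weight c (nrep - K) / nrep, make up in
   expectation for the weight c K / nrep lost by each survivor. Hence the
   expectation of the estimator frozen after q iterations does not depend on q;
   it is pi(phi) at q = 0. The total weight is 1, so dominated convergence
   applies as q tends to infinity. *)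

Require Import Defs.
From HB Require Import structures.
From mathcomp Require Import all_boot all_order all_algebra.
From mathcomp Require Import all_classical all_reals all_analysis measurable_realfun.
From mathcomp Require Import ring.

Set Implicit Arguments.
Unset Strict Implicit.
Unset Printing Implicit Defensive.

Import Order.TTheory GRing.Theory Num.Theory.
Import numFieldNormedType.Exports.

Local Open Scope classical_set_scope.
Local Open Scope ring_scope.

(** * The Borel sigma-field of the path space *)

(** Two dependences have to be controlled. First, the next level depends on all working replicas,
    including the one that is redrawn. But replacing a survivor by another path above the level
    keeps the level, the survivors and the killed labels; with the other replicas frozen, the random
    level is a constant z0 on the event of the splitting. Secondly, a resampling at z0 has to be
    absorbed by the kernel of the preceding iteration, which requires z0 to lie above the preceding
    level. This is why the invariant also carries the almost sure statement that every working
    replica exceeds the preceding level: z0 is attained by a killed replica.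

    Conditional laws appear as equalities between integrals of nonnegative functions over events,
    checked on rectangles. A history makes every random set of labels deterministic: on its event
    the configuration is a fixed family of draws, to which the conditional law of the draws
    applies. *)

Lemma polish_base (R : realType) (S : completePseudoMetricType R) :
  polish S -> exists V : nat -> set S, (forall i, open (V i)) /\
    forall x U, nbhs x U -> exists i, V i x /\ V i `<=` U.
Proof.
move=> [_ [D [cD dD]]].
have [p Dp] : D !=set0.
  have [x [_ Dx]] := dD setT (ex_intro _ point I) openT.
  by exists x.
have /pfcard_geP[D0|[f]] := cD; first by move: Dp; rewrite D0.
pose V (c : nat * nat) : set S := (ball (f c.1) (c.2.+1%:R^-1 / 2))°.
exists (fun i => V (odflt (0, 0)%N (unpickle i))); split.
  by move=> i; exact: open_interior.
move=> x U /nbhs_ballP[e /= e0 eU].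
have [n _ /(_ n (leqnn n)) ne] := near_infty_natSinv_lt (PosNum e0).
have r0 : 0 < n.+1%:R^-1 / 2 :> R by rewrite divr_gt0.
(* The centre is a point of [D] within a quarter of 1/(n+1) of x: the ball of half that length about
   it is a neighbourhood of x and lies within 1/(n+1) < e of x. *)
have r40 : 0 < n.+1%:R^-1 / 2 / 2 :> R by rewrite divr_gt0.
have [y [xy Dy]] : (ball x (n.+1%:R^-1 / 2 / 2))° `&` D !=set0.
  apply: dD (open_interior _).
  by exists x; apply: nbhs_singleton; apply: nbhs_interior; exact: nbhsx_ballx.
have [i _ fi] := @surj _ _ setT D f y Dy.
exists (pickle (i, n)); rewrite pickleK /=.
rewrite /V /= fi; split.
  apply/nbhs_ballP; exists (n.+1%:R^-1 / 2 / 2) => //= z xz.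
  rewrite (splitr (_ / 2)); apply: ball_triangle xz.
  by apply: ball_sym; exact: interior_subset.
move=> z /interior_subset yz; apply: eU; apply: le_ball (ltW ne) _ _.
rewrite (splitr n.+1%:R^-1); apply: ball_triangle yz.
apply: le_ball (interior_subset xy).
by rewrite ler_pdivrMr// ler_peMr ?ltW// ltr1n.
Qed.

Definition cylinder (T : Type) (t : nat) (C : nat -> set T) : set (nat -> T) :=
  [set y | forall s, (s <= t)%N -> C s (y s)].

Definition path_cylinders (S : ptopologicalType) : set (set (nat -> S)) :=
  [set E | exists t (C : nat -> set (borel S)),
    (forall s, measurable (C s)) /\ E = cylinder t C].

Lemma measurable_coordinate (S : ptopologicalType) (t : nat) :
  measurable_fun setT ((fun y => y t) : path_space S -> borel S).
Proof.
apply: (@measurability _ _ (path_space S) (borel S) setT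
  (fun y : path_space S => y t) (@open S)) => //.
move=> _ [B oB <-]; rewrite setTI.
apply: sub_sigma_algebra; apply: open_comp oB => x _.
exact: (@proj_continuous nat (fun _ => S) t).
Qed.

Lemma measurable_cylinder (S : ptopologicalType) t (C : nat -> set (borel S)) :
  (forall s, measurable (C s)) ->
  measurable (cylinder t C : set (path_space S)).
Proof.
move=> mC.
rewrite (_ : cylinder t C = \bigcap_(s in [set s | (s <= t)%N])
   ((fun y : path_space S => y s) @^-1` C s)); last by [].
apply: bigcap_measurable; first by exists 0%N.
move=> s _; rewrite -[X in measurable X]setTI.
exact: measurable_coordinate.
Qed.

Lemma setI_closed_path_cylinders (S : ptopologicalType) :
  setI_closed (@path_cylinders S).
Proof.
move=> _ _ [t [C [mC ->]]] [u [D [mD ->]]].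
exists (maxn t u), (fun s => (if (s <= t)%N then C s else setT) `&`
                         (if (s <= u)%N then D s else setT)); split.
  by move=> s; apply: measurableI; case: ifP.
apply/seteqP; split=> y.
  move=> [Cy Dy] s _; split; case: ifP => // ?; [exact: Cy|exact: Dy].
move=> h; split=> s sle.
  by have [] := h s (leq_trans sle (leq_maxl _ _)); rewrite sle.
by have [_] := h s (leq_trans sle (leq_maxr _ _)); rewrite sle.
Qed.

(** Second countability is the point: an open set of the product is the union of the cylinders over
    base sets that it contains, and these are indexed by finite sequences of indices, hence
    countably many. *)
Lemma path_space_measurableE (R : realType) (S : completePseudoMetricType R) :
  polish S -> (measurable : set (set (path_space S))) = <<s @path_cylinders S >>.
Proof.
move=> /polish_base[V [oV Vb]].
apply/seteqP; split; last first.
  apply: smallest_sub; first exact: sigma_algebra_measurable.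
  by move=> _ [t [C [mC ->]]]; exact: measurable_cylinder.
apply: smallest_sub; first exact: smallest_sigma_algebra.
move=> U oU.
pose cyl (l : seq nat) : set (nat -> S) :=
  [set y | forall s, (s < size l)%N -> V (nth 0%N l s) (y s)].
have -> : U = \bigcup_(l in [set: seq nat])
    (if `[< cyl l `<=` U >] then cyl l else set0).
  apply/seteqP; split; last first.
    by move=> y [l _]; case: asboolP => // + cy; apply.
  move=> x Ux.
  (* The cylinders around x are a filter base converging to x coordinatewise, so the open set [U]
     contains one of them. *)
  pose F : set_system {ptws nat -> S} := filter_from [set l | cyl l x] cyl.
  have exV : forall y : S, exists i, V i y by
    move=> y; have [i [Viy _]] := Vb y setT filterT; exists i.
  have FF : Filter F.
    apply: filter_from_filter; first by exists [::].
    move=> l1 l2 cl1 cl2.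
    have /choice[f fP] : forall s, exists i, V i (x s) /\
        V i `<=` [set z | ((s < size l1)%N -> V (nth 0%N l1 s) z) /\
                          ((s < size l2)%N -> V (nth 0%N l2 s) z)].
      move=> s; apply: Vb; apply: filterI.
        have [ls|ls] := boolP (s < size l1)%N; last by apply: filterE => z.
        have := open_nbhs_nbhs (conj (oV (nth 0%N l1 s)) (cl1 _ ls)).
        by apply: filterS => z.
      have [ls|ls] := boolP (s < size l2)%N; last by apply: filterE => z.
      have := open_nbhs_nbhs (conj (oV (nth 0%N l2 s)) (cl2 _ ls)).
      by apply: filterS => z.
    exists (mkseq f (maxn (size l1) (size l2))).
      by move=> s; rewrite size_mkseq => sl; rewrite nth_mkseq//; apply: (fP s).1.
    move=> y; rewrite /cyl /= size_mkseq => h; split=> s sl.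
      have sm : (s < maxn (size l1) (size l2))%N by rewrite leq_max sl.
      by have := h s sm; rewrite nth_mkseq// => /(fP s).2[+ _]; apply.
    have sm : (s < maxn (size l1) (size l2))%N by rewrite leq_max sl orbT.
    by have := h s sm; rewrite nth_mkseq// => /(fP s).2[_]; apply.
  have /choice[g gP] := exV.
  have : {ptws, F --> (x : {ptws nat -> S})}.
    apply/pointwise_cvgP => t W xW.
    have [i [Vix VW]] := Vb _ _ xW.
    exists (rcons (mkseq (fun s => g (x s)) t) i).
      move=> s; rewrite size_rcons size_mkseq nth_rcons size_mkseq.
      rewrite ltnS leq_eqVlt => /orP[/eqP->|st]; first by rewrite ltnn eqxx.
      by rewrite st nth_mkseq.
    move=> y /(_ t); rewrite size_rcons size_mkseq nth_rcons size_mkseq.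
    by rewrite ltnn eqxx ltnSn => /(_ isT); exact: VW.
  move=> /(_ U); case; first by apply: open_nbhs_nbhs; split.
  by move=> l xl lU; exists l => //; case: asboolP.
apply: (@countable_bigcupT_measurable _
  (g_sigma_algebraType (@path_cylinders S))) => [|l].
  exact: countableP.
case: ifP => _; last exact: (@sigma_algebra0 _ setT (@path_cylinders S)).
apply: sub_sigma_algebra.
(* [path_cylinders] constrains the times up to t included, [cyl] those below [size l]; the empty
   sequence is treated apart, as the whole space. *)
case: l => [|a l].
  exists 0%N, (fun=> setT); split => //.
  by apply/seteqP; split.
exists (size l), (fun s => V (nth 0%N (a :: l) s)); split => // s.
by apply: sub_sigma_algebra; exact: oV.
Qed.

(** * Kernels *)

Section kernel_precomposition.
Context d1 d2 d3 (X : measurableType d1) (Y : measurableType d2)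
  (Z : measurableType d3) (R : realType).
Variables (k : R.-pker Y ~> Z) (f : X -> Y).

(** The measurability proof is an argument so that the kernel structure can be inferred from the
    term alone. *)
Definition kernel_precomp of measurable_fun setT f :
  X -> {measure set Z -> \bar R} := fun x => k (f x).

Hypothesis mf : measurable_fun setT f.

Let measurable_kernel_precomp U : measurable U ->
  measurable_fun setT (fun x => kernel_precomp mf x U : \bar R).
Proof.
by move=> mU; exact: (measurableT_comp (measurable_kernel k _ mU) mf).
Qed.

HB.instance Definition _ :=
  isKernel.Build _ _ _ _ _ (kernel_precomp mf) measurable_kernel_precomp.

Let prob_kernel_precomp x : kernel_precomp mf x setT = 1%E.
Proof. exact: prob_kernel. Qed.

HB.instance Definition _ := Kernel_isProbability.Build _ _ _ _ _
  (kernel_precomp mf) prob_kernel_precomp.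

End kernel_precomposition.

Section mixture.
Local Open Scope ereal_scope.
Context d1 d2 d3 (X : measurableType d1) (Y : measurableType d2)
  (T : measurableType d3) (R : realType).
Context (m : {measure set X -> \bar R}) (k : R.-pker X ~> Y).
Context (psi : X -> R) (g : X * Y -> T) (D : set X).
Hypotheses (mD : measurable D) (mpsi : measurable_fun setT psi)
  (psi0 : forall x, (0 <= psi x)%R) (mg : measurable_fun setT g).

(* The phantom arguments are the hypotheses under which this is a measure. *)
Definition mixture of measurable D & measurable_fun setT psi &
    (forall x, (0 <= psi x)%R) & measurable_fun setT g : set T -> \bar R :=
  fun U => \int[m]_(x in D) ((psi x)%:E * k x [set y | U (g (x, y))]).

Lemma measurable_kernel_section (F : X * Y -> \bar R) :
  (forall z, 0 <= F z) -> measurable_fun setT F ->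
  measurable_fun setT (fun x => \int[k x]_y F (x, y)).
Proof. by move=> F0 mF; exact: (measurable_fun_integral_finite_kernel F k). Qed.

Let mgx x : measurable_fun setT (fun y => g (x, y)).
Proof. exact: measurableT_comp mg (pair1_measurable x). Qed.

Let mslice U x : measurable U -> measurable [set y | U (g (x, y))].
Proof. by move=> mU; rewrite -[X in measurable X]setTI; exact: mgx. Qed.

Let mkslice U : measurable U ->
  measurable_fun setT (fun x => k x [set y | U (g (x, y))]).
Proof.
move=> mU.
rewrite (_ : (fun x => _) =
    (fun x => \int[k x]_y ((\1_(g @^-1` U) (x, y))%:E))); last first.
  apply/funext => x; rewrite -[X in _ = X]/(\int[k x]_y
    ((\1_[set y | U (g (x, y))] y)%:E)) integral_indic ?setIT//.
  exact: mslice.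
apply: (measurable_kernel_section (F := fun z => (\1_(g @^-1` U) z)%:E)).
  by move=> z; rewrite lee_fin.
apply/measurable_EFinP; apply: measurable_indic.
by rewrite -[X in measurable X]setTI; exact: mg.
Qed.

Local Notation mix := (mixture mD mpsi psi0 mg).

Let mix0 : mix set0 = 0.
Proof. by apply: integral0_eq => x _; rewrite measure0 mule0. Qed.

Let mix_ge0 U : 0 <= mix U.
Proof. by apply: integral_ge0 => x _; by apply: mule_ge0; rewrite ?lee_fin. Qed.

Let mix_sigma_additive : semi_sigma_additive mix.
Proof.
move=> U mU tU mUU; rewrite /mixture [X in _ --> X](_ : _ =
  \int[m]_(x in D) (\sum_(n <oo) (psi x)%:E * k x [set y | U n (g (x, y))]));
  last first.
  apply: eq_integral => x _.
  rewrite nneseriesZl//; congr (_ * _).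
  apply/esym/cvg_lim => //.
  have := @measure_semi_sigma_additive _ _ _ (k x)
    (fun n => [set y | U n (g (x, y))]).
  rewrite (_ : \bigcup_n [set y | U n (g (x, y))] =
    [set y | (\bigcup_n U n) (g (x, y))])//; apply.
  - by move=> n; exact: mslice.
  - apply/trivIsetP => i j _ _ ij.
    move/trivIsetP : tU => /(_ i j Logic.I Logic.I ij) h.
    by apply/seteqP; split => // y; rewrite /= -[False]/(set0 (g (x, y))) -h.
  - by rewrite -[X in measurable X]/[set y | (\bigcup_n U n) (g (x, y))];
      exact: mslice.
apply/cvg_closeP; split.
  apply: is_cvg_nneseries => n _ _; apply: integral_ge0 => x _.
  by apply: mule_ge0; rewrite ?lee_fin.
rewrite closeE// integral_nneseries//.
- move=> n; apply: measurable_funTS; apply: emeasurable_funM; first exact/measurable_EFinP.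
  exact: mkslice.
- by move=> n x _; by apply: mule_ge0; rewrite ?lee_fin.
Qed.

HB.instance Definition _ := isMeasure.Build _ _ _
  mix mix0 mix_ge0 mix_sigma_additive.

Import HBNNSimple.

Let intk (F : T -> \bar R) x := \int[k x]_y F (g (x, y)).

Let mintk F : (forall t, 0 <= F t) -> measurable_fun setT F ->
  measurable_fun setT (intk F).
Proof.
move=> F0 mF; apply: (measurable_kernel_section (F := F \o g)).
  by move=> z; exact: F0.
exact: measurableT_comp mF mg.
Qed.

Lemma measurable_mixture_integrand (F : T -> \bar R) :
  (forall t, 0 <= F t) -> measurable_fun setT F ->
  measurable_fun D (fun x => (psi x)%:E * \int[k x]_y F (g (x, y))).
Proof.
move=> F0 mF; apply: measurable_funTS; apply: emeasurable_funM; first exact/measurable_EFinP.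
exact: mintk.
Qed.

Let integral_mix_indic U : measurable U ->
  \int[mix]_t (\1_U t)%:E = \int[m]_(x in D) ((psi x)%:E * intk (EFin \o \1_U) x).
Proof.
move=> mU; rewrite integral_indic// setIT.
apply: eq_integral => x _; congr (_ * _).
rewrite /intk -[RHS]/(\int[k x]_y
    ((\1_[set y | U (g (x, y))] y)%:E)) integral_indic ?setIT//.
exact: mslice.
Qed.

Let integral_mix_nnsfun (h : {nnsfun T >-> R}) :
  \int[mix]_t (h t)%:E = \int[m]_(x in D) ((psi x)%:E * intk (EFin \o h) x).
Proof.
have mh r : measurable (h @^-1` [set r]) by exact: measurable_sfunP.
have ge0 r t : 0 <= (r * \1_(h @^-1` [set r]) t)%:E.
  by rewrite EFinM nnfun_muleindic_ge0.
have mind r : measurable_fun setT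
    (fun t => (r * \1_(h @^-1` [set r]) t)%:E : \bar R).
  by apply/measurable_EFinP; exact: measurable_funM.
transitivity (\sum_(r \in range h)
    \int[mix]_t (r * \1_(h @^-1` [set r]) t)%:E).
  under eq_integral do rewrite fimfunE -fsumEFin//.
  by rewrite ge0_integral_fsum.
transitivity (\sum_(r \in range h) \int[m]_(x in D)
    ((psi x)%:E * intk (fun t => (r * \1_(h @^-1` [set r]) t)%:E) x)).
  apply: eq_fsbigr => r; rewrite inE => -[t0 _ hr].
  have r0 : (0 <= r)%R by rewrite -hr.
  rewrite (eq_integral (fun t => r%:E * (\1_(h @^-1` [set r]) t)%:E)) //.
  rewrite ge0_integralZl_EFin//; last exact/measurable_EFinP.
  rewrite integral_mix_indic// -ge0_integralZl_EFin//; last 2 first.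
  - move=> x _; apply: mule_ge0; first (by rewrite lee_fin).
    by apply: integral_ge0 => y _; rewrite lee_fin.
  - apply: measurable_mixture_integrand; last exact/measurable_EFinP.
    by move=> t; rewrite lee_fin.
  apply: eq_integral => x _; rewrite muleCA; congr (_ * _).
  rewrite /intk [RHS](eq_integral
    (fun y => r%:E * (\1_(h @^-1` [set r]) (g (x, y)))%:E)) //.
  rewrite ge0_integralZl_EFin//.
  by apply/measurable_EFinP; apply: measurableT_comp.
transitivity (\int[m]_(x in D) \sum_(r \in range h)
    ((psi x)%:E * intk (fun t => (r * \1_(h @^-1` [set r]) t)%:E) x)).
  rewrite ge0_integral_fsum//.
  - by move=> r; exact: measurable_mixture_integrand.
  - by move=> r x _; apply: mule_ge0; first (by rewrite lee_fin); exact: integral_ge0.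
apply: eq_integral => x _.
rewrite -ge0_mule_fsumr; last by move=> r; exact: integral_ge0.
congr (_ * _).
rewrite /intk -ge0_integral_fsum//.
- by apply: eq_integral => y _ /=; rewrite fimfunE -fsumEFin.
- by move=> r; exact: measurableT_comp (mind r) (mgx x).
Qed.

(** The mixture is given by its values on sets, so the formula is obtained for indicators, simple
    functions and increasing limits in turn. *)
Lemma integral_mixture (F : T -> \bar R) :
  (forall t, 0 <= F t) -> measurable_fun setT F ->
  \int[mix]_t F t = \int[m]_(x in D) ((psi x)%:E * \int[k x]_y F (g (x, y))).
Proof.
move=> F0 mF.
pose F_ := nnsfun_approx measurableT mF.
have F_F t : (F_ n t)%:E @[n --> \oo] --> F t by exact: cvg_nnsfun_approx.
have ndF t : {homo (fun n => (F_ n t)%:E) : a b / (a <= b)%N >-> a <= b}.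
  by move=> a b ab; rewrite lee_fin; exact/lefP/nd_nnsfun_approx.
have mF_ n : measurable_fun setT (EFin \o F_ n) by exact/measurable_EFinP.
have F_0 n t : 0 <= (EFin \o F_ n) t by rewrite lee_fin.
have mF_x n x : measurable_fun setT (fun y => (F_ n (g (x, y)))%:E).
  exact: measurableT_comp (mF_ n) (mgx x).
transitivity (limn (fun n => \int[mix]_t (F_ n t)%:E)).
  rewrite -monotone_convergence//; last by move=> n t _; exact: F_0.
  by apply: eq_integral => t _; apply/esym/cvg_lim.
transitivity (limn (fun n => \int[m]_(x in D)
    ((psi x)%:E * intk (EFin \o F_ n) x))).
  by congr (limn _); apply/funext => n; rewrite integral_mix_nnsfun.
have intk_mono x : {homo (fun n => intk (EFin \o F_ n) x) :
    a b / (a <= b)%N >-> a <= b}.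
  move=> a b ab; apply: ge0_le_integral => //.
  - exact: mF_x.
  - exact: mF_x.
  - by move=> y _; exact: ndF.
rewrite -monotone_convergence//; last 3 first.
- by move=> n; exact: measurable_mixture_integrand.
- by move=> n x _; apply: mule_ge0; first (by rewrite lee_fin); exact: integral_ge0.
- by move=> x _ a b ab; apply: lee_wpmul2l; [rewrite lee_fin|exact: intk_mono].
apply: eq_integral => x _.
have : intk (EFin \o F_ n) x @[n --> \oo] --> \int[k x]_y F (g (x, y)).
  rewrite [X in _ --> X](_ : _ =
    \int[k x]_y limn (fun n => (F_ n (g (x, y)))%:E)); last first.
    by apply: eq_integral => y _; apply/esym/cvg_lim.
  apply: cvg_monotone_convergence => //.
  - by move=> n; exact: mF_x.
  - by move=> y _ a b; exact: ndF.
by move=> cvgi; apply/cvg_lim => //; exact: cvgeZl.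
Qed.

End mixture.

Lemma ge0_integral_restr_comp d d' (X : measurableType d)
    (T : measurableType d') (R : realType) (m : {measure set X -> \bar R})
    (D : set X) (mD : measurable D) (f : X -> T) (F : T -> \bar R) :
  measurable_fun setT f -> measurable_fun setT F -> (forall t, 0 <= F t)%E ->
  (\int[pushforward (mrestr m mD) f]_t F t = \int[m]_(x in D) F (f x))%E.
Proof.
move=> mf mF F0; rewrite ge0_integral_pushforward//.
rewrite preimage_setT [LHS](@ge0_negligible_integral _ _ _ _ _ (~` D))//=.
- rewrite setTD setCK; apply: eq_measure_integral => U _ UD.
  by rewrite /= /mrestr setIidl.
- exact: measurableC.
- exact: measurableT_comp mF mf.
- by rewrite /mrestr setICl.
Qed.

Section disintegration.
Local Open Scope ereal_scope.
Context d1 d2 d3 (X : measurableType d1) (Y : measurableType d2)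
  (T : measurableType d3) (R : realType).
Context (m : {finite_measure set X -> \bar R}) (k : R.-pker X ~> Y).
Context (psi : X -> R) (f : X -> T) (g : X * Y -> T) (D D' : set X).
Hypotheses (mD : measurable D) (mD' : measurable D')
  (mpsi : measurable_fun setT psi) (psi0 : forall x, (0 <= psi x)%R)
  (mf : measurable_fun setT f) (mg : measurable_fun setT g).

(** Both sides are integrals of [F] against finite measures on [T]: the image of [m] restricted to
    [D], and a mixture. Agreement on a generating family closed under intersection is therefore
    enough. This turns a conditional law known on rectangles into a formula for integrals. *)
Lemma disintegration (G : set (set T)) :
  (measurable : set (set T)) = <<s G >> -> setI_closed G -> G setT ->
  (forall U, G U -> m (D `&` f @^-1` U) =
     \int[m]_(x in D') ((psi x)%:E * k x [set y | U (g (x, y))])) ->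
  forall F : T -> \bar R, (forall t, 0 <= F t) -> measurable_fun setT F ->
  \int[m]_(x in D) F (f x) =
  \int[m]_(x in D') ((psi x)%:E * \int[k x]_y F (g (x, y))).
Proof.
move=> sG GI GT mG F F0 mF.
rewrite -(integral_mixture m k mD' mpsi psi0 mg)//.
rewrite -(ge0_integral_restr_comp m mD mf mF F0).
apply: eq_measure_integral => U mU _.
apply: (measure_unique G (fun=> setT)) => //.
- by rewrite bigcup_const//; exists 0%N.
- by move=> V GV; rewrite /= /pushforward /mrestr /mixture -mG// setIC.
- move=> _; rewrite /= /pushforward /mrestr preimage_setT setTI.
  by rewrite -ge0_fin_numE// fin_num_measure.
Qed.

End disintegration.

(** * Entrance times and maximum levels *)

Lemma first_time_Some (E : set nat) t :
  first_time E = Some t <-> E t /\ forall s, (s < t)%N -> ~ E s.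
Proof.
rewrite /first_time; case: asboolP => [[u Eu]|nE]; last first.
  by split => // -[Et _]; case: nE; exists t.
have [v [Ev vmin]] : [set t | E t /\ forall s, E s -> (t <= s)%N] !=set0.
  have ex : exists n, `[< E n >] by exists u; exact/asboolP.
  exists (ex_minn ex); case: ex_minnP => n /asboolP En nmin.
  by split=> // s Es; apply: nmin; exact/asboolP.
have [xE xmin] := xgetI 0%N (conj Ev vmin : [set t | E t /\ forall s, E s -> (t <= s)%N] v).
set x := xget _ _ in xE xmin *.
split=> [[<-]|[Et tmin]].
  by split => // s sx /xmin; rewrite leqNgt sx.
congr Some; apply/eqP; rewrite eqn_leq xmin//= leqNgt.
by apply/negP => /tmin.
Qed.

Lemma first_time_None (E : set nat) :
  first_time E = None <-> forall t, ~ E t.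
Proof.
rewrite /first_time; case: asboolP => [[u Eu]|nE]; split => //.
  by move=> /(_ u).
by move=> _ t Et; apply: nE; exists t.
Qed.

Lemma not_after_first_time (E : set nat) t :
  not_after t (first_time E) <-> forall s, (s < t)%N -> ~ E s.
Proof.
case H : (first_time E) => [T|] /=.
  move/first_time_Some : H => [ET Tmin]; split.
    by move=> tT s st; apply: Tmin; exact: leq_trans tT.
  by move=> h; rewrite leqNgt; apply/negP => /h.
by move/first_time_None : H => nE; split.
Qed.

Section path_levels.
Context {R : realType} {S : Type} (A : set S) (xi : S -> R).
Implicit Types (x y : nat -> S) (z : R) (t T : nat).

Lemma not_after_entranceP x t :
  not_after t (entrance_time A x) <-> forall s, (s < t)%N -> ~ A (x s).
Proof. exact: not_after_first_time. Qed.

Lemma level_time_SomeP z x T :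
  level_time A xi z x = Some T <->
  [/\ forall s, (s < T)%N -> ~ A (x s), z < xi (x T) &
      forall s, (s < T)%N -> xi (x s) <= z].
Proof.
rewrite /level_time first_time_Some /=; split.
  move=> [[/not_after_entranceP nA zT] h]; split => // s sT.
  rewrite leNgt; apply/negP => zs; apply: (h s sT); split => //.
  by apply/not_after_entranceP => r rs; apply: nA; exact: ltn_trans sT.
move=> [nA zT h]; split; first by split => //; exact/not_after_entranceP.
by move=> s sT [_]; rewrite ltNge h.
Qed.

Lemma level_time_NoneP z x :
  level_time A xi z x = None <->
  forall t, (forall s, (s < t)%N -> ~ A (x s)) -> xi (x t) <= z.
Proof.
rewrite /level_time first_time_None /=; split=> h t.
  move=> /not_after_entranceP nA; rewrite leNgt; apply/negP => zt.
  by apply: (h t).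
by move=> [/not_after_entranceP /h]; rewrite leNgt => /negP.
Qed.

Lemma level_time_eq z x y T : level_time A xi z x = Some T ->
  (forall t, (t <= T)%N -> y t = x t) -> level_time A xi z y = Some T.
Proof.
move=> /level_time_SomeP[nA zT h] yx; apply/level_time_SomeP; split.
- by move=> s sT; rewrite yx ?(ltnW sT)//; exact: nA.
- by rewrite yx.
- by move=> s sT; rewrite yx ?(ltnW sT)//; exact: h.
Qed.

Lemma stopped_before x t : (forall s, (s < t)%N -> ~ A (x s)) ->
  stopped A x t = x t.
Proof.
move=> /not_after_entranceP; rewrite /stopped /min_time.
by case: (entrance_time A x) => //= T /minn_idPl ->.
Qed.

Lemma stopped_after x s t : (s <= t)%N -> A (stopped A x s) ->
  stopped A x t = stopped A x s.
Proof.
rewrite /stopped /min_time.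
case H : (entrance_time A x) => [T|] /= st; last first.
  by move: H => /first_time_None nA /nA.
move: H => /first_time_Some[AT Tmin].
have [sT|Ts] := ltnP s T; first by move=> /(Tmin _ sT).
by rewrite (minn_idPr (leq_trans Ts st)).
Qed.

Lemma stopped_hit x s t : (s <= t)%N -> A (x s) -> A (stopped A x t).
Proof.
move=> st As; rewrite /stopped /min_time.
case H : (entrance_time A x) => [T|] /=; last first.
  by move: H => /first_time_None /(_ s).
move: H => /first_time_Some[AT Tmin]; rewrite (minn_idPr _)// (leq_trans _ st)//.
by rewrite leqNgt; apply/negP => /Tmin.
Qed.

Lemma stopped_stopped x : stopped A (stopped A x) = stopped A x.
Proof.
apply/funext => t.
rewrite {1}/stopped /min_time.
case H : (entrance_time A (stopped A x)) => [T|] //.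
move: H => /first_time_Some[AT Tmin].
by case: (leqP t T) => // Tt; rewrite (stopped_after (ltnW Tt)).
Qed.

Lemma stopped_exists x t : exists2 s, stopped A x t = x s &
  forall r, (r < s)%N -> ~ A (x r).
Proof.
rewrite /stopped; exists (min_time t (entrance_time A x)) => //.
apply/not_after_entranceP; rewrite /min_time.
by case: (entrance_time A x) => //= T; rewrite geq_minr.
Qed.

Lemma level_time_stopped z x : level_time A xi z x = None ->
  level_time A xi z (stopped A x) = None.
Proof.
move=> /level_time_NoneP h; apply/level_time_NoneP => t _.
by have [s -> /h] := stopped_exists x t.
Qed.

(** A supremum strictly above z is witnessed by a value strictly above z at some time; the strict
    inequality in [level_time] is what makes this an equivalence. *)
Lemma max_level_gtP z x :
  (z%:E < max_level A xi x)%E <-> level_time A xi z x <> None.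
Proof.
split.
  move=> /ereal_sup_gt[_ [t _ <-]]; rewrite lte_fin => zt /level_time_NoneP h.
  by have [s es /h] := stopped_exists x t; rewrite -es leNgt zt.
case H : (level_time A xi z x) => [T|] // _.
move: H => /level_time_SomeP[nA zT _].
apply: (@lt_le_trans _ _ (xi (stopped A x T))%:E).
  by rewrite lte_fin stopped_before.
by apply: ereal_sup_ubound; exists T.
Qed.

Lemma max_level_gtNy x : (-oo < max_level A xi x)%E.
Proof.
apply: lt_le_trans (ltNyr (xi (stopped A x 0))) _.
by apply: ereal_sup_ubound; exists 0%N.
Qed.

End path_levels.

Section path_measurability.
Context {R : realType} {S : completePseudoMetricType R} (S_polish : polish S).
Context (A : set (borel S)) (mA : measurable A).

Lemma measurable_path d (T : measurableType d) (f : T -> path_space S) :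
  (forall t, measurable_fun setT (fun w => f w t : borel S)) ->
  measurable_fun setT f.
Proof.
move=> mf.
apply: (@measurability _ _ T (path_space S) setT f (@path_cylinders S)).
  exact: path_space_measurableE.
move=> _ [_ [t [C [mC ->]]] <-].
rewrite (_ : _ `&` _ = \bigcap_(s in [set s | (s <= t)%N])
   ((fun w => f w s) @^-1` C s)); last by rewrite setTI.
apply: bigcap_measurable; first by exists 0%N.
by move=> s _; rewrite -[X in measurable X]setTI; exact: mf.
Qed.

Lemma measurable_not_hit t :
  measurable [set y : path_space S | forall s, (s < t)%N -> ~ A (y s)].
Proof.
case: t => [|t].
  rewrite [X in measurable X](_ : _ = setT)//.
  by apply/seteqP; split.
apply: (@measurable_cylinder S t (fun=> ~` A)) => _.
exact: measurableC.
Qed.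

(** Induction on t, which avoids entrance times as random variables: the value at time t + 1 is that
    of the path if [A] has not been entered up to time t, and the stopped value at time t
    otherwise. *)
Lemma measurable_stopped_coordinate t :
  measurable_fun setT (fun y : path_space S => stopped A y t : borel S).
Proof.
elim: t => [|t IH].
  rewrite (_ : (fun y => _) = (fun y => y 0%N)); last first.
    by apply/funext => y; rewrite stopped_before.
  exact: measurable_coordinate.
rewrite (_ : (fun y => _) = (fun y : path_space S =>
    if `[< forall s, (s < t.+1)%N -> ~ A (y s) >] then y t.+1
    else stopped A y t)); last first.
  apply/funext => y; case: asboolP => [|h]; first exact: stopped_before.
  have [s st As] : exists2 s, (s < t.+1)%N & A (y s).
    apply: contrapT => h'; apply: h => s st As; apply: h'; by exists s.
  by apply: stopped_after => //; exact: stopped_hit As.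
apply: (measurable_fun_ifT (f := fun y : path_space S =>
  `[< forall s, (s < t.+1)%N -> ~ A (y s) >])) => //.
  apply: (measurable_fun_bool true).
  rewrite setTI; rewrite [X in measurable X](_ : _ =
    [set y : path_space S | forall s, (s < t.+1)%N -> ~ A (y s)]).
    exact: measurable_not_hit.
  by apply/seteqP; split => y /= /asboolP.
exact: measurable_coordinate.
Qed.

Lemma measurable_stopped :
  measurable_fun setT (fun y : path_space S => stopped A y : path_space S).
Proof. by apply: measurable_path => t; exact: measurable_stopped_coordinate. Qed.

Lemma measurable_max_level (xi : borel S -> R) : measurable_fun setT xi ->
  measurable_fun setT (fun y : path_space S => max_level A xi y).
Proof.
move=> mxi.
rewrite (_ : (fun y => _) = (fun y : path_space S =>
    esups (fun t => (xi (stopped A y t))%:E) 0)); last first.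
  apply/funext => y; rewrite /max_level /esups /sdrop; congr ereal_sup.
  by apply/seteqP; split => _ [t _ <-]; exists t.
apply: (measurable_fun_esups (f := fun t (y : path_space S) =>
  (xi (stopped A y t))%:E)) => t.
apply/measurable_EFinP.
exact: measurableT_comp mxi (measurable_stopped_coordinate t).
Qed.

End path_measurability.

(** * The resampling kernels *)

Lemma sigma_algebra_setI T (G : set (set T)) (U V : set T) :
  <<s G >> U -> <<s G >> V -> <<s G >> (U `&` V).
Proof.
move=> GU GV.
have GC W : <<s G >> W -> <<s G >> (~` W).
  by move=> GW; rewrite -setTD; exact: sigma_algebraCD.
rewrite -[U `&` V]setCK setCI; apply: (GC); rewrite -bigcup2E.
apply: sigma_algebra_bigcup => -[|[|i]]; rewrite /bigcup2 /=.
- exact: GC.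
- exact: GC.
- exact: sigma_algebra0.
Qed.

Lemma cylinderS (T : Type) t (C : nat -> set T) :
  cylinder t.+1 C = cylinder t C `&` [set y | C t.+1 (y t.+1)].
Proof.
apply/seteqP; split=> y.
  by move=> h; split => [s st|]; apply: h => //; exact: leqW.
by move=> [h h'] s; rewrite leq_eqVlt => /orP[/eqP ->//|]; exact: h.
Qed.

Lemma cylinder_widen (T : Type) t u (C : nat -> set T) : (t <= u)%N ->
  cylinder t C = cylinder u (fun s => if (s <= t)%N then C s else setT).
Proof.
move=> tu; apply/seteqP; split=> y h s.
  by move=> _; case: ifP => // /h.
by move=> st; have := h s (leq_trans st tu); rewrite st.
Qed.

Lemma cylinderI (T : Type) t (C D : nat -> set T) :
  cylinder t C `&` cylinder t D = cylinder t (fun s => C s `&` D s).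
Proof.
apply/seteqP; split=> y; first by move=> [h h'] s st; split; [exact: h|exact: h'].
by move=> h; split=> s /h [].
Qed.

Lemma measurable_coordinate_preimage (S : ptopologicalType) t
    (D : set (borel S)) : measurable D ->
  measurable [set y : path_space S | D (y t)].
Proof. by move=> mD; rewrite -[X in measurable X]setTI; exact: measurable_coordinate. Qed.

Lemma history_cylinder (S : ptopologicalType) d (Om : measurableType d)
    (X : nat -> Om -> borel S) t (C : nat -> set (borel S)) :
  (forall s, measurable (C s)) ->
  history X t [set w | cylinder t C (fun s => X s w)].
Proof.
move=> mC.
suff h u : (u <= t)%N -> history X t [set w | cylinder u C (fun s => X s w)].
  exact: h.
elim: u => [_|u IH ut].
  apply: sub_sigma_algebra; exists 0%N, (C 0%N); split => //.
  apply/seteqP; split => w; first by apply.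
  by move=> Cw s; rewrite leqn0 => /eqP ->.
rewrite (_ : [set w | _] = [set w | cylinder u C (fun s => X s w)] `&`
   X u.+1 @^-1` C u.+1).
  apply: sigma_algebra_setI (IH (ltnW ut)) _.
  by apply: sub_sigma_algebra; exists u.+1, (C u.+1).
by apply/seteqP; split => w /=; rewrite cylinderS.
Qed.

Section ae_tools.
Local Open Scope ereal_scope.
Context d (T : measurableType d) (R : realType) (m : {measure set T -> \bar R}).

Lemma measure_integral_indic U : measurable U -> m U = \int[m]_x (\1_U x)%:E.
Proof. by move=> mU; rewrite integral_indic// setIT. Qed.

Lemma measurable_fun_EFin_indic U : measurable U ->
  measurable_fun setT (fun x : T => (\1_U x)%:E : \bar R).
Proof. by move=> mU; apply/measurable_EFinP; exact: measurable_indic. Qed.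

Lemma ae_full_measure (U : set T) : measurable U -> m U = 1 -> m setT = 1 ->
  {ae m, forall x, U x}.
Proof.
move=> mU U1 T1; apply/negligibleP; first exact: measurableC.
have Too : m setT < +oo by rewrite T1 ltry.
rewrite -setTD; apply: etrans (measureD measurableT mU Too) _.
rewrite setTI; apply: etrans (congr2 (fun x y => x - y) T1 U1) _.
by rewrite subee.
Qed.

Lemma ae_imply (U V : T -> Prop) : (forall x, U x -> V x) ->
  {ae m, forall x, U x} -> {ae m, forall x, V x}.
Proof. by move=> UV; apply: filterS. Qed.

Lemma ae_imply2 (U U' V : T -> Prop) : (forall x, U x -> U' x -> V x) ->
  {ae m, forall x, U x} -> {ae m, forall x, U' x} -> {ae m, forall x, V x}.
Proof. by move=> UV; apply: filterS2. Qed.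

Lemma ae_integral_cst (F : T -> \bar R) c : m setT = 1 -> measurable_fun setT F ->
  {ae m, forall x, F x = c} -> \int[m]_x F x = c.
Proof.
move=> m1 mF Fc; rewrite (ae_eq_integral (cst c))//.
  by rewrite integral_cst// m1 mule1.
by apply: filterS Fc => x Fc _.
Qed.

End ae_tools.

Section stopped_laws.
Local Open Scope ereal_scope.
Context {R : realType} {S : completePseudoMetricType R} (S_polish : polish S).
Context (P : R.-pker (borel S) ~> (borel S)) (A : set (borel S)).
Hypothesis (mA : measurable A).

Local Notation K := (stopped_transition P A).

Lemma measurable_stopped_transition D : measurable D ->
  measurable_fun setT (fun y : borel S => K y D).
Proof.
move=> mD; rewrite /stopped_transition.
apply: measurable_fun_ifT => //.
- apply: (measurable_fun_bool true).
  rewrite setTI (_ : _ @^-1` _ = A)//; apply/seteqP; split => y.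
    exact: set_mem.
  exact: mem_set.
- apply/measurable_EFinP; exact: measurable_indic.
- exact: measurable_kernel.
Qed.

Lemma stopped_transition_ge0 y D : 0 <= K y D.
Proof. by rewrite /stopped_transition; case: ifP. Qed.

(* Tested on cylinders only, which suffices by [stopped_law_unique]. *)
Definition stopped_law (T : nat) (x : path_space S)
    (m : {measure set (path_space S) -> \bar R}) : Prop :=
  (forall C : nat -> set (borel S), (forall s, measurable (C s)) ->
     m (cylinder T C) = \d_x (cylinder T C)) /\
  (forall t (C : nat -> set (borel S)) (D : set (borel S)), (T <= t)%N ->
     (forall s, measurable (C s)) -> measurable D ->
     m (cylinder t C `&` [set y | D (y t.+1)]) =
     \int[m]_(y in cylinder t C) K (y t) D).

Lemma stopped_law_cylinder T x m t (C : nat -> set (borel S)) :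
  stopped_law T x m -> (t <= T)%N ->
  (forall s, measurable (C s)) -> m (cylinder t C) = \d_x (cylinder t C).
Proof.
move=> [h _] tT mC; rewrite (cylinder_widen C tT) h// => s.
by case: ifP.
Qed.

(** Induction on the last time of a cylinder. Up to [T] both measures are Dirac masses; afterwards
    the measure is the integral, over a shorter cylinder, of a function of the last coordinate,
    whose law there is known by induction. *)
Lemma stopped_law_unique T x (m1 m2 : {measure set (path_space S) -> \bar R}) :
  stopped_law T x m1 -> stopped_law T x m2 ->
  forall U, measurable U -> m1 U = m2 U.
Proof.
move=> l1 l2.
have cyl t (C : nat -> set (borel S)) : (forall s, measurable (C s)) ->
    m1 (cylinder t C) = m2 (cylinder t C).
  elim: t C => [|t IH] C mC.
    by rewrite (stopped_law_cylinder l1)// (stopped_law_cylinder l2).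
  have [tT|Tt] := ltnP t T.
    by rewrite (stopped_law_cylinder l1)// (stopped_law_cylinder l2).
  have mcyl : measurable (cylinder t C : set (path_space S)).
    exact: measurable_cylinder.
  have mK := measurable_stopped_transition (mC t.+1).
  rewrite cylinderS l1.2// l2.2//.
  rewrite -(ge0_integral_restr_comp m1 mcyl (@measurable_coordinate S t) mK)//;
    last by move=> y; exact: stopped_transition_ge0.
  rewrite -(ge0_integral_restr_comp m2 mcyl (@measurable_coordinate S t) mK)//;
    last by move=> y; exact: stopped_transition_ge0.
  apply: eq_measure_integral; do ?exact: measurable_coordinate.
  move=> ? ? D mD _; rewrite /= /pushforward /mrestr.
  have -> : (fun y : path_space S => y t) @^-1` D `&` cylinder t C =
      cylinder t (fun s => if s == t then C s `&` D else C s).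
    apply/seteqP; split=> y.
      by move=> [Dy h] s st; case: eqP => [->|_]; [split => //|]; exact: h.
    move=> h; split; first by have := h t (leqnn t); rewrite eqxx => -[].
    by move=> s st; have := h s st; case: ifP => // _ [].
  apply: IH => s; case: ifP => // _; exact: measurableI.
move=> U mU.
apply: (@measure_unique _ R (path_space S) (@path_cylinders S)
  (fun=> setT)) => //.
- exact: path_space_measurableE.
- exact: setI_closed_path_cylinders.
- by move=> _; exists 0%N, (fun=> setT); split => //; apply/seteqP; split.
- by rewrite bigcup_const//; exists 0%N.
- by move=> _ [t [C [mC ->]]]; exact: cyl.
- move=> _; have -> : setT = cylinder T (fun=> setT) :> set (path_space S).
    by apply/seteqP; split.
  by rewrite (stopped_law_cylinder l1)// diracE; case: (_ \in _); rewrite ltry.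
Qed.

End stopped_laws.

Section resampling_theory.
Local Open Scope ereal_scope.
Context {R : realType} {S : completePseudoMetricType R} (S_polish : polish S).
Context (P : R.-pker (borel S) ~> (borel S)) (A : set (borel S)).
Context (xi : borel S -> R).
Hypotheses (mA : measurable A) (mxi : measurable_fun setT xi).
Context (piz : R.-pker (measurableTypeR R * path_space S)%type ~> (path_space S)).
Hypothesis piz_law : resampling_kernel P A xi piz.

Local Notation K := (stopped_transition P A).

Lemma resampled_stopped_law z x T : level_time A xi z x = Some T ->
  stopped_law P A T x (piz (z, x)).
Proof.
move=> zx; have := piz_law z x; rewrite /resampled_law zx => -[aeT tr].
split=> [C mC|t C D Tt mC mD].
  have mcyl : measurable (cylinder T C : set (path_space S)).
    exact: measurable_cylinder.
  rewrite measure_integral_indic//.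
  apply: ae_integral_cst; first exact: prob_kernel.
    exact: measurable_fun_EFin_indic.
  apply: filterS aeT => y yx; rewrite diracE indicE; congr ((_ : bool)%:R%:E).
  by apply/idP/idP; rewrite !inE => h s sT; have := h s sT; rewrite yx.
have := tr t Tt (cylinder t C) D; apply => //.
exact: (@history_cylinder _ _ _ (fun s (y : path_space S) => y s)).
Qed.

Lemma resampled_below z x U : level_time A xi z x = None -> measurable U ->
  piz (z, x) U = \d_(stopped A x : path_space S) U.
Proof.
move=> zx mU; have := piz_law z x; rewrite /resampled_law zx => aex.
rewrite measure_integral_indic//.
apply: ae_integral_cst; first exact: prob_kernel.
  exact: measurable_fun_EFin_indic.
apply: filterS aex => y yx; rewrite diracE indicE.
by have -> : y = stopped A x by apply/funext => t; exact: yx.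
Qed.

(** Nothing happens to the path before time n, so its level time is at least n or infinite; time n
    is included because resampling keeps the point at the level time. *)
Lemma resampled_agree z x n :
  (forall s, (s < n)%N -> ~ A (x s) /\ (xi (x s) <= z)%R) ->
  {ae piz (z, x), forall y : path_space S, forall s, (s <= n)%N -> y s = x s}.
Proof.
move=> h; have := piz_law z x; rewrite /resampled_law.
case zx : (level_time A xi z x) => [T|]; last first.
  move=> aex; apply: filterS aex => y yx s sn; rewrite yx stopped_before//.
  by move=> r rs; have [] := h r (leq_trans rs sn).
move/level_time_SomeP : zx => [nA zT _].
have nT : (n <= T)%N.
  rewrite leqNgt; apply/negP => /h[_]; rewrite leNgt.
  by rewrite zT.
move=> [aeT _]; apply: filterS aeT => y yx s sn; apply: yx.
exact: leq_trans nT.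
Qed.

(** Whether the level is exceeded is decided by the path up to its level time, which resampling
    keeps; a path that stays below is only stopped. *)
Lemma resampled_level z x : {ae piz (z, x), forall y : path_space S,
  (z%:E < max_level A xi y) = (z%:E < max_level A xi x)}.
Proof.
have := piz_law z x; rewrite /resampled_law.
case zx : (level_time A xi z x) => [T|].
  move=> [aeT _]; apply: filterS aeT => y yx; apply/idP/idP => _.
    by apply/max_level_gtP; rewrite zx.
  by apply/max_level_gtP; rewrite (level_time_eq zx yx).
move=> aex; apply: filterS aex => y /funext yx.
rewrite (_ : y = stopped A x)//.
apply/idP/idP => /max_level_gtP; last by rewrite zx.
by rewrite (level_time_stopped zx).
Qed.

(** If the level is reached, the kernel depends only on the path up to its level time, which
    resampling keeps; otherwise the path is only stopped, and stopping is idempotent. This serves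
    for new replicas branched off a survivor that is itself redrawn. *)
Lemma resampled_kernel z x : {ae piz (z, x), forall y : path_space S,
  forall U, measurable U -> piz (z, y) U = piz (z, x) U}.
Proof.
have := piz_law z x; rewrite /resampled_law.
case zx : (level_time A xi z x) => [T|].
  move=> [aeT _]; apply: filterS aeT => y yx U mU.
  apply: (stopped_law_unique (P := P) (A := A) S_polish mA (T := T) (x := x)) => //.
    have [h1 h2] := resampled_stopped_law (level_time_eq zx yx).
    split => // C mC; rewrite h1// !diracE; congr ((_ : bool)%:R%:E).
    by apply/idP/idP; rewrite !inE => h s sT; have := h s sT; rewrite yx.
  exact: resampled_stopped_law.
move=> aex; apply: filterS aex => y /funext yx U mU.
rewrite (_ : y = stopped A x)// !resampled_below//.
  by rewrite stopped_stopped.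
exact: level_time_stopped.
Qed.

Lemma measurable_at_level z :
  measurable_fun setT (fun x : path_space S => ((z : measurableTypeR R), x)).
Proof. by apply: measurable_fun_pair => //; exact: measurable_cst. Qed.

Lemma integral_stopped_transition_resampled z x t
    (C : nat -> set (borel S)) (D : set (borel S)) T :
  level_time A xi z x = Some T -> (T <= t)%N ->
  (forall s, measurable (C s)) -> measurable D ->
  piz (z, x) (cylinder t C `&` [set y | D (y t.+1)]) =
  \int[piz (z, x)]_(y in cylinder t C) K (y t) D.
Proof. by move=> zx Tt mC mD; exact: (resampled_stopped_law zx).2. Qed.

(* The law of the resampled path again satisfies [stopped_law], hence is [m]. *)
Lemma resample_stopped_law z T x (m : {measure set (path_space S) -> \bar R}) :
  stopped_law P A T x m ->
  (forall s, (s < T)%N -> ~ A (x s) /\ (xi (x s) <= z)%R) ->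
  forall F : path_space S -> \bar R, (forall y, 0 <= F y) ->
  measurable_fun setT F ->
  \int[m]_y \int[piz (z, y)]_w F w = \int[m]_y F y.
Proof.
move=> lm hx.
pose k := kernel_precomp piz (measurable_at_level z).
have mone : measurable_fun setT ((fun=> 1%R) : path_space S -> R).
  exact: measurable_cst.
have msnd : measurable_fun setT (snd : path_space S * path_space S -> path_space S).
  exact: measurable_snd.
(* [m'] is the law of the path obtained by drawing y from [m] and then resampling it above z. *)
pose m' : {measure set (path_space S) -> \bar R} :=
  mixture m k measurableT mone (fun=> ler01) msnd.
have int_m' F : (forall y, 0 <= F y) -> measurable_fun setT F ->
    \int[m']_w F w = \int[m]_y \int[piz (z, y)]_w F w.
  move=> F0 mF; rewrite integral_mixture//.
  by apply: eq_integral => y _; rewrite mul1e.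
have m'E U : m' U = \int[m]_y piz (z, y) U.
  by apply: eq_integral => y _; rewrite mul1e.
(* Paths that up to time n have neither entered [A] nor exceeded z: resampling changes nothing on
   them up to time n + 1. *)
pose N n : set (path_space S) :=
  cylinder n (fun=> ~` A `&` xi @^-1` `]-oo, z]%classic).
have mN n : measurable (N n).
  apply: measurable_cylinder => _; apply: measurableI; first exact: measurableC.
  by rewrite -[X in measurable X]setTI; exact: mxi.
have NP n y : N n y -> forall s, (s < n.+1)%N -> ~ A (y s) /\ (xi (y s) <= z)%R.
  by move=> Ny s /Ny[nA]; rewrite /= in_itv.
suff lm' : stopped_law P A T x m'.
  move=> F F0 mF; rewrite -int_m'//.
  apply: eq_measure_integral => U mU _.
  exact: (stopped_law_unique S_polish mA lm' lm).
have mass1 : m setT = 1.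
  have -> : setT = cylinder T (fun=> setT) :> set (path_space S).
    by apply/seteqP; split.
  by rewrite lm.1// diracE mem_set.
split=> [C mC|t C D Tt mC mD].
  have mcyl : measurable (cylinder T C : set (path_space S)).
    exact: measurable_cylinder.
  rewrite m'E -lm.1// [RHS]measure_integral_indic//.
  apply: ae_eq_integral => //.
  - exact: measurable_kernel k _ mcyl.
  - exact: measurable_fun_EFin_indic.
  (* [m] follows x up to [T], and x lies in [N T.-1], so this set has mass 1; for [T] equal to 0 the
     claim is empty. *)
  have : {ae m, forall y : path_space S,
      forall s, (s < T)%N -> ~ A (y s) /\ (xi (y s) <= z)%R}.
    have [T0|T0] := posnP T; first by apply: aeW => y s; rewrite T0.
    have : m (N T.-1) = 1.
      rewrite (stopped_law_cylinder lm) ?leq_pred//.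
        rewrite diracE mem_set// => s sn.
        have [|nA le] := hx s; first by rewrite -(prednK T0) ltnS.
        by split => //; rewrite /= in_itv.
      move=> _; apply: measurableI; first exact: measurableC.
      by rewrite -[X in measurable X]setTI; exact: mxi.
    move=> /(ae_full_measure (mN T.-1)) /(_ mass1).
    by apply: ae_imply => y /NP; rewrite prednK.
  apply: ae_imply => y hy _.
  rewrite measure_integral_indic//.
  apply: ae_integral_cst; first exact: prob_kernel.
    exact: measurable_fun_EFin_indic.
  apply: filterS (resampled_agree hy) => w wy.
  rewrite !indicE; congr ((_ : bool)%:R%:E).
  by apply/idP/idP; rewrite !inE => h s sT; have := h s sT; rewrite wy.
pose E : set (path_space S) := cylinder t C `&` [set y | D (y t.+1)].
have mcyl : measurable (cylinder t C : set (path_space S)).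
  exact: measurable_cylinder.
have mE : measurable E.
  by apply: measurableI => //; exact: measurable_coordinate_preimage.
pose Fa (w : path_space S) : \bar R := (\1_E w)%:E.
pose Fb (w : path_space S) : \bar R := (\1_(cylinder t C) w)%:E * K (w t) D.
have mFa : measurable_fun setT Fa.
  exact: measurable_fun_EFin_indic.
have Fa0 y : 0 <= Fa y by rewrite lee_fin.
have Fb0 y : 0 <= Fb y.
  by apply: mule_ge0; [rewrite lee_fin|exact: stopped_transition_ge0].
have mFb : measurable_fun setT Fb.
  apply: emeasurable_funM.
    exact: measurable_fun_EFin_indic.
  exact: measurableT_comp (measurable_stopped_transition P mA mD)
    (@measurable_coordinate S t).
have intFa (mu : {measure set (path_space S) -> \bar R}) : \int[mu]_w Fa w = mu E.
  by rewrite integral_indic// setIT.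
have intFb (mu : {measure set (path_space S) -> \bar R}) :
    \int[mu]_w Fb w = \int[mu]_(w in cylinder t C) K (w t) D.
  rewrite [RHS]integral_mkcond; apply: eq_integral => w _.
  rewrite /Fb patchE indicE; case: ifP => _; first by rewrite mul1e.
  by rewrite mul0e.
rewrite -/E -intFa -intFb !int_m'//.
have mint F : (forall y, 0 <= F y) -> measurable_fun setT F ->
    measurable_fun setT (fun y => \int[k y]_w F w).
  move=> F0 mF; apply: (measurable_kernel_section k (F := F \o snd)).
    by move=> ?; exact: F0.
  exact: measurableT_comp mF msnd.
have int0 F y : (forall y, 0 <= F y) -> 0 <= \int[k y]_w F w.
  by move=> F0; exact: integral_ge0.
have split_N (G : path_space S -> \bar R) : (forall y, 0 <= G y) ->
    measurable_fun setT G ->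
    \int[m]_y G y = \int[m]_(y in N t) G y + \int[m]_(y in ~` N t) G y.
  move=> G0 mG; rewrite -[in LHS](setUv (N t)) ge0_integral_setU//.
  - by apply: measurableC; exact: mN.
  - by rewrite setUv.
  - exact/disj_setPCl.
(* On [N t] resampling leaves both integrands unchanged, and the transition at time t is that of
   [m]; off [N t] the identity holds for each resampling kernel separately. *)
rewrite [LHS]split_N; [|by move=> y; exact: int0|exact: mint].
rewrite [RHS]split_N; [|by move=> y; exact: int0|exact: mint].
congr (_ + _).
  have resampled_eq (F : path_space S -> \bar R) y : N t y -> measurable_fun setT F ->
      (forall w : path_space S, (forall s, (s <= t.+1)%N -> w s = y s) ->
         F w = F y) ->
      \int[piz (z, y)]_w F w = F y.
    move=> Ny mF FE; apply: ae_integral_cst => //; first exact: prob_kernel.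
    by apply: ae_imply (resampled_agree (NP _ _ Ny)) => w /FE.
  have cylE (w y : path_space S) : (forall s, (s <= t.+1)%N -> w s = y s) ->
      (w \in (cylinder t C : set (path_space S))) =
      (y \in (cylinder t C : set (path_space S))).
    move=> wy; apply/idP/idP; rewrite !inE => h s st.
      by rewrite -wy ?leqW//; exact: h.
    by rewrite wy ?leqW//; exact: h.
  transitivity (\int[m]_(y in N t) Fa y).
    apply: eq_integral => y /set_mem Ny; apply: resampled_eq => // w wy.
    rewrite /Fa !indicE /E !in_setI (cylE _ _ wy).
    by congr ((_ && _)%:R%:E); apply/idP/idP; rewrite !inE/= wy.
  transitivity (\int[m]_(y in N t) Fb y); last first.
    apply: eq_integral => y /set_mem Ny; apply/esym; apply: resampled_eq => // w wy.
    by rewrite /Fb !indicE (cylE _ _ wy) wy.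
  rewrite /Fa integral_indic//.
  (* [N t] is itself a cylinder and is absorbed into [C], so that the transition property of [m]
     applies. *)
  transitivity (m (cylinder t (fun s => (~` A `&` xi @^-1` `]-oo, z]%classic) `&` C s)
      `&` [set y | D (y t.+1)])).
    by congr (m _); rewrite -cylinderI setIC setIA.
  have mNC s : measurable ((~` A `&` xi @^-1` `]-oo, z]%classic) `&` C s).
    apply: measurableI => //; apply: measurableI; first exact: measurableC.
    by rewrite -[X in measurable X]setTI; exact: mxi.
  rewrite lm.2// -cylinderI integral_mkcond [RHS]integral_mkcond.
  apply: eq_integral => y _; rewrite !patchE in_setI /Fb indicE.
  by case: (y \in N t) => //=; case: ifP => _; rewrite ?mul1e ?mul0e.
apply: eq_integral => y /set_mem nNy.
(* Outside [N t] either the level was exceeded by time t, and the kernel moves by [K] at time t, or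
   the path was absorbed in [A] by time t without ever exceeding it, and both sides are the same
   indicator. *)
case zy : (level_time A xi z y) => [T'|].
  rewrite intFa intFb; apply: (integral_stopped_transition_resampled zy) => //.
  rewrite leqNgt; apply/negP => tT'; apply: nNy => s st.
  move/level_time_SomeP : zy => [nA _ h]; split.
    by apply: nA; exact: leq_ltn_trans tT'.
  by rewrite /= in_itv /= h//; exact: leq_ltn_trans tT'.
have At : A (stopped A y t).
  apply: contrapT => nAt; apply: nNy => s st.
  have nA r : (r <= t)%N -> ~ A (y r).
    by move=> rt Ar; apply: nAt; exact: stopped_hit rt Ar.
  split; first exact: nA.
  rewrite /= in_itv /=; move/level_time_NoneP : zy; apply => r rs.
  by apply: nA; exact: leq_trans (ltnW rs) st.
have := piz_law z y; rewrite /resampled_law zy => aey.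
have cstE (F : path_space S -> \bar R) : measurable_fun setT F ->
    \int[piz (z, y)]_w F w = F (stopped A y).
  move=> mF; apply: ae_integral_cst => //; first exact: prob_kernel.
  by apply: ae_imply aey => w /funext wy; congr F.
rewrite !cstE// /Fa /Fb /E !indicE in_setI /stopped_transition (mem_set At).
rewrite -mulnb natrM EFinM; congr (_ * _).
rewrite diracE; congr ((_ : bool)%:R%:E).
by apply/idP/idP; rewrite !inE/= (stopped_after (leqnSn t) At).
Qed.

End resampling_theory.

Section resampling_consistency.
Local Open Scope ereal_scope.
Context {R : realType} {S : completePseudoMetricType R} (S_polish : polish S).
Context (P : R.-pker (borel S) ~> (borel S)) (A : set (borel S)).
Context (xi : borel S -> R).
Hypotheses (mA : measurable A) (mxi : measurable_fun setT xi).
Context (piz : R.-pker (measurableTypeR R * path_space S)%type ~> (path_space S)).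
Hypothesis piz_law : resampling_kernel P A xi piz.

Lemma measurable_integral_kernel d1 d2 d3 (X : measurableType d1)
    (Y : measurableType d2) (Z : measurableType d3) (k : R.-pker Y ~> Z)
    (f : X -> Y) (F : X * Z -> \bar R) : measurable_fun setT f ->
  (forall u, 0 <= F u) -> measurable_fun setT F ->
  measurable_fun setT (fun x => \int[k (f x)]_z F (x, z)).
Proof.
by move=> mf F0 mF; exact: (measurable_kernel_section (kernel_precomp k mf) F0 mF).
Qed.

Lemma measurable_resampled_integral z (F : path_space S -> \bar R) :
  (forall y, 0 <= F y) -> measurable_fun setT F ->
  measurable_fun setT (fun y : path_space S => \int[piz (z, y)]_w F w).
Proof.
move=> F0 mF.
apply: (measurable_integral_kernel (f := fun y => (z, y)) (F := F \o snd) piz).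
- exact: measurable_at_level.
- by move=> u; exact: F0.
- exact: measurableT_comp mF (@measurable_snd _ _ _ _).
Qed.

Lemma integral_resampled_below z x (F : path_space S -> \bar R) :
  level_time A xi z x = None -> measurable_fun setT F ->
  \int[piz (z, x)]_w F w = F (stopped A x).
Proof.
move=> zx mF; have := piz_law z x; rewrite /resampled_law zx => aex.
apply: ae_integral_cst => //; first exact: prob_kernel.
by apply: ae_imply aex => w /funext wx; congr F.
Qed.

(** Before the level time of z the path is at most z, hence at most z', so the second resampling
    branches no earlier than the first and continues a path that already moves by [K]. *)
Lemma resampled_resample z z' x (F : path_space S -> \bar R) : (z <= z')%R ->
  (forall y, 0 <= F y) -> measurable_fun setT F ->
  \int[piz (z, x)]_y \int[piz (z', y)]_w F w = \int[piz (z, x)]_y F y.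
Proof.
move=> zz' F0 mF.
case zx : (level_time A xi z x) => [T|].
  apply: (resample_stopped_law S_polish mA mxi piz_law
    (resampled_stopped_law piz_law zx)) => // s sT.
  have /level_time_SomeP[nA _ h] := zx.
  by split; [exact: nA|exact: le_trans (h _ sT) zz'].
rewrite !integral_resampled_below//; last exact: measurable_resampled_integral.
  by rewrite stopped_stopped.
apply/level_time_NoneP => t nA; apply: le_trans zz'.
by move: (level_time_stopped zx) => /level_time_NoneP; apply.
Qed.

Section chain.
Context (x0 : S) (d' : measure_display) (Omega' : measurableType d').
Context (Pr' : probability Omega' R) (X : nat -> Omega' -> borel S).
Hypothesis X_chain : markov_chain Pr' P x0 X.
Context (pi : probability (path_space S) R).
Hypothesis pi_law : forall C : set (path_space S), measurable C ->
  pi C = Pr' [set w | C (stopped A (fun t => X t w))].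

(** Only the initial value of the constant path matters. In this form [pi] falls under the same
    invariance as the resampling kernels. *)
Lemma chain_stopped_law : stopped_law P A 0 (fun=> x0) pi.
Proof.
have [mX X0 trX] := X_chain.
pose phi w : path_space S := stopped A (fun t => X t w).
have mphi : measurable_fun setT phi.
  by apply: measurableT_comp (measurable_stopped S_polish mA) _; exact: measurable_path.
split=> [C mC|t C D _ mC mD].
  have mcyl : measurable (cylinder 0 C : set (path_space S)).
    exact: measurable_cylinder.
  have mU : measurable [set w | cylinder 0 C (phi w)].
    by rewrite -[X in measurable X]setTI; exact: mphi.
  apply: etrans (pi_law mcyl) _; rewrite measure_integral_indic//.
  apply: ae_integral_cst; first exact: probability_setT.
    exact: measurable_fun_EFin_indic.
  apply: ae_imply X0 => w X0; rewrite diracE indicE; congr ((_ : bool)%:R%:E).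
  by apply/idP/idP; rewrite !inE => h s; have := h s; rewrite leqn0 => + /eqP s0;
    rewrite s0 /phi stopped_before// X0; exact.
pose E : set (path_space S) := cylinder t C `&` [set y | D (y t.+1)].
have mcyl : measurable (cylinder t C : set (path_space S)).
  exact: measurable_cylinder.
have mE : measurable E.
  by apply: measurableI => //; exact: measurable_coordinate_preimage.
(* [H] separates two cases: before the entrance in [A] the stopped chain is the chain and the Markov
   property applies; afterwards the path is constant and the two integrands agree pointwise. *)
pose H : set Omega' := [set w | forall s, (s < t.+1)%N -> ~ A (X s w)].
have mXp : measurable_fun setT (fun w => (fun t => X t w) : path_space S).
  exact: measurable_path.
have mH : measurable H.
  by rewrite -[X in measurable X]setTI; exact: mXp (measurable_not_hit mA t.+1).
have nmH : measurable (~` H) by exact: measurableC.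
pose a w : \bar R := (\1_E (phi w))%:E.
pose b w : \bar R := (\1_(cylinder t C : set (path_space S)) (phi w))%:E *
  stopped_transition P A (phi w t) D.
have ma : measurable_fun setT a.
  exact: measurableT_comp (measurable_fun_EFin_indic mE) mphi.
have mK := measurableT_comp (measurable_stopped_transition P mA mD)
    (@measurable_coordinate S t).
have mb : measurable_fun setT b.
  apply: emeasurable_funM.
    exact: measurableT_comp (measurable_fun_EFin_indic mcyl) mphi.
  exact: measurableT_comp mK mphi.
have a0 w : 0 <= a w by rewrite lee_fin.
have b0 w : 0 <= b w.
  by apply: mule_ge0; [rewrite lee_fin|exact: stopped_transition_ge0].
transitivity (\int[Pr']_w a w).
  apply: etrans (pi_law mE) _; rewrite measure_integral_indic//.
  by rewrite -[X in measurable X]setTI; exact: mphi.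
transitivity (\int[Pr']_w b w); last first.
  rewrite [RHS](eq_measure_integral (pushforward Pr' phi)); last first.
    by move=> U mU _; exact: pi_law.
  rewrite ge0_integral_pushforward//.
  - rewrite [RHS]integral_mkcond; apply: eq_integral => w _.
    rewrite /b /= patchE indicE.
    have -> : (w \in phi @^-1` cylinder t C) =
        (phi w \in (cylinder t C : set (path_space S))).
      by apply/idP/idP; rewrite !inE.
    by case: ifP => _; rewrite ?mul1e ?mul0e.
  - exact: measurable_funTS.
  - by move=> y _; exact: stopped_transition_ge0.
have split_H (G : Omega' -> \bar R) : (forall y, 0 <= G y) ->
    measurable_fun setT G ->
    \int[Pr']_y G y = \int[Pr']_(y in H) G y + \int[Pr']_(y in ~` H) G y.
  move=> G0 mG; rewrite -[in LHS](setUv H) ge0_integral_setU//.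
  - by rewrite setUv.
  - exact/disj_setPCl.
rewrite split_H// [RHS]split_H//; congr (_ + _); last first.
  apply: eq_integral => w /set_mem nHw.
  have At : A (phi w t).
    apply: contrapT => nAt; apply: nHw => s st As; apply: nAt.
    exact: (@stopped_hit S A (fun t => X t w) s t st As).
  rewrite /a /b /E !indicE in_setI /stopped_transition (mem_set At).
  rewrite -mulnb natrM EFinM; congr (_ * _).
  rewrite diracE; congr ((_ : bool)%:R%:E).
  by apply/idP/idP; rewrite !inE/= /phi (stopped_after (leqnSn t) At).
have phiE w s : H w -> (s <= t.+1)%N -> phi w s = X s w.
  by move=> Hw st; apply: stopped_before => r rs; apply: Hw; exact: leq_trans st.
pose E' : set Omega' := [set w | cylinder t (fun s => ~` A `&` C s) (fun s => X s w)].
have mAC s : measurable (~` A `&` C s) by apply: measurableI => //; exact: measurableC.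
have hE' : history X t E' by exact: history_cylinder.
have mE' : measurable E'.
  rewrite -[X in measurable X]setTI.
  exact: (mXp measurableT _ (measurable_cylinder t mAC)).
have E'P w : E' w <-> H w /\ cylinder t C (phi w).
  split=> [h|[Hw h] s st].
    have Hw : H w by move=> s st; have [] := h s st.
    by split => // s st; rewrite phiE ?leqW//; have [] := h s st.
  by split; [exact: Hw|rewrite -phiE ?leqW//; exact: h].
transitivity (Pr' (E' `&` X t.+1 @^-1` D)).
  rewrite measure_integral_indic//; last first.
    by apply: measurableI => //; rewrite -[X in measurable X]setTI; exact: mX.
  rewrite [LHS]integral_mkcond; apply: eq_integral => w _.
  rewrite patchE; case: ifPn => [/set_mem Hw|/negP nHw]; last first.
    rewrite indicE memNset// => -[/E'P[Hw _] _]; apply: nHw; exact: mem_set.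
  rewrite /a !indicE; congr ((_ : bool)%:R%:E); apply/idP/idP; rewrite !inE.
    move=> [cw Dw]; split; first by apply/E'P.
    by rewrite /= -phiE.
  by move=> [/E'P[_ cw] Dw]; split => //=; rewrite phiE.
rewrite trX// [LHS]integral_mkcond [RHS]integral_mkcond.
apply: eq_integral => w _; rewrite !patchE.
case: ifPn => [/set_mem/E'P[Hw cw]|/negP nE'].
  rewrite mem_set// /b indicE mem_set// mul1e /stopped_transition memNset//.
    by rewrite phiE.
  by rewrite phiE//; exact: Hw.
case: ifPn => // /set_mem Hw; rewrite /b indicE memNset ?mul0e// => cw.
by apply: nE'; apply/mem_set/E'P.
Qed.

Lemma law_resample z (F : path_space S -> \bar R) :
  (forall y, 0 <= F y) -> measurable_fun setT F ->
  \int[pi]_y \int[piz (z, y)]_w F w = \int[pi]_y F y.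
Proof. exact: (resample_stopped_law S_polish mA mxi piz_law chain_stopped_law). Qed.

End chain.

End resampling_consistency.

(** * Splitting a configuration *)

(** Every natural number is a coordinate, so that one space serves for all iterations, whatever the
    number of labels created. *)
Definition rectangles (S : ptopologicalType) : set (set (nat -> path_space S)) :=
  [set E | exists2 C : nat -> set (path_space S),
    (forall n, measurable (C n)) & E = [set x | forall n, C n (x n)]].

Notation config S := (g_sigma_algebraType (@rectangles S)).

Definition update (T : Type) (x : nat -> T) (n : nat) (y : T) : nat -> T :=
  fun m => if m == n then y else x m.

Section config_space.
Context (S : ptopologicalType).

Lemma setI_closed_rectangles : setI_closed (@rectangles S).
Proof.
move=> _ _ [C mC ->] [D mD ->]; exists (fun n => C n `&` D n).
  by move=> n; exact: measurableI.
apply/seteqP; split=> x; first by move=> [Cx Dx] n; split.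
by move=> h; split=> n; have [] := h n.
Qed.

Lemma rectanglesT : (@rectangles S) setT.
Proof. by exists (fun=> setT) => //; apply/seteqP; split. Qed.

Lemma measurable_replica n :
  measurable_fun setT ((fun x => x n) : config S -> path_space S).
Proof.
move=> _ C mC; rewrite setTI; apply: sub_sigma_algebra.
exists (fun m => if m == n then C else setT); first by move=> m; case: ifP.
apply/seteqP; split=> x /=; first by move=> Cx m; case: eqP => // ->.
by move=> /(_ n); rewrite eqxx.
Qed.

Lemma measurable_config d (T : measurableType d) (f : T -> config S) :
  (forall n, measurable_fun setT (fun w => f w n : path_space S)) ->
  measurable_fun setT f.
Proof.
move=> mf.
apply: (@measurability _ _ T (config S) setT f (@rectangles S)) => //.
move=> _ [_ [C mC ->] <-].
rewrite (_ : _ `&` _ = \bigcap_n ((fun w => f w n) @^-1` C n)); last first.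
  by rewrite setTI; apply/seteqP; split=> w h n; [move=> _|]; exact: h.
apply: bigcap_measurable; first by exists 0%N.
by move=> n _; rewrite -[X in measurable X]setTI; exact: mf.
Qed.

Lemma measurable_update n : measurable_fun setT
  (fun u : config S * path_space S => update u.1 n u.2 : config S).
Proof.
apply: measurable_config => m; rewrite /update; case: eqP => _.
  exact: measurable_snd.
exact: measurableT_comp (measurable_replica m) measurable_fst.
Qed.

End config_space.

(** * Counting characterisation of the order statistic *)

Section order_statistics.
Context {R : realType} (k : nat).
Implicit Types (v : seq (\bar R)) (z a : \bar R).
Local Open Scope ereal_scope.

Local Notation srt v := (sort (fun a b : \bar R => a <= b) v).

Let sorted_nth v i j : (i <= j)%N -> (j < size v)%N ->
  nth +oo (srt v) i <= nth +oo (srt v) j.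
Proof.
move=> ij js.
apply: (sorted_leq_nth (leT := fun a b : \bar R => a <= b)) => //.
- by move=> x y z; exact: le_trans.
- by apply: sort_sorted => x y; exact: le_total.
- by rewrite inE size_sort (leq_ltn_trans ij).
- by rewrite inE size_sort.
Qed.

Lemma order_stat_mem v : (0 < k <= size v)%N -> order_stat k v \in v.
Proof.
move=> /andP[k0 kv]; rewrite /order_stat -(mem_sort (fun a b => a <= b)).
by apply: mem_nth; rewrite size_sort prednK.
Qed.

Lemma count_le_order_stat v : (0 < k <= size v)%N ->
  (k <= count (fun a => (a <= order_stat k v)%E) v)%N.
Proof.
move=> /andP[k0 kv].
rewrite -(permP (permEl (perm_sort (fun a b : \bar R => a <= b) v))).
rewrite -[X in count _ X](cat_take_drop k) count_cat (leq_trans _ (leq_addr _ _))//.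
rewrite (_ : count _ _ = size (take k (srt v))).
  by rewrite size_take size_sort; case: ltnP.
apply/eqP; rewrite -all_count; apply/(all_nthP +oo) => i.
rewrite size_take_min size_sort (minn_idPl kv) => ik.
by rewrite nth_take// /order_stat; apply: sorted_nth; rewrite -ltnS prednK.
Qed.

Lemma count_lt_order_stat v : (0 < k <= size v)%N ->
  (count (fun a => (a < order_stat k v)%E) v < k)%N.
Proof.
move=> /andP[k0 kv].
rewrite -(permP (permEl (perm_sort (fun a b : \bar R => a <= b) v))).
rewrite -[X in count _ X](cat_take_drop k.-1) count_cat.
rewrite (_ : count _ (drop _ _) = 0%N).
  rewrite addn0 (leq_ltn_trans (count_size _ _))// size_take_min size_sort.
  by rewrite (leq_ltn_trans (geq_minl _ _))// prednK.
apply/eqP; rewrite -leqn0 leqNgt -has_count; apply/negP => /(has_nthP +oo)[i].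
rewrite size_drop size_sort => ik; rewrite nth_drop /order_stat ltNge.
by rewrite sorted_nth ?leq_addr// -ltn_subRL.
Qed.

(** The counting event on the right is what gives the measurability of the level. *)
Lemma order_stat_le v a : (0 < k <= size v)%N ->
  (order_stat k v <= a) = (k <= count (fun b => (b <= a)%E) v)%N.
Proof.
move=> kv; apply/idP/idP => h.
  apply: leq_trans (count_le_order_stat kv) _.
  by apply: sub_count => b /= /le_trans; exact.
rewrite leNgt; apply/negP => az.
suff /(leq_ltn_trans h) : (count (fun b => (b <= a)%E) v < k)%N by rewrite ltnn.
apply: leq_ltn_trans (count_lt_order_stat kv).
by apply: sub_count => b /= ba; exact: le_lt_trans az.
Qed.

(** These two counts are preserved when an entry above z is replaced by another one above z. *)
Lemma order_stat_unique v z : (0 < k <= size v)%N ->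
  (k <= count (fun a => (a <= z)%E) v)%N -> (count (fun a => (a < z)%E) v < k)%N ->
  order_stat k v = z.
Proof.
move=> kv kz zk; apply/eqP; rewrite eq_le order_stat_le// kz/=.
rewrite leNgt; apply/negP => lz.
have := leq_trans zk (count_le_order_stat kv); rewrite ltnNge => /negP; apply.
by apply: sub_count => b /= /le_lt_trans; exact.
Qed.

End order_statistics.

(** * Stability of the level and of the splitting when a survivor changes *)

Section levels.
Context {R : realType} {S : Type} (A : set S) (xi : S -> R) (zmax : R).
Context (nrep k : nat) (k_range : (0 < k < nrep)%N).
Implicit Types (l : seq nat) (x : nat -> nat -> S) (m n : nat).
Local Open Scope ereal_scope.

(* [Ioff] and [weight] are dummies: one iteration splits the working replicas
   without looking at them. *)
Definition state_of l x : ams_state R S :=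
  {| Ion := l; Ioff := [::]; weight := fun=> 0%R; replica := x |}.

Local Notation lev l x := (level A xi k (state_of l x)).
Local Notation Xi x := (max_level A xi x).

Lemma eq_level l x x' : {in l, forall m, Xi (x m) = Xi (x' m)} ->
  lev l x = lev l x'.
Proof.
move=> h; rewrite /level /=; have -> : [seq Xi (x n) | n <- l] = [seq Xi (x' n) | n <- l].
  by apply/eq_in_map => m /h.
rewrite (eq_in_all (a2 := fun n => Xi (x' n) <= order_stat k [seq Xi (x' n0) | n0 <- l]))//.
by move=> m ml /=; rewrite h.
Qed.

Lemma size_killed_survivors s :
  (size (killed A xi k s) + size (survivors A xi k s))%N = size (Ion s).
Proof.
rewrite /killed /survivors !size_filter -(count_predC
  (fun n => Xi (replica s n) <= level A xi k s)) ; congr (_ + _)%N.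
by apply: eq_count => n /=; rewrite ltNge.
Qed.

Let kl l : size l = nrep -> forall f : nat -> \bar R,
  (0 < k <= size [seq f n | n <- l])%N.
Proof. by move=> ln f; rewrite size_map ln; case/andP: k_range => -> /ltnW. Qed.

(** A finite level is an order statistic, hence the maximum of some working replica, and a replica
    at the level is killed. *)
Lemma level_attained l x : size l = nrep -> lev l x < +oo ->
  exists2 m, m \in killed A xi k (state_of l x) & Xi (x m) = lev l x.
Proof.
move=> ln; rewrite /level /=; case: ifP => // _ _.
have /mapP[m ml e] := order_stat_mem (kl ln (fun n => Xi (x n))).
exists m; last by rewrite -e.
by rewrite /killed mem_filter ml andbT /level /=; case: ifP; rewrite ?leey// -e.
Qed.

Lemma survivors_neq0 l x : lev l x < +oo ->
  (0 < size (survivors A xi k (state_of l x)))%N.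
Proof.
rewrite /survivors size_filter -has_count /level /=; case: ifP => // + _.
move=> /negbT; rewrite -has_predC; apply: sub_has => n /=.
by rewrite -ltNge.
Qed.

(** The numbers of replicas at most at the level and strictly below it do not see the change, and
    they determine the order statistic; as y exceeds it, the level is not reset to +oo. *)
Lemma level_update l x n y : size l = nrep -> n \in l ->
  lev l x < Xi (x n) -> lev l x < Xi y -> lev l (update x n y) = lev l x.
Proof.
move=> ln nl zx zy.
have loo : lev l x < +oo by apply: lt_le_trans zx (leey _).
have le : lev l x = order_stat k [seq Xi (x m) | m <- l].
  by move: loo; rewrite /level /=; case: ifP.
have cle : count (fun m => Xi (update x n y m) <= lev l x) l =
    count (fun m => Xi (x m) <= lev l x) l.
  apply: eq_in_count => m ml /=; rewrite /update; case: eqP => // ->.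
  by rewrite !leNgt zx zy.
have clt : count (fun m => Xi (update x n y m) < lev l x) l =
    count (fun m => Xi (x m) < lev l x) l.
  apply: eq_in_count => m ml /=; rewrite /update; case: eqP => // ->.
  by rewrite !ltNge !ltW.
have os : order_stat k [seq Xi (update x n y m) | m <- l] = lev l x.
  apply: order_stat_unique; first exact: kl ln _.
    rewrite count_map (eq_count (a2 := fun m => Xi (update x n y m) <= lev l x))//.
    rewrite cle; have := count_le_order_stat (kl ln (fun m => Xi (x m))).
    by rewrite -le count_map.
  rewrite count_map (eq_count (a2 := fun m => Xi (update x n y m) < lev l x))//.
  rewrite clt; have := count_lt_order_stat (kl ln (fun m => Xi (x m))).
  by rewrite -le count_map.
rewrite [LHS]/level /= os ifF//; apply/negP => /allP /(_ n nl).
by rewrite /update eqxx leNgt zy.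
Qed.

Lemma survivors_update l x n y : size l = nrep -> n \in l ->
  lev l x < Xi (x n) -> lev l x < Xi y ->
  survivors A xi k (state_of l (update x n y)) = survivors A xi k (state_of l x).
Proof.
move=> ln nl zx zy; rewrite /survivors level_update//=.
by apply: eq_in_filter => m _; rewrite /update; case: eqP => // ->; rewrite zx zy.
Qed.

Lemma killed_update l x n y : size l = nrep -> n \in l ->
  lev l x < Xi (x n) -> lev l x < Xi y ->
  killed A xi k (state_of l (update x n y)) = killed A xi k (state_of l x).
Proof.
move=> ln nl zx zy; rewrite /killed level_update//=.
by apply: eq_in_filter => m _; rewrite /update; case: eqP => // ->;
  rewrite !leNgt zx zy.
Qed.

Definition splitting l Sv Kl : set (nat -> nat -> S) :=
  [set x | [/\ ~~ stops A xi zmax k (state_of l x),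
      survivors A xi k (state_of l x) = Sv & killed A xi k (state_of l x) = Kl]].

Lemma splitting_update l Sv Kl x n y : size l = nrep -> n \in Sv ->
  splitting l Sv Kl x -> lev l x < Xi y ->
  splitting l Sv Kl (update x n y) /\ lev l (update x n y) = lev l x.
Proof.
move=> ln nS [ns sS kK] zy.
have /andP[zx nl] : (lev l x < Xi (x n)) && (n \in l).
  by move: nS; rewrite -sS mem_filter.
by rewrite /splitting /= /stops survivors_update// killed_update// level_update.
Qed.

Lemma splitting_survivor l Sv Kl x n : n \in Sv ->
  splitting l Sv Kl x -> lev l x < Xi (x n).
Proof. by move=> nS [_ sS _]; move: nS; rewrite -sS mem_filter => /andP[]. Qed.

Lemma splitting_level_fin l Sv Kl x : size l = nrep -> splitting l Sv Kl x ->
  lev l x \is a fin_num.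
Proof.
move=> ln [ns _ _]; move: ns; rewrite /stops -leNgt => lez.
have loo : lev l x < +oo by apply: le_lt_trans lez (ltry _).
rewrite fin_numE (lt_eqF loo) andbT gt_eqF//.
by have [m _ <-] := level_attained ln loo; exact: max_level_gtNy.
Qed.

End levels.

Section measurable_lists.
Context d (T : measurableType d).
Implicit Types (p : T -> nat -> bool) (l : seq nat).

Lemma measurable_filter_eq p l l' : (forall n, measurable [set x | p x n]) ->
  measurable [set x | seq.filter (p x) l = l'].
Proof.
move=> mp; elim: l l' => [|a l IH] l' /=.
  have [->|/eqP l0] := eqVneq l' [::].
    by rewrite (_ : mkset _ = setT)//; apply/seteqP; split.
  by rewrite (_ : mkset _ = set0)//; apply/seteqP; split => // x /= /esym.
have mcons : measurable [set x | a :: seq.filter (p x) l = l'].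
  case: l' => [|b l'].
    by rewrite (_ : mkset _ = set0)//; apply/seteqP; split.
  have [->|/eqP ab] := eqVneq a b.
    rewrite (_ : mkset _ = [set x | seq.filter (p x) l = l'])//.
    by apply/seteqP; split => x /= [] // ->.
  by rewrite (_ : mkset _ = set0)//; apply/seteqP; split => // x /= [].
rewrite (_ : mkset _ = ([set x | p x a] `&` [set x | a :: seq.filter (p x) l = l'])
    `|` (~` [set x | p x a] `&` [set x | seq.filter (p x) l = l'])).
  by apply: measurableU; apply: measurableI => //; exact: measurableC.
apply/seteqP; split => x /=.
  by case: ifP => pa; [left|right; split => //; rewrite pa].
by case: ifP => pa [[]|[]].
Qed.

Lemma measurable_count_ge p l k : (forall n, measurable [set x | p x n]) ->
  measurable [set x | (k <= count (p x) l)%N].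
Proof.
move=> mp; elim: l k => [|a l IH] k /=.
  case: k => [|k]; first by rewrite (_ : mkset _ = setT)//; apply/seteqP; split.
  by rewrite (_ : mkset _ = set0)//; apply/seteqP; split.
rewrite (_ : mkset _ = ([set x | p x a] `&` [set x | (k.-1 <= count (p x) l)%N])
    `|` (~` [set x | p x a] `&` [set x | (k <= count (p x) l)%N])).
  by apply: measurableU; apply: measurableI => //; exact: measurableC.
apply/seteqP; split => x /=; case pa : (p x a) => /=.
- by rewrite add1n => h; left; split => //; case: (k) h.
- by rewrite add0n; right.
- by move=> [[_ h]|[]//]; rewrite add1n; case: (k) h.
- by move=> [[]//|[_]].
Qed.

Lemma measurable_all p l : (forall n, measurable [set x | p x n]) ->
  measurable [set x | all (p x) l].
Proof.
move=> mp; rewrite (_ : mkset _ = [set x | (size l <= count (p x) l)%N]).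
  exact: measurable_count_ge.
apply/seteqP; split => x /=; rewrite all_count.
  by move=> /eqP ->.
by move=> h; rewrite eqn_leq count_size h.
Qed.

End measurable_lists.

Lemma integral_setI_indicl d (T : measurableType d) (R : realType)
    (m : {measure set T -> \bar R}) (D E : set T) (f : T -> \bar R) :
  (\int[m]_(x in D `&` E) f x = \int[m]_(x in D) ((\1_E x)%:E * f x))%E.
Proof.
rewrite integral_mkcondr; apply: eq_integral => x _.
by rewrite patchE indicE; case: ifP; rewrite ?mul1e ?mul0e.
Qed.

Section constant_kernel.
Context d1 d2 (X : measurableType d1) (Y : measurableType d2) (R : realType).
Variable p : probability Y R.

Definition kernel_cst : X -> {measure set Y -> \bar R} := fun=> p.

Let measurable_kernel_cst U : measurable U ->
  measurable_fun setT (kernel_cst ^~ U).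
Proof. by move=> mU; exact: measurable_cst. Qed.

HB.instance Definition _ :=
  isKernel.Build _ _ _ _ _ kernel_cst measurable_kernel_cst.

Let prob_kernel_cst x : kernel_cst x setT = 1%E.
Proof. exact: probability_setT. Qed.

HB.instance Definition _ := Kernel_isProbability.Build _ _ _ _ _
  kernel_cst prob_kernel_cst.

End constant_kernel.
Arguments kernel_cst {d1 d2} X {Y R} p.

(** * Invariance of a configuration under the resampling of a survivor *)

Section resampling_invariance.
Local Open Scope ereal_scope.
Context {R : realType} {S : completePseudoMetricType R} (S_polish : polish S).
Context (P : R.-pker (borel S) ~> (borel S)) (A : set (borel S)).
Context (xi : borel S -> R) (zmax : R).
Hypotheses (mA : measurable A) (mxi : measurable_fun setT xi).
Context (piz : R.-pker (measurableTypeR R * path_space S)%type ~> (path_space S)).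
Hypothesis piz_law : resampling_kernel P A xi piz.
Context (nrep k : nat) (k_range : (0 < k < nrep)%N).

Local Notation lev l x := (level A xi k (state_of l x)).
Local Notation Xi x := (max_level A xi x).

Lemma measurable_replica_level n :
  measurable_fun setT (fun x : config S => Xi (x n)).
Proof.
exact: measurableT_comp (measurable_max_level mA mxi) (@measurable_replica S n).
Qed.

Lemma measurable_level l : size l = nrep ->
  measurable_fun setT (fun x : config S => lev l x).
Proof.
move=> ln.
have kl (x : config S) : (0 < k <= size [seq Xi (x n) | n <- l])%N.
  by rewrite size_map ln; case/andP: k_range => -> /ltnW.
have mos : measurable_fun setT
    (fun x : config S => order_stat k [seq Xi (x n) | n <- l]).
  apply: (@measurability _ _ (config S) (\bar R) setT
    (fun x : config S => order_stat k [seq Xi (x n) | n <- l])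
    (@ErealGenOInfty.G R)); first exact: ErealGenOInfty.measurableE.
  move=> _ [_ [r ->] <-]; rewrite setTI.
  rewrite (_ : _ @^-1` _ =
    ~` [set x : config S | (k <= count (fun n => (Xi (x n) <= r%:E)%E) l)%N]).
    apply: measurableC; apply: measurable_count_ge => n.
    rewrite -[X in measurable X]setTI; apply: measurable_lee => //.
    exact: measurable_replica_level.
  apply/seteqP; split => x /=.
    by rewrite in_itv /= andbT ltNge order_stat_le// count_map => /negP.
  by rewrite in_itv /= andbT ltNge order_stat_le// count_map => /negP.
rewrite /level /=; apply: measurable_fun_ifT => //.
apply: (measurable_fun_bool true); rewrite setTI.
apply: measurable_all => n; rewrite -[X in measurable X]setTI.
by apply: measurable_lee => //; exact: measurable_replica_level.
Qed.

Lemma measurable_splitting l Sv Kl : size l = nrep ->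
  measurable (splitting A xi zmax k l Sv Kl : set (config S)).
Proof.
move=> ln; have mlev := measurable_level ln.
rewrite (_ : splitting _ _ _ _ _ _ _ =
    [set x : config S | lev l x <= zmax%:E] `&`
    ([set x | survivors A xi k (state_of l x) = Sv] `&`
     [set x | killed A xi k (state_of l x) = Kl])); last first.
  apply/seteqP; split => x; first by move=> [? ? ?]; split => //=; rewrite leNgt.
  by move=> [/= ? [? ?]]; split => //; rewrite /stops -leNgt.
apply: measurableI.
  by rewrite -[X in measurable X]setTI; apply: measurable_lee.
by apply: measurableI; apply: measurable_filter_eq => n;
  rewrite -[X in measurable X]setTI;
  [apply: measurable_lte|apply: measurable_lee] => //;
  exact: measurable_replica_level.
Qed.

Lemma measurable_level_replica l n : size l = nrep -> measurable_fun setT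
  (fun x : config S => ((fine (lev l x) : measurableTypeR R), x n : path_space S)).
Proof.
move=> ln; apply: measurable_fun_pair; last exact: measurable_replica.
exact: measurableT_comp (@fine_measurable R _ measurableT) (measurable_level ln).
Qed.

(** Since [kappa] may depend on coordinate n itself, this is an invariance on [D] and not the
    conditional law of that coordinate given the others. *)
Definition resampling_invariant d (Om : measurableType d)
    (Pr : {measure set Om -> \bar R}) (D : set Om) (V : Om -> config S) (n : nat)
    (kappa : config S -> {measure set (path_space S) -> \bar R}) : Prop :=
  forall F : config S -> \bar R, (forall x, 0 <= F x) -> measurable_fun setT F ->
  \int[Pr]_(w in D) F (V w) =
  \int[Pr]_(w in D) \int[kappa (V w)]_y F (update (V w) n y).

Lemma update_update (x : config S) n y y' :
  update (update x n y) n y' = update x n y'.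
Proof. by apply/funext => m; rewrite /update; case: eqP. Qed.

(** The two paths play symmetric roles: if y gave the event without exceeding the level for y0, then
    y0 would exceed the level for y, and exchanging them would make the two levels equal, a
    contradiction. *)
Lemma splitting_update_iff l Sv Kl n (x : config S) y0 y : size l = nrep ->
  n \in Sv -> splitting A xi zmax k l Sv Kl (update x n y0) ->
  splitting A xi zmax k l Sv Kl (update x n y) <->
  lev l (update x n y0) < Xi y.
Proof.
move=> ln nS G0; split=> [G1|h]; last first.
  by have [] := splitting_update k_range ln nS G0 h; rewrite update_update.
rewrite ltNge; apply/negP => le.
have := splitting_survivor nS G1; rewrite {2}/update eqxx => z1.
have := splitting_survivor nS G0; rewrite {2}/update eqxx => z0.
have [|_] := splitting_update k_range (y := y0) ln nS G1.
  exact: lt_le_trans z1 (le_trans le (ltW z0)).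
by rewrite update_update => e; move: le; rewrite e leNgt z1.
Qed.

(* Given the other replicas, the splitting event only says of a survivor [n]
   that it exceeds the level, and this level is determined by the killed
   replicas: it is therefore enough to resample [n] at a fixed level. *)
Lemma resampling_invariant_splitting d (Om : measurableType d)
    (Pr : {measure set Om -> \bar R}) (D : set Om) (V : Om -> config S) (n : nat)
    (kappa : R.-pker (config S) ~> (path_space S)) (zeta : config S -> \bar R)
    (l Sv Kl : seq nat) (ln : size l = nrep) :
  measurable D -> measurable_fun setT V -> n \in Sv ->
  (forall x z, zeta x < z%:E -> forall F : path_space S -> \bar R,
     (forall y, 0 <= F y) -> measurable_fun setT F ->
     \int[kappa x]_y \int[piz (z, y)]_w F w = \int[kappa x]_y F y) ->
  {ae Pr, forall w, D w -> forall m, m \in l -> zeta (V w) < Xi (V w m)} ->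
  resampling_invariant Pr D V n kappa ->
  resampling_invariant Pr (D `&` V @^-1` splitting A xi zmax k l Sv Kl) V n
    (kernel_precomp piz (measurable_level_replica n ln)).
Proof.
move=> mD mV nS kappa_piz aeO inv F F0 mF.
pose G : set (config S) := splitting A xi zmax k l Sv Kl.
have mG : measurable G by exact: measurable_splitting.
pose I (x : config S) := \int[piz (fine (lev l x), x n : path_space S)]_y F (update x n y).
have mFu : measurable_fun setT
    (fun u : config S * path_space S => F (update u.1 n u.2)).
  exact: measurableT_comp mF (@measurable_update S n).
have mI : measurable_fun setT I.
  by apply: (measurable_integral_kernel piz (measurable_level_replica n ln) _ mFu).
have I0 x : 0 <= I x by exact: integral_ge0.
pose F1 (x : config S) := (\1_G x)%:E * F x.
pose H (x : config S) := (\1_G x)%:E * I x.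
have mG1 := measurable_fun_EFin_indic (R := R) mG.
have mF1 : measurable_fun setT F1 by exact: emeasurable_funM.
have mH : measurable_fun setT H by exact: emeasurable_funM.
have F10 x : 0 <= F1 x by apply: mule_ge0 => //; rewrite lee_fin.
have H0 x : 0 <= H x by apply: mule_ge0 => //; rewrite lee_fin.
transitivity (\int[Pr]_(w in D) F1 (V w)); first exact: integral_setI_indicl.
transitivity (\int[Pr]_(w in D) H (V w)); last first.
  by rewrite integral_setI_indicl.
(* The event is now inside the integrands, so the invariance on [D] redraws replica n from [kappa]
   on both sides; what remains is an identity for almost every fixed configuration x. *)
rewrite inv// [RHS]inv//.
have mint (F' : config S -> \bar R) : (forall x, 0 <= F' x) ->
    measurable_fun setT F' ->
    measurable_fun D (fun w => \int[kappa (V w)]_y F' (update (V w) n y)).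
  move=> F'0 mF'; apply: measurable_funTS.
  apply: (measurableT_comp (f := fun x : config S =>
    \int[kappa x]_y F' (update x n y)) _ mV).
  apply: (measurable_kernel_section kappa (F := fun u => F' (update u.1 n u.2))).
    by move=> u; exact: F'0.
  exact: measurableT_comp mF' (@measurable_update S n).
apply: ae_eq_integral => //; [exact: mint|exact: mint|].
apply: ae_imply aeO => w + Dw => /(_ Dw); move: (V w) => x Ox.
have [[y0 G0]|nG] := pselect (exists y0, G (update x n y0)); last first.
  rewrite !integral0_eq// => y _; rewrite /F1 /H indicE memNset ?mul0e// => Gy;
  by apply: nG; exists y.
(* With the other replicas fixed, z0 is the level for every path at n that gives the event, and
   these paths are exactly those above z0. *)
have z0fin := splitting_level_fin k_range ln G0.
set z0 := lev l (update x n y0) in z0fin.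
have zE : z0 = (fine z0)%:E by rewrite fineK.
have GE y : G (update x n y) <-> (fine z0)%:E < Xi y.
  by rewrite -zE; exact: splitting_update_iff.
have levE y : G (update x n y) -> lev l (update x n y) = z0.
  move=> Gy; have z0y : z0 < Xi y by rewrite zE; apply/GE.
  by have [_] := splitting_update k_range ln nS G0 z0y; rewrite update_update.
have zeta_z0 : zeta x < (fine z0)%:E.
  have z0oo : z0 < +oo by rewrite zE ltry.
  (* z0 is the maximum of a killed replica, which is not n and therefore exceeds the preceding level
     [zeta x]; this lets [kappa] absorb a resampling at z0. *)
  have [m mK me'] := level_attained k_range ln z0oo.
  have me : Xi (update x n y0 m) = z0 by exact: me'.
  have mn : m <> n.
    move=> emn; have h : z0 < Xi (update x n y0 n) := splitting_survivor nS G0.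
    by move: me h; rewrite emn => ->; rewrite ltxx.
  have ml : m \in l by move: mK; rewrite mem_filter => /andP[].
  by rewrite -zE -me /update; case: eqP => // _; exact: Ox.
pose B : set (path_space S) := [set y | ((fine z0)%:E < Xi y)%E].
pose phi (y : path_space S) : \bar R := (\1_B y)%:E * F (update x n y).
have mB : measurable B.
  rewrite -[X in measurable X]setTI; apply: measurable_lte => //.
  exact: measurable_max_level.
have mFx : measurable_fun setT (fun y : path_space S => F (update x n y)).
  exact: measurableT_comp mFu (pair1_measurable x).
have mphi : measurable_fun setT phi.
  by apply: emeasurable_funM => //; exact: measurable_fun_EFin_indic.
have phi0 y : 0 <= phi y by apply: mule_ge0 => //; rewrite lee_fin.
transitivity (\int[kappa x]_y phi y).
  apply: eq_integral => y _; rewrite /F1 /phi !indicE.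
  by congr ((_ : bool)%:R%:E * _); apply/idP/idP; rewrite !inE => /GE.
(* A resampling at z0 is inserted: it does not change whether z0 is exceeded, and on the event it is
   the one in [I]. *)
rewrite -(kappa_piz _ _ zeta_z0 phi)//.
apply: eq_integral => y _; rewrite /H indicE.
have ae_y := resampled_level piz_law (fine z0) y.
have [/set_mem Gy|/negP nGy] := boolP (update x n y \in G).
  rewrite mul1e /I levE// (_ : update x n y n = y); last by rewrite /update eqxx.
  have -> : (fun y' => F (update (update x n y) n y')) = (fun y' => F (update x n y')).
    by apply/funext => y'; rewrite update_update.
  apply: ae_eq_integral => //.
  apply: ae_imply ae_y => y' e _; rewrite /phi indicE mem_set ?mul1e//=.
  by rewrite /B /= e; apply/GE.
rewrite mul0e; apply: ae_integral_cst => //; first exact: prob_kernel.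
apply: ae_imply ae_y => y' e; rewrite /phi indicE memNset ?mul0e//=.
by rewrite /B /= e => /GE Gy; apply: nGy; exact: mem_set.
Qed.

End resampling_invariance.

(** * Histories and weights *)

(* A history lists, last iteration first, the survivors, the killed labels and
   the parents of the new labels. *)
Definition split_step := (seq nat * seq nat * seq nat)%type.

Section histories.
Context {R : realType} {S : ptopologicalType}.
Context (A : set (borel S)) (xi : borel S -> R) (zmax : R) (nrep k : nat).
Context {d : measure_display} {Omega : measurableType d}.
Context (X0 : nat -> Omega -> path_space S).
Context (parent : nat -> nat -> Omega -> nat).
Context (Y : nat -> nat -> Omega -> path_space S).
Implicit Types (w : Omega) (q n m : nat) (h : seq split_step) (l : seq nat).

Local Notation run := (ams_run A xi zmax nrep k X0 parent Y).
Local Notation surv q w := (survivors A xi k (run q w)).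
Local Notation kill q w := (killed A xi k (run q w)).
Local Notation halts q w := (stops A xi zmax k (run q w)).
Local Notation crea := (created A xi zmax nrep k X0 parent Y).
Local Notation lev l x := (level A xi k (state_of l x)).

Lemma run_stable q w : halts q w -> run q.+1 w = run q w.
Proof. by rewrite /= /ams_step => ->. Qed.

Lemma labels_step q w : ~~ halts q w ->
  perm_eq (labels (run q.+1 w)) (labels (run q w) ++ crea q w).
Proof.
move=> ns; rewrite /= /ams_step (negbTE ns) /labels /= /created.
rewrite -catA (perm_catCA _ (new_labels A xi zmax k (run q w))) perm_catC.
rewrite perm_cat2r catA perm_sym.
apply: perm_trans (_ : perm_eq _ ((kill q w ++ surv q w) ++ Ioff (run q w))) _.
  rewrite perm_cat2r perm_sym.
  have -> : surv q w = [seq n <- Ion (run q w) | predC (fun n =>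
      (max_level A xi (replica (run q w) n) <= level A xi k (run q w))%E) n].
    by apply: eq_filter => n /=; rewrite ltNge.
  by rewrite /killed perm_filterC.
by rewrite -[X in perm_eq X _]catA perm_catC.
Qed.

(** The bound on the labels makes those of the next iteration, numbered from the number of labels
    plus one, distinct from all the old ones. *)
Lemma run_labels q w : [/\ size (Ion (run q w)) = nrep, uniq (labels (run q w)) &
  forall n, n \in labels (run q w) -> (n <= size (labels (run q w)))%N].
Proof.
elim: q => [|q [sI uL bL]].
  rewrite /= /labels /= cats0 size_iota iota_uniq; split => // n.
  by rewrite mem_iota add1n ltnS => /andP[].
have [st|ns] := boolP (halts q w); first by rewrite run_stable.
have pL := labels_step ns.
have cE : crea q w = iota (size (labels (run q w))).+1 (size (kill q w)).
  by rewrite /created /new_labels (negbTE ns).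
split.
- rewrite /= /ams_step (negbTE ns) /= size_cat /new_labels (negbTE ns) size_iota.
  by rewrite addnC size_killed_survivors.
- rewrite (perm_uniq pL) cat_uniq uL cE iota_uniq andbT /=.
  apply/hasPn => n; rewrite mem_iota => /andP[nL _].
  by apply/negP => /bL; rewrite leqNgt nL.
- move=> n; rewrite (perm_mem pL) (perm_size pL) mem_cat size_cat cE size_iota.
  case/orP => [/bL h|]; first exact: leq_trans (leq_addr _ _).
  by rewrite mem_iota => /andP[_]; rewrite addSn ltnS.
Qed.

Fixpoint history_on h : seq nat :=
  if h is (Sv, Kl, _) :: h' then
    Sv ++ iota (size (history_on h' ++ history_off h')).+1 (size Kl)
  else init_labels nrep
with history_off h : seq nat :=
  if h is (_, Kl, _) :: h' then history_off h' ++ Kl else [::].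

Definition history_new h (Kl : seq nat) : seq nat :=
  iota (size (history_on h ++ history_off h)).+1 (size Kl).

Fixpoint run_history q w : seq split_step :=
  if q is q'.+1
  then (surv q' w, kill q' w, [seq parent q' n w | n <- crea q' w]) ::
       run_history q' w
  else [::].

Definition history_event h : set Omega :=
  [set w | (forall r, (r < size h)%N -> ~~ halts r w) /\
           run_history (size h) w = h].

(** For fixed h each coordinate is one of the draws or [point], so the configuration is measurable
    on the whole of [Omega]; it describes the run on the event of h, at the labels in use. *)
Fixpoint history_config h w : config S :=
  if h is (Sv, Kl, _) :: h' then
    fun n => if n \in history_new h' Kl then Y (size h') n w
             else history_config h' w n
  else fun n => if n \in init_labels nrep then X0 n w else point.

Lemma eq_replica_level s l x : Ion s = l ->
  {in l, forall n, replica s n = x n} ->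
  [/\ level A xi k s = lev l x, stops A xi zmax k s = stops A xi zmax k (state_of l x),
      survivors A xi k s = survivors A xi k (state_of l x) &
      killed A xi k s = killed A xi k (state_of l x)].
Proof.
move=> sl sx.
have e : {in l, forall n, max_level A xi (replica s n) = max_level A xi (x n)}.
  by move=> n nl; rewrite sx.
have le : level A xi k s = lev l x.
  by rewrite -(eq_level k e) /level /= sl.
split => //; first by rewrite /stops le.
  by rewrite /survivors sl le; apply: eq_in_filter => n nl; rewrite e.
by rewrite /killed sl le; apply: eq_in_filter => n nl; rewrite e.
Qed.

Lemma history_run h w : history_event h w ->
  [/\ Ion (run (size h) w) = history_on h,
      Ioff (run (size h) w) = history_off h &
      {in history_on h ++ history_off h, forall n,
         replica (run (size h) w) n = history_config h w n}].
Proof.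
elim: h => [|[[Sv Kl] Pl] h IH] [ns] /=.
  by move=> _; split => // n; rewrite cats0 => ->.
move=> [sE kE _ hE].
have hw : history_event h w.
  by split=> // r rh; apply: ns; rewrite /= ltnS ltnW.
have nsh := ns _ (ltnSn (size h)).
have [onE offE rE] := IH hw.
have newE : new_labels A xi zmax k (run (size h) w) = history_new h Kl.
  by rewrite /new_labels (negbTE nsh) /labels onE offE kE.
rewrite /ams_step (negbTE nsh) /= newE sE kE offE; split => // n.
rewrite !mem_cat; case: ifP => // nnew /=.
rewrite orbF => nold; apply: rE.
rewrite mem_cat; case/orP: nold => [|/orP[->|]]; last 2 first.
- by rewrite orbT.
- by rewrite -kE /killed mem_filter onE => /andP[_ ->].
by rewrite -sE /survivors mem_filter onE => /andP[_ ->].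
Qed.

Lemma history_levels h w : history_event h w ->
  let s := run (size h) w in let x := history_config h w in
  [/\ level A xi k s = lev (history_on h) x,
      stops A xi zmax k s = stops A xi zmax k (state_of (history_on h) x),
      survivors A xi k s = survivors A xi k (state_of (history_on h) x) &
      killed A xi k s = killed A xi k (state_of (history_on h) x)].
Proof.
move=> hw; have [onE offE rE] := history_run hw.
by apply: eq_replica_level => // n nl; apply: rE; rewrite mem_cat nl.
Qed.

Lemma history_labels h w : history_event h w ->
  [/\ size (history_on h) = nrep, uniq (history_on h ++ history_off h) &
      forall n, n \in history_on h ++ history_off h ->
        (n <= size (history_on h ++ history_off h))%N].
Proof.
move=> hw; have [onE offE _] := history_run hw.
by have := run_labels (size h) w; rewrite /labels onE offE.
Qed.

Lemma history_created h Sv Kl w : history_event h w ->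
  splitting A xi zmax k (history_on h) Sv Kl (history_config h w) ->
  crea (size h) w = history_new h Kl.
Proof.
move=> hw [ns _ kE]; have [onE offE _] := history_run hw.
have [_ stE _ killE] := history_levels hw.
by rewrite /created /new_labels stE (negbTE ns) /labels onE offE killE kE.
Qed.

Lemma history_event_cons h Sv Kl Pl w :
  history_event ((Sv, Kl, Pl) :: h) w <->
  [/\ history_event h w,
      splitting A xi zmax k (history_on h) Sv Kl (history_config h w) &
      [seq parent (size h) n w | n <- history_new h Kl] = Pl].
Proof.
split.
  move=> [ns] /= [sE kE pE hE].
  have hw : history_event h w.
    by split=> // r rh; apply: ns; rewrite /= ltnS ltnW.
  have [_ stE sE' kE'] := history_levels hw.
  have sp : splitting A xi zmax k (history_on h) Sv Kl (history_config h w).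
    split; [|by rewrite -sE'|by rewrite -kE'].
    by rewrite -stE; exact: (ns _ (ltnSn (size h))).
  by split => //; rewrite -pE (history_created hw sp).
move=> [hw sp pE]; have [ns hE] := hw.
have [_ stE sE' kE'] := history_levels hw; have [nst sE kE] := sp.
split=> /=.
  move=> r; rewrite ltnS leq_eqVlt => /orP[/eqP ->|]; last exact: ns.
  by rewrite stE.
by rewrite hE (history_created hw sp) pE sE' kE' sE kE.
Qed.

Lemma history_new_notin h Kl w n : history_event h w ->
  n \in history_new h Kl -> n \notin history_on h ++ history_off h.
Proof.
move=> hw; have [_ _ b] := history_labels hw.
rewrite mem_iota => /andP[ln _]; apply/negP => /b; by rewrite leqNgt ln.
Qed.

Lemma run_history_event q w : ~~ halts q w -> history_event (run_history q w) w.
Proof.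
have sz r : size (run_history r w) = r by elim: r => //= r ->.
move=> ns; split; rewrite sz // => r rq; apply: contra ns.
elim: q rq => // q IH; rewrite ltnS leq_eqVlt => /orP[/eqP <- st|rq st].
  by rewrite (run_stable st).
by rewrite (run_stable (IH rq st)); exact: IH.
Qed.

Section history_measurability.
Variable Alg : set (set Omega).
Hypothesis sAlg : sigma_algebra setT Alg.

Let AlgC E : Alg E -> Alg (~` E).
Proof. by case: sAlg => _ C _ /C; rewrite setTD. Qed.

Let AlgI E E' : Alg E -> Alg E' -> Alg (E `&` E').
Proof.
rewrite -(sigma_algebra_id sAlg); exact: sigma_algebra_setI.
Qed.

Let Alg0 : Alg set0. Proof. by case: sAlg. Qed.

Let AlgT : Alg setT. Proof. by rewrite -setC0; exact: AlgC. Qed.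

Let Alg_bigcap (F : (set Omega)^nat) : (forall i, Alg (F i)) -> Alg (\bigcap_i F i).
Proof.
move=> AF; rewrite -[X in Alg X]setCK setC_bigcap; apply: AlgC.
by case: sAlg => _ _; apply => i; exact: AlgC.
Qed.

Lemma algebra_config (E : set Omega) (f : Omega -> config S) : Alg E ->
  (forall n (C : set (path_space S)), measurable C ->
     Alg (E `&` [set w | C (f w n)])) ->
  forall D, measurable D -> Alg (E `&` f @^-1` D).
Proof.
move=> AE Af D mD.
suff : (measurable : set (set (config S))) `<=` [set D | Alg (E `&` f @^-1` D)].
  by apply.
apply: smallest_sub.
  split=> /=; first by rewrite preimage_set0 setI0.
  - move=> B AB; rewrite setTD preimage_setC.
    rewrite (_ : _ `&` _ = E `&` ~` (E `&` f @^-1` B)); first exact/AlgI/AlgC.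
    by rewrite setCI setIUr setICr set0U.
  - move=> F AF; rewrite preimage_bigcup setI_bigcupr.
    by case: sAlg => _ _; apply.
move=> _ [C mC ->] /=.
rewrite (_ : _ `&` _ = \bigcap_n (E `&` [set w | C n (f w n)])).
  by apply: Alg_bigcap => n; exact: Af.
apply/seteqP; split => w; first by move=> [Ew h] n _; split.
by move=> h; split=> [|n]; [have [] := h 0%N I|have [] := h n I].
Qed.

Hypothesis Alg_init : forall n (C : set (path_space S)),
  n \in init_labels nrep -> measurable C -> Alg (X0 n @^-1` C).

(** Stated for any sigma-algebra, to be applied both to the measurable sets and to [generated]. The
    latter sees a parent or a path only at a label that has been created, hence the side conditions
    on [E]. *)
Lemma history_event_algebra h :
  (forall E r n p, (r < size h)%N -> Alg E -> (forall w, E w -> n \in crea r w) ->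
     Alg (E `&` [set w | parent r n w = p])) ->
  (forall E r n C, (r < size h)%N -> Alg E -> (forall w, E w -> n \in crea r w) ->
     measurable C -> Alg (E `&` [set w | C (Y r n w)])) ->
  (forall l Sv Kl, size l = nrep ->
     measurable (splitting A xi zmax k l Sv Kl : set (config S))) ->
  forall D, measurable D -> Alg (history_event h `&` history_config h @^-1` D).
Proof.
move=> Ap AY mG; elim: h Ap AY => [|[[Sv Kl] Pl] h IH] Ap AY D mD.
  have -> : history_event [::] = setT by apply/seteqP; split.
  apply: algebra_config => // n C mC; rewrite setTI /=.
  have [ni|nni] := boolP (n \in init_labels nrep); first exact: Alg_init.
  by have [Cp|nCp] := pselect (C point);
    [rewrite (_ : mkset _ = setT)//|rewrite (_ : mkset _ = set0)//];
    apply/seteqP; split.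
have {}IH := IH (fun E r n p rh => Ap E r n p (leqW rh))
                (fun E r n C rh => AY E r n C (leqW rh)).
have [[w0 hw0]|/forallNP nE] := pselect (exists w, history_event h w); last first.
  rewrite (_ : _ `&` _ = set0)//; apply/seteqP; split => // w [].
  by move=> /history_event_cons[/nE].
have [onN _ _] := history_labels hw0.
pose E0 := history_event h `&`
  history_config h @^-1` splitting A xi zmax k (history_on h) Sv Kl.
have AE0 : Alg E0 by apply: IH; exact: mG.
(* The splitting is fixed first: it determines which labels are created, hence which parents and
   paths are visible. *)
have E0c w : E0 w -> crea (size h) w = history_new h Kl.
  by move=> [hw sp]; exact: history_created hw sp.
have AE0p l P : {subset l <= history_new h Kl} ->
    Alg (E0 `&` [set w | [seq parent (size h) n w | n <- l] = P]).
  elim: l P => [|n l IHl] P lnew.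
    have [->|/eqP P0] := eqVneq P [::].
      by rewrite (_ : mkset _ = setT) ?setIT//; apply/seteqP; split.
    rewrite (_ : _ `&` _ = set0)//; apply/seteqP; split => // w [_ /=] /esym.
    by [].
  case: P => [|p P]; first by rewrite (_ : _ `&` _ = set0)//; apply/seteqP; split => // w [].
  rewrite (_ : _ `&` _ = (E0 `&` [set w | parent (size h) n w = p]) `&`
     (E0 `&` [set w | [seq parent (size h) n w | n <- l] = P])).
    apply: AlgI; last by apply: IHl => m ml; apply: lnew; rewrite inE ml orbT.
    apply: Ap => // w /E0c ->; apply: lnew; exact: mem_head.
  by apply/seteqP; split => w /=; [move=> [? [-> ->]]|move=> [[? ->] [_ ->]]].
pose E1 := E0 `&` [set w | [seq parent (size h) n w | n <- history_new h Kl] = Pl].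
have AE1 : Alg E1 by exact: AE0p.
have -> : history_event ((Sv, Kl, Pl) :: h) = E1.
  apply/seteqP; split => w; first by move=> /history_event_cons[].
  by move=> [[? ?] ?]; apply/history_event_cons.
apply: algebra_config => // n C mC /=.
have [nnew|nold] := boolP (n \in history_new h Kl).
  by apply: AY => // w [/E0c ->].
rewrite (_ : _ `&` _ = E1 `&` (history_event h `&`
    history_config h @^-1` [set x : config S | C (x n)])).
  apply: AlgI => //; apply: IH.
  by rewrite -[X in measurable X]setTI; exact: measurable_replica.
by apply/seteqP; split => w /=; [move=> [[[? ?] ?] ?]|move=> [? []]].
Qed.

End history_measurability.

Definition split_event h Sv Kl : set Omega := history_event h `&`
  history_config h @^-1` splitting A xi zmax k (history_on h) Sv Kl.

Local Notation on := history_on.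
Local Notation new := history_new.
Local Notation hev := history_event.
Local Notation conf := history_config.
Local Notation split_ev := split_event.
Local Notation hist := run_history.

Lemma history_config_old h Sv Kl Pl w n : n \notin new h Kl ->
  conf ((Sv, Kl, Pl) :: h) w n = conf h w n.
Proof. by rewrite /= => /negbTE ->. Qed.

Lemma history_config_new h Sv Kl Pl w n : n \in new h Kl ->
  conf ((Sv, Kl, Pl) :: h) w n = Y (size h) n w.
Proof. by rewrite /= => ->. Qed.

Lemma history_on_notin_new h Kl w n : hev h w -> n \in on h -> n \notin new h Kl.
Proof.
move=> hw non; apply/negP => /(history_new_notin hw).
by rewrite mem_cat non.
Qed.

Lemma level_config_cons h Sv Kl Pl w : hev h w ->
  lev (on h) (conf ((Sv, Kl, Pl) :: h) w) = lev (on h) (conf h w).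
Proof.
move=> hw; apply: eq_level => n non; rewrite history_config_old//.
exact: history_on_notin_new hw non.
Qed.

Lemma split_survivor_on h Sv Kl w n : split_ev h Sv Kl w -> n \in Sv -> n \in on h.
Proof. by move=> [_ [_ <- _]]; rewrite mem_filter => /andP[]. Qed.

(** * Weights and estimator along a history *)

Hypothesis k_range : (0 < k < nrep)%N.

Let nrep_neq0 : nrep%:R != 0 :> R.
Proof. by rewrite pnatr_eq0 -lt0n; case/andP: k_range => _; exact: leq_trans. Qed.

Lemma size_killed_survivors_run q w :
  (size (kill q w) + size (surv q w))%N = nrep.
Proof.
by rewrite size_killed_survivors; have [] := run_labels q w.
Qed.

Lemma weight_ge0 q w n : 0 <= weight (run q w) n.
Proof.
elim: q n => [|q IH] n /=; first by rewrite invr_ge0.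
rewrite /ams_step; case: ifP => // _ /=.
have w0 m : 0 <= (if m \in surv q w
    then (nrep%:R - (size (kill q w))%:R) / nrep%:R * weight (run q w) m
    else weight (run q w) m).
  case: ifP => // _; rewrite !mulr_ge0 ?invr_ge0// subr_ge0 ler_nat.
  by rewrite -[leqRHS](size_killed_survivors_run q w) leq_addr.
by case: ifP.
Qed.

(** The parents are part of the history, so it determines all the weights, even if a parent is not a
    survivor; the measurability of the estimator rests on this. *)
Lemma history_weights h w w0 : hev h w -> hev h w0 ->
  weight (run (size h) w) =1 weight (run (size h) w0).
Proof.
elim: h => [//|[[Sv Kl] Pl] h IH] hw hw0 n.
have [hw' sp pw] := (history_event_cons _ _ _ _ _).1 hw.
have [hw0' sp0 pw0] := (history_event_cons _ _ _ _ _).1 hw0.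
have cE := history_created hw' sp; have cE0 := history_created hw0' sp0.
have [ns sE kE] := sp; have [ns0 sE0 kE0] := sp0.
have [_ stE sE' kE'] := history_levels hw'.
have [_ stE0 sE0' kE0'] := history_levels hw0'.
have {}IH := IH hw' hw0'.
rewrite /= /ams_step stE stE0 (negbTE ns) (negbTE ns0) /=.
rewrite -/(crea (size h) w) -/(crea (size h) w0) cE cE0.
rewrite sE' sE0' kE' kE0' sE sE0 kE kE0 !IH.
case: ifP => // nn; suff -> : parent (size h) n w = parent (size h) n w0 by [].
by move: pw; rewrite -pw0 => /eq_in_map; exact.
Qed.

(** The law of the draws makes this almost sure only, so the pathwise identities take it as a
    hypothesis. *)
Definition parents_survive q w : Prop :=
  forall n, n \in crea q w -> parent q n w \in surv q w.

Fixpoint common_weight h : R :=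
  if h is (_, Kl, _) :: h' then
    (nrep%:R - (size Kl)%:R) / nrep%:R * common_weight h'
  else nrep%:R^-1.

Lemma common_weight_ge0 h w : hev h w -> 0 <= common_weight h.
Proof.
elim: h => [|[[Sv Kl] Pl] h IH] hw /=; first by rewrite invr_ge0.
have [hw' sp pw] := (history_event_cons _ _ _ _ _).1 hw.
have [_ _ kE] := sp; have [onN _ _] := history_labels hw'.
rewrite !mulr_ge0 ?invr_ge0 ?(IH hw')// subr_ge0 ler_nat -[leqRHS]onN -kE.
by rewrite /killed size_filter; exact: count_size.
Qed.

Lemma split_survivors h Sv Kl w : split_ev h Sv Kl w ->
  [/\ ~~ halts (size h) w, surv (size h) w = Sv, kill (size h) w = Kl,
      crea (size h) w = new h Kl & {in on h ++ history_off h, forall n,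
      replica (run (size h) w) n = conf h w n}].
Proof.
move=> [hw sp]; have [ns sE kE] := sp.
have [_ stE sE' kE'] := history_levels hw.
have [_ _ rE] := history_run hw.
by rewrite stE ns sE' kE' sE kE; split => //; exact: history_created hw sp.
Qed.

Lemma size_run_history q w : size (hist q w) = q.
Proof. by elim: q => //= q ->. Qed.

Lemma run_split_event q w : ~~ halts q w ->
  split_ev (hist q w) (surv q w) (kill q w) w.
Proof.
move=> ns; have hw := run_history_event ns; split => //.
have [_ stE sE kE] := history_levels hw.
by rewrite size_run_history in stE sE kE; split; rewrite -?stE.
Qed.

Lemma history_weight h w : hev h w ->
  (forall r, (r < size h)%N -> parents_survive r w) ->
  {in on h, forall n, weight (run (size h) w) n = common_weight h}.
Proof.
elim: h => [//|[[Sv Kl] Pl] h IH] hw ps n.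
have [hw' sp pw] := (history_event_cons _ _ _ _ _).1 hw.
have {}IH := IH hw' (fun r rh => ps r (ltnW rh)).
have [ns sE kE cE _] : _ := split_survivors (conj hw' sp).
have psh := ps _ (ltnSn _).
have wS m : m \in Sv -> weight (run (size h) w) m = common_weight h.
  by move=> mS; apply: IH; exact: split_survivor_on (conj hw' sp) mS.
rewrite /= /ams_step (negbTE ns) /= -/(crea (size h) w) cE sE kE.
rewrite mem_cat => nS.
have [nn|nnn] := boolP (n \in new h Kl).
  have pS : parent (size h) n w \in Sv by rewrite -sE psh// cE.
  by rewrite pS wS.
case/orP: nS => nS; last by rewrite /history_new nS in nnn.
by rewrite nS wS.
Qed.

Lemma sum_killed_survivors (s : ams_state R S) (F : nat -> R) :
  \sum_(n <- Ion s) F n =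
  \sum_(n <- killed A xi k s) F n + \sum_(n <- survivors A xi k s) F n.
Proof.
rewrite /killed /survivors !big_filter [LHS](bigID (fun n =>
  (max_level A xi (replica s n) <= level A xi k s)%E))/=; congr (_ + _).
by apply: eq_bigl => n; rewrite ltNge.
Qed.

(** Each survivor loses the fraction K / nrep of its weight, and the new terms enter with the
    reduced weight. The identity has only sums, so that it can be integrated term by term for
    nonnegative [phi]. *)
Lemma estimate_step h Sv Kl w (phi : (nat -> S) -> R) : split_ev h Sv Kl w ->
  (forall r, (r <= size h)%N -> parents_survive r w) ->
  estimate phi (run (size h).+1 w) +
    (size Kl)%:R / nrep%:R * common_weight h * \sum_(n <- Sv) phi (conf h w n) =
  estimate phi (run (size h) w) + (nrep%:R - (size Kl)%:R) / nrep%:R *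
    common_weight h * \sum_(n <- new h Kl) phi (Y (size h) n w).
Proof.
move=> sp ps; have [hw _] := sp.
have [ns sE kE cE rE] := split_survivors sp.
have cw := history_weight hw (fun r rh => ps r (ltnW rh)).
have psh := ps _ (leqnn _).
have [onE offE _] := history_run hw; have [_ uL _] := history_labels hw.
have Son n : n \in Sv -> n \in on h by exact: split_survivor_on sp.
have Kon n : n \in Kl -> n \in on h by rewrite -kE mem_filter onE => /andP[].
have Snew n : n \in Sv -> n \notin new h Kl.
  by move=> /Son non; exact: history_on_notin_new hw non.
have oldnew n : n \in on h ++ history_off h -> n \notin new h Kl.
  by move=> no; apply/negP => /(history_new_notin hw); rewrite no.
have offS n : n \in history_off h -> n \notin Sv.
  move=> noff; apply/negP => /Son non; move: uL; rewrite cat_uniq => /and3P[_ + _].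
  by move=> /hasPn/(_ _ noff)/negP; apply.
have KS n : n \in Kl -> n \notin Sv.
  by rewrite -kE -sE !mem_filter => /andP[le ->]; rewrite andbT ltNge le.
pose c := common_weight h.
pose a := (nrep%:R - (size Kl)%:R) / nrep%:R * c.
(* The labels fall into survivors, new, formerly killed and just killed ones; the last two groups
   keep their weights. *)
rewrite {1 2}/estimate /labels /= /ams_step (negbTE ns) /= -/(crea (size h) w).
rewrite cE sE kE onE offE !big_cat /=.
rewrite -{1}onE sum_killed_survivors sE kE.
have oldE n : n \in on h ++ history_off h ->
    (n \in new h Kl) = false by move=> /oldnew/negbTE.
rewrite [X in X + _ + _ + _ = _](eq_big_seq (fun n => a * phi (conf h w n))); last first.
  by move=> n nS; rewrite (negbTE (Snew _ nS)) nS cw ?Son// rE// mem_cat Son.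
rewrite [X in _ + X + _ + _ = _](eq_big_seq (fun n => a * phi (Y (size h) n w)));
    last first.
  move=> n nn; have pS : parent (size h) n w \in Sv by rewrite -sE psh// cE.
  by rewrite nn pS cw ?Son.
rewrite [X in _ + (X + _) + _ = _](eq_big_seq (fun n =>
    weight (run (size h) w) n * phi (replica (run (size h) w) n))); last first.
  by move=> n noff; rewrite oldE ?mem_cat ?noff ?orbT// (negbTE (offS _ noff)).
rewrite [X in _ + (_ + X) + _ = _](eq_big_seq (fun n =>
    weight (run (size h) w) n * phi (replica (run (size h) w) n))); last first.
  by move=> n nK; rewrite oldE ?mem_cat ?Kon// (negbTE (KS _ nK)).
rewrite [X in _ = _ + X + _ + _](eq_big_seq (fun n => c * phi (conf h w n))); last first.
  by move=> n nS; rewrite cw ?Son// rE// mem_cat Son.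
rewrite -!mulr_sumr -/c /a.
by field; exact: nrep_neq0.
Qed.

(** The function 1 in [estimate_step]: with nrep - K survivors and K new labels the two corrections
    are equal. *)
Lemma total_weight q w : (forall r, (r < q)%N -> parents_survive r w) ->
  \sum_(n <- labels (run q w)) weight (run q w) n = 1.
Proof.
elim: q => [|q IH] ps.
  rewrite /labels /= cats0 big_const_seq count_predT size_iota iter_addr addr0.
  by rewrite -[LHS]mulr_natr mulVf.
have {}IH := IH (fun r rq => ps r (ltnW rq)).
have [st|ns] := boolP (halts q w); first by rewrite run_stable.
have sp := run_split_event ns; have sz := size_run_history q w.
have := estimate_step (fun=> 1) sp; rewrite sz => /(_ ps).
rewrite /estimate; under eq_bigr do rewrite mulr1.
under [X in _ = X + _]eq_bigr do rewrite mulr1.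
rewrite IH !big_const_seq !count_predT !iter_addr !addr0 size_iota.
have -> : (size (surv q w))%:R = nrep%:R - (size (kill q w))%:R :> R.
  have /(congr1 (fun m => m%:R : R)) := size_killed_survivors_run q w.
  by rewrite natrD => <-; rewrite addrC addKr.
have eqK (x y a b : R) : x / a * b * y = y / a * b * x by ring.
by rewrite eqK => /addIr.
Qed.

End histories.

(** * The law of the draws *)

Definition rectangle (S : ptopologicalType) (C : nat -> set (path_space S)) :
  set (config S) := [set x | forall n, C n (x n)].

Lemma measurable_rectangle (S : ptopologicalType) (C : nat -> set (path_space S)) :
  (forall n, measurable (C n)) -> measurable (rectangle C).
Proof. by move=> mC; apply: sub_sigma_algebra; exists C. Qed.

Section rectangle_criterion.
Local Open Scope ereal_scope.
Context {R : realType} {S : completePseudoMetricType R}.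
Context d (Om : measurableType d) (Pr : probability Om R).

Lemma measure_slice_rectangle (mu : {measure set (path_space S) -> \bar R})
    (C : nat -> set (path_space S)) (x : config S) n :
  mu [set y | rectangle C (update x n y)] =
  (\1_(rectangle (update C n setT)) x)%:E * mu (C n).
Proof.
rewrite indicE; have [/set_mem Cx|/negP nCx] := boolP (x \in _).
  rewrite mul1e; congr (mu _); apply/seteqP; split => y /=.
    by move=> /(_ n); rewrite /update eqxx.
  move=> Cy m; rewrite /update; case: eqP => [->//|mn].
  by have := Cx m; rewrite /update; case: eqP.
rewrite mul0e (_ : mkset _ = set0) ?measure0//; apply/seteqP; split => // y Cy.
apply: nCx; apply: mem_set => m; have := Cy m; rewrite /update.
by case: eqP.
Qed.

Lemma measurable_update_setT (C : nat -> set (path_space S)) n :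
  (forall m, measurable (C m)) -> forall m, measurable (update C n setT m).
Proof. by move=> mC m; rewrite /update; case: eqP. Qed.

(** [disintegration] with weight 1: redrawing coordinate n frees its constraint and replaces it by
    the factor [k (V w) (C n)]. *)
Lemma resampling_invariant_rectangle (D : set Om) (V : Om -> config S) n
    (k : R.-pker (config S) ~> (path_space S)) :
  measurable D -> measurable_fun setT V ->
  (forall C, (forall m, measurable (C m)) ->
    Pr (D `&` V @^-1` rectangle C) =
    \int[Pr]_(w in D)
      ((\1_(rectangle (update C n setT)) (V w))%:E * k (V w) (C n))) ->
  resampling_invariant Pr D V n k.
Proof.
move=> mD mV h F F0 mF.
have mone : measurable_fun setT ((fun=> 1%R) : Om -> R) by exact: measurable_cst.
have mpair : measurable_fun setT
    (fun u : Om * path_space S => (V u.1, u.2) : config S * path_space S).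
  apply: measurable_fun_pair; last exact: measurable_snd.
  exact: measurableT_comp mV measurable_fst.
have mg : measurable_fun setT
    (fun u : Om * path_space S => update (V u.1) n u.2 : config S).
  exact: measurableT_comp (@measurable_update S n) mpair.
rewrite (disintegration (k := kernel_precomp k mV) mD mD mone (fun=> ler01) mV mg
  (G := @rectangles S))//.
- by apply: eq_integral => w _; rewrite mul1e.
- exact: setI_closed_rectangles.
- exact: rectanglesT.
- move=> _ [C mC ->]; apply: etrans (h C mC) _; apply: eq_integral => w _.
  by rewrite mul1e -measure_slice_rectangle.
Qed.

End rectangle_criterion.

Section uniform_draws.
Local Open Scope ereal_scope.
Context d (T : measurableType d) (R : realType) (mu : {measure set T -> \bar R}).
Implicit Types (E : set T) (g : T -> \bar R) (l s : seq nat).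

Lemma integral_nat_partition E g (X : T -> nat) s (b : nat -> \bar R) :
  measurable E -> measurable_fun setT X -> measurable_fun setT g ->
  (forall x, 0 <= g x) -> uniq s ->
  (forall i, \int[mu]_(x in E `&` X @^-1` [set i]) g x =
     if i \in s then b i else 0) ->
  \int[mu]_(x in E) g x = \sum_(i <- s) b i.
Proof.
move=> mE mX mg g0 us gE.
have EE : E = \bigcup_i (E `&` X @^-1` [set i]).
  by apply/seteqP; split => [x Ex|x [i _ []//]]; exists (X x).
rewrite {1}EE ge0_integral_bigcup//; last 3 first.
- by move=> i; apply: measurableI => //; rewrite -[V in measurable V]setTI; exact: mX.
- exact: measurable_funTS.
- by move=> i j _ _ [x [[_ <-] [_ <-]]].
have b0 i : i \in s -> 0 <= b i.
  by move=> si; have := gE i; rewrite si => <-; exact: integral_ge0.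
rewrite (eq_eseriesr (fun i _ => gE i)) -eseries_mkcond.
rewrite nneseries_esum// esum_fset; last 2 first.
- exact: finite_seq.
- by move=> i; rewrite inE; exact: b0.
by rewrite -fsbig_seq.
Qed.

(* Summing out independent uniform draws, one at a time. *)
Lemma integral_uniform_draws (X : nat -> T -> nat) s g l : uniq s -> s != [::] ->
  (forall n, measurable_fun setT (X n)) -> measurable_fun setT g ->
  (forall x, 0 <= g x) -> uniq l ->
  forall E c, measurable E -> 0 <= c ->
  (forall p : nat -> nat,
     \int[mu]_(x in E `&` [set x | forall n, n \in l -> X n x = p n]) g x =
     (\prod_(n <- l) (if p n \in s then (size s)%:R^-1 else 0 : R)%R)%:E * c) ->
  \int[mu]_(x in E) g x = c.
Proof.
move=> us s0 mX mg g0; elim: l => [_|n l IH /= /andP[nl ul]] E c mE c0 gE.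
  have := gE id; rewrite big_nil mul1e => <-; congr (integral mu _ g).
  by apply/seteqP; split => x // [].
(* c is split into equal shares, one for each value of the draw [X n]; the induction hypothesis is
   then used on each event where [X n] is i. *)
have cE : c = \sum_(i <- s) (((size s)%:R^-1)%:E * c).
  rewrite -ge0_sume_distrl; last by move=> i _; rewrite lee_fin.
  rewrite sumEFin big_const_seq count_predT iter_addr addr0.
  have sz : (size s)%:R != 0%R :> R by rewrite pnatr_eq0 size_eq0.
  have -> : ((size s)%:R^-1 *+ size s = 1 :> R)%R by rewrite -[LHS]mulr_natr mulVf.
  by rewrite mul1e.
rewrite [RHS]cE; apply: (integral_nat_partition mE (mX n)) => // i.
have mEi : measurable (E `&` X n @^-1` [set i]).
  by apply: measurableI => //; rewrite -[V in measurable V]setTI; exact: mX.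
have ci0 : 0 <= (if i \in s then (size s)%:R^-1 else 0 : R)%R%:E * c.
  by apply: mule_ge0 => //; rewrite lee_fin; case: ifP.
rewrite (IH ul _ _ mEi ci0); first by case: ifP => // _; rewrite mul0e.
move=> p; have := gE (fun m => if m == n then i else p m).
rewrite big_cons eqxx EFinM -muleA muleCA => e.
transitivity (\int[mu]_(x in E `&` [set x | forall m, m \in n :: l ->
    X m x = if m == n then i else p m]) g x).
  congr (integral mu _ g); apply/seteqP; split => x.
    move=> [[Ex Xx] h]; split => // m; rewrite inE; case: eqP => [->//|_ /=].
    exact: h.
  move=> [Ex h]; split; [split => //|].
    by have := h n (mem_head _ _); rewrite eqxx.
  move=> m ml; have := h m; rewrite inE ml orbT => /(_ isT) ->.
  by case: eqP => // mn; rewrite -mn ml in nl.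
rewrite e; congr (_%:E * _); rewrite !big_seq; apply: eq_bigr => m ml.
by case: eqP => // mn; rewrite -mn ml in nl.
Qed.

End uniform_draws.

Lemma integral_bounded_fin_num d (T : measurableType d) (R : realType)
    (mu : probability T R) (D : set T) (f : T -> R) M : measurable D ->
  measurable_fun setT f -> (forall x, 0 <= f x <= M) ->
  (\int[mu]_(x in D) (f x)%:E)%E \is a fin_num.
Proof.
move=> mD mf fM; have f0 x : 0 <= f x by case/andP: (fM x).
have M0 : 0 <= M by case/andP: (fM point) => p0; exact: le_trans.
rewrite ge0_fin_numE; last by apply: integral_ge0 => x _; rewrite lee_fin.
apply: (@le_lt_trans _ _ (\int[mu]_(x in D) (cst M%:E) x)%E).
  apply: ge0_le_integral => //.
  - by move=> x _; rewrite lee_fin.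
  - by apply/measurable_EFinP; exact: measurable_funTS.
  - by move=> x _; rewrite lee_fin; case/andP: (fM x).
rewrite integral_cst//; apply: le_lt_trans (ltry M).
rewrite -[leRHS]mule1; apply: lee_wpmul2l; last exact: probability_le1.
by rewrite lee_fin.
Qed.

(** * Conditional laws of the draws and the invariant *)

Section draws.
Local Open Scope ereal_scope.
Context {R : realType} {S : completePseudoMetricType R} (S_polish : polish S).
Context (P : R.-pker (borel S) ~> (borel S)) (A : set (borel S)).
Context (xi : borel S -> R) (zmax : R).
Hypotheses (mA : measurable A) (mxi : measurable_fun setT xi).
Context (piz : R.-pker (measurableTypeR R * path_space S)%type ~> (path_space S)).
Hypothesis piz_law : resampling_kernel P A xi piz.
Context (pi : probability (path_space S) R).
Hypothesis pi_resample : forall z (F : path_space S -> \bar R),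
  (forall y, 0 <= F y) -> measurable_fun setT F ->
  \int[pi]_y \int[piz (z, y)]_w F w = \int[pi]_y F y.
Context (nrep k : nat) (k_range : (0 < k < nrep)%N).
Context (d : measure_display) (Omega : measurableType d) (Pr : probability Omega R).
Context (X0 : nat -> Omega -> path_space S) (parent : nat -> nat -> Omega -> nat).
Context (Y : nat -> nat -> Omega -> path_space S).
Hypothesis draws : ams_draws A xi zmax nrep k X0 parent Y Pr pi piz.
Implicit Types (w : Omega) (q n m j : nat) (h : seq split_step) (l Sv Kl : seq nat).

Local Notation run := (ams_run A xi zmax nrep k X0 parent Y).
Local Notation crea := (created A xi zmax nrep k X0 parent Y).
Local Notation gen := (generated A xi zmax nrep k X0 parent Y).
Local Notation lev l x := (level A xi k (state_of l x)).
Local Notation Xi x := (max_level A xi x).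
Local Notation on := (history_on nrep).
Local Notation new := (history_new nrep).
Local Notation hev := (history_event A xi zmax nrep k X0 parent Y).
Local Notation conf := (history_config nrep X0 Y).
Local Notation split := (splitting A xi zmax k).
Local Notation split_ev := (split_event A xi zmax nrep k X0 parent Y).
Local Notation ps := (parents_survive A xi zmax nrep k X0 parent Y).
Local Notation cw := (common_weight nrep).
Local Notation hist := (run_history A xi zmax nrep k X0 parent Y).
Local Notation halts q w := (stops A xi zmax k (run q w)).
Local Notation est := (ams_estimator A xi zmax nrep k X0 parent Y).
Local Notation u_ Sv := ((size Sv)%:R^-1 : R)%R.

Lemma measurable_history_config h : measurable_fun setT (conf h).
Proof.
apply: measurable_config => n; elim: h => [|[[Sv Kl] Pl] h IH] /=.
  by case: (n \in _); [exact: (measurable_init draws)|exact: measurable_cst].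
by case: (n \in _) => //; exact: (measurable_resampled draws).
Qed.

Lemma history_event_generated h (D : set (config S)) : measurable D ->
  gen (size h) (hev h `&` conf h @^-1` D).
Proof.
apply: history_event_algebra.
- exact: smallest_sigma_algebra.
- move=> n C ni mC; apply: sub_sigma_algebra; left; left.
  by exists n, C.
- move=> E r n p rh gE En.
  rewrite (_ : _ `&` _ = E `&` [set w | n \in crea r w /\ parent r n w = p]).
    apply: sigma_algebra_setI => //.
    by apply: sub_sigma_algebra; left; right; exists r, n, p.
  by apply/seteqP; split => w [Ew /=]; [move=> ?; split => //; split => //; exact: En|case].
- move=> E r n C rh gE En mC.
  rewrite (_ : _ `&` _ = E `&` [set w | n \in crea r w /\ C (Y r n w)]).
    apply: sigma_algebra_setI => //.
    by apply: sub_sigma_algebra; right; exists r, n, C.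
  by apply/seteqP; split => w [Ew /=]; [move=> ?; split => //; split => //; exact: En|case].
- by move=> l Sv Kl ln; exact: (measurable_splitting zmax mA mxi k_range).
Qed.

Lemma measurable_preimageT d1 d2 (T1 : measurableType d1) (T2 : measurableType d2)
    (f : T1 -> T2) (B : set T2) : measurable_fun setT f -> measurable B ->
  measurable (f @^-1` B).
Proof. by move=> mf mB; rewrite -[X in measurable X]setTI; exact: mf. Qed.

Lemma measurable_history_event h : measurable (hev h).
Proof.
rewrite -[hev h]setIT -(preimage_setT (conf h)).
apply: (history_event_algebra (Alg := measurable)) => //.
- exact: sigma_algebra_measurable.
- move=> n C _ mC; exact: (measurable_preimageT (measurable_init draws n)).
- move=> E r n p rh mE _; apply: measurableI => //.
  exact: (measurable_preimageT (measurable_parent draws r n) (B := [set p])).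
- move=> E r n C rh mE _ mC; apply: measurableI => //.
  exact: (measurable_preimageT (measurable_resampled draws r n)).
- by move=> l Sv Kl ln; exact: (measurable_splitting zmax mA mxi k_range).
Qed.

Lemma measurable_split_event h Sv Kl : measurable (split_ev h Sv Kl).
Proof.
have [[w0 hw0]|/forallNP nE] := pselect (exists w, hev h w); last first.
  rewrite (_ : split_ev _ _ _ = set0)//; apply/seteqP; split => // w [].
  by move=> /nE.
have [onN _ _] := history_labels hw0.
apply: measurableI; first exact: measurable_history_event.
apply: measurable_preimageT; first exact: measurable_history_config.
exact: (measurable_splitting zmax mA mxi k_range).
Qed.

Definition new_prob h (p : nat -> nat) (C : nat -> set (path_space S)) n
    (x : config S) : R :=
  fine (piz (fine (lev (on h) x), x (p n) : path_space S) (C n)).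

(** On the event of the splitting, the created labels and the survivors are fixed, and the level and
    the parents' paths are functions of the configuration: the random product of [step_law] becomes
    one over fixed labels. *)
Lemma step_law_history h Sv Kl p C (D : set (config S)) :
  (forall n, measurable (C n)) -> measurable D ->
  Pr (split_ev h Sv Kl `&` conf h @^-1` D `&`
      [set w | forall n, n \in new h Kl ->
         parent (size h) n w = p n /\ C n (Y (size h) n w)]) =
  \int[Pr]_(w in split_ev h Sv Kl `&` conf h @^-1` D)
    (\prod_(n <- new h Kl) ((if p n \in Sv then (size Sv)%:R^-1 else 0) *
       new_prob h p C n (conf h w))%R)%:E.
Proof.
move=> mC mD.
have [[w0 hw0]|/forallNP nE] := pselect (exists w, hev h w); last first.
  rewrite (_ : split_ev _ _ _ = set0); last first.
    by apply/seteqP; split => // w [] /nE.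
  by rewrite !set0I measure0 integral_set0.
have [onN _ _] := history_labels hw0.
have E0P w : split_ev h Sv Kl w ->
    crea (size h) w = new h Kl /\ survivors A xi k (run (size h) w) = Sv /\
    level A xi k (run (size h) w) = lev (on h) (conf h w) /\
    {in Sv, forall n, replica (run (size h) w) n = conf h w n}.
  move=> [hw sp]; split; first exact: history_created sp.
  have [levE _ survE _] := history_levels hw.
  have [_ _ repE] := history_run hw; have [_ sE _] := sp.
  rewrite survE sE levE; split => //; split => // n nS; apply: repE.
  by rewrite mem_cat; move: nS; rewrite -sE mem_filter => /andP[_ ->].
have gE : gen (size h) (split_ev h Sv Kl `&` conf h @^-1` D).
  rewrite -setIA -preimage_setI; apply: history_event_generated.
  by apply: measurableI => //; exact: (measurable_splitting zmax mA mxi k_range).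
have := step_law draws p gE mC.
rewrite (_ : _ `&` [set w | forall n, n \in crea (size h) w -> _] =
  split_ev h Sv Kl `&` conf h @^-1` D `&`
      [set w | forall n, n \in new h Kl ->
         parent (size h) n w = p n /\ C n (Y (size h) n w)]); last first.
  by apply/seteqP; split => w [[E0w Dw] /= hw]; (split; first by []) => n;
    have [cE _] := E0P w E0w; [rewrite -cE|rewrite cE]; exact: hw.
move=> ->; apply: eq_integral => w /set_mem[E0w Dw].
have [cE [sE [lE repE]]] := E0P w E0w; cbv zeta; rewrite cE sE lE.
congr (_%:E); apply: eq_bigr => n _; case: ifP => [pS|]; last by rewrite !mul0r.
by rewrite /new_prob repE.
Qed.

Lemma measurable_new_prob h p C n : size (on h) = nrep ->
  (forall n, measurable (C n)) -> measurable_fun setT (new_prob h p C n).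
Proof.
move=> onN mC; apply: (measurableT_comp (@fine_measurable R _ measurableT)).
exact: measurableT_comp (measurable_kernel piz _ (mC n))
  (measurable_level_replica mA mxi k_range (p n) onN).
Qed.

Lemma new_prob_ge0 h p C n x : (0 <= new_prob h p C n x)%R.
Proof. exact: fine_ge0. Qed.

Definition parents_event h Sv Kl (p : nat -> nat) : set Omega :=
  split_ev h Sv Kl `&`
    [set w | forall n, n \in new h Kl -> parent (size h) n w = p n].

Definition others_event h Kl j (C : nat -> set (path_space S)) : set Omega :=
  [set w | forall n, n \in new h Kl -> n != j -> C n (Y (size h) n w)].

Lemma measurable_forall_new h Kl (E : nat -> set Omega) :
  (forall n, measurable (E n)) ->
  measurable [set w | forall n, n \in new h Kl -> E n w].
Proof.
move=> mE; rewrite (_ : mkset _ = \bigcap_(n in [set n | n \in new h Kl]) E n)//.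
have [->|/set0P ne] := eqVneq [set n | n \in new h Kl] set0.
  by rewrite bigcap_set0.
exact: bigcap_measurable.
Qed.

Lemma measurable_parents_event h Sv Kl p : measurable (parents_event h Sv Kl p).
Proof.
apply: measurableI; first exact: measurable_split_event.
apply: (@measurable_forall_new h Kl (fun n => parent (size h) n @^-1` [set p n])) => n.
exact: (measurable_preimageT (measurable_parent draws _ _)).
Qed.

Lemma measurable_others_event h Kl j C : (forall n, measurable (C n)) ->
  measurable (others_event h Kl j C).
Proof.
move=> mC; apply: (@measurable_forall_new h Kl
  (fun n => [set w | n != j -> C n (Y (size h) n w)])) => n.
have [nj|nj] := boolP (n != j).
  rewrite (_ : mkset _ = Y (size h) n @^-1` C n).
    exact: (measurable_preimageT (measurable_resampled draws _ _)).
  by apply/seteqP; split => w /=; [exact|].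
by rewrite (_ : mkset _ = setT)//; apply/seteqP; split.
Qed.

(** All factors of the conditional probability except the law of path j; the leading factor is the
    probability of the parent of j. *)
Definition others_prob h Sv Kl p C j (x : config S) : R :=
  ((size Sv)%:R^-1 * \prod_(n <- new h Kl)
    (if n == j then 1 else (size Sv)%:R^-1 * new_prob h p C n x))%R.

Lemma others_prob_ge0 h Sv Kl p C j x : (0 <= others_prob h Sv Kl p C j x)%R.
Proof.
apply: mulr_ge0; first by rewrite invr_ge0.
apply: prodr_ge0 => n _; case: ifP => // _; apply: mulr_ge0 => //.
exact: new_prob_ge0.
Qed.

Lemma measurable_others_prob h Sv Kl p C j : size (on h) = nrep ->
  (forall n, measurable (C n)) ->
  measurable_fun setT (others_prob h Sv Kl p C j).
Proof.
move=> onN mC; apply: measurable_funM => //.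
apply: (measurable_prod (h := fun n x => if n == j then 1%R else
  ((size Sv)%:R^-1 * new_prob h p C n x)%R)) => n _.
case: (n == j) => //; apply: measurable_funM => //.
exact: measurable_new_prob.
Qed.

Lemma others_probE h Sv Kl p C j x : j \in new h Kl ->
  (\prod_(n <- new h Kl) ((size Sv)%:R^-1 * new_prob h p C n x))%R =
  (others_prob h Sv Kl p C j x * new_prob h p C j x)%R.
Proof.
move=> jn; rewrite (bigD1_seq j) ?iota_uniq//= /others_prob.
rewrite [in RHS](bigD1_seq j) ?iota_uniq//= eqxx mul1r mulrAC; congr (_ * _ * _)%R.
by apply: eq_bigr => n /negbTE ->.
Qed.

(** [disintegration] leaves products of two sets to check, where this is [step_law] with the second
    set as constraint at j. The other new paths keep their constraints and contribute the weight
    [others_prob]. *)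
Lemma integral_new_path h Sv Kl p C j (F : config S * path_space S -> \bar R) :
  j \in new h Kl -> {in new h Kl, forall n, p n \in Sv} ->
  (forall n, measurable (C n)) -> (forall u, 0 <= F u) -> measurable_fun setT F ->
  \int[Pr]_(w in parents_event h Sv Kl p `&` others_event h Kl j C)
     F (conf h w, Y (size h) j w) =
  \int[Pr]_(w in split_ev h Sv Kl) ((others_prob h Sv Kl p C j (conf h w))%:E *
     \int[piz (fine (lev (on h) (conf h w)), conf h w (p j))]_y F (conf h w, y)).
Proof.
move=> jn pS mC F0 mF.
have [[w0 hw0]|/forallNP nE] := pselect (exists w, hev h w); last first.
  have E0 : split_ev h Sv Kl = set0.
    by apply/seteqP; split => // w [] /nE.
  by rewrite /parents_event E0 !set0I !integral_set0.
have [onN _ _] := history_labels hw0.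
have mconf := measurable_history_config h.
have mk := measurableT_comp
  (measurable_level_replica mA mxi k_range (p j) onN) mconf.
have mf : measurable_fun setT
    (fun w => (conf h w, Y (size h) j w) : config S * path_space S).
  by apply: measurable_fun_pair => //; exact: (measurable_resampled draws).
have mg : measurable_fun setT
    (fun u : Omega * path_space S => (conf h u.1, u.2) : config S * path_space S).
  apply: measurable_fun_pair; last exact: measurable_snd.
  exact: measurableT_comp mconf measurable_fst.
have mD : measurable (parents_event h Sv Kl p `&` others_event h Kl j C).
  apply: measurableI; first exact: measurable_parents_event.
  exact: measurable_others_event.
rewrite (disintegration (k := kernel_precomp piz mk) mD (measurable_split_event h Sv Kl)
  (measurableT_comp (measurable_others_prob Sv Kl p j onN mC) mconf)
  (fun w => others_prob_ge0 h Sv Kl p C j (conf h w)) mf mg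
  (G := [set B1 `*` B2 | B1 in measurable & B2 in measurable]))//.
- by rewrite -measurable_prod_measurableType.
- move=> _ _ [B1 mB1 [B2 mB2 <-]] [B3 mB3 [B4 mB4 <-]].
  exists (B1 `&` B3); first exact: measurableI.
  exists (B2 `&` B4); first exact: measurableI.
  by rewrite setXI.
- by exists setT => //; exists setT => //; rewrite setXTT.
move=> _ [B mB [B' mB' <-]].
have mC' n : measurable (update C j B' n) by rewrite /update; case: eqP.
transitivity (Pr (split_ev h Sv Kl `&` conf h @^-1` B `&`
      [set w | forall n, n \in new h Kl ->
         parent (size h) n w = p n /\ update C j B' n (Y (size h) n w)])).
  congr (Pr _); apply/seteqP; split => w /=.
    move=> [[[E0w pw] ow] [Bw B'w]]; split => // n nn; split; first exact: pw.
    rewrite /update; case: eqP => [->//|/eqP nj]; exact: ow.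
  move=> [[E0w Bw] hw]; split; last first.
    by split => //; have [_] := hw j jn; rewrite /update eqxx.
  split; first by split => // n nn; have [] := hw n nn.
  by move=> n nn nj; have [_] := hw n nn; rewrite /update (negbTE nj).
rewrite step_law_history// integral_setI_indicl; apply: eq_integral => w _.
rewrite indicE; have [/set_mem Bw|/negP nBw] := boolP (w \in _); last first.
  rewrite mul0e (_ : mkset _ = set0) ?measure0 ?mule0//.
  by apply/seteqP; split => // y [] Bw _; apply: nBw; exact: mem_set.
rewrite mul1e.
have -> : (\prod_(n <- new h Kl) ((if p n \in Sv then (size Sv)%:R^-1 else 0) *
    new_prob h p (update C j B') n (conf h w)))%R =
  (\prod_(n <- new h Kl) ((size Sv)%:R^-1 *
    new_prob h p (update C j B') n (conf h w)))%R.
  by rewrite !big_seq; apply: eq_bigr => n nn; rewrite pS.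
rewrite (others_probE _ _ _ _ jn) EFinM; congr (_%:E * _).
  rewrite /others_prob; congr (_ * _)%R; apply: eq_bigr => n _.
  by case: eqP => // /eqP nj; rewrite /new_prob /update (negbTE nj).
rewrite /new_prob fineK; last first.
  exact: finite_kernel_measure (mC' j).
rewrite /update eqxx; congr (piz _ _).
by apply/seteqP; split => y //= [].
Qed.

Lemma history_event_parents h Sv Kl Pl w0 : hev ((Sv, Kl, Pl) :: h) w0 ->
  hev ((Sv, Kl, Pl) :: h) = parents_event h Sv Kl (fun n => parent (size h) n w0).
Proof.
move=> /history_event_cons[_ _ p0].
apply/seteqP; split => w.
  move=> /history_event_cons[hw sp pw]; split; first by split.
  by rewrite -p0 in pw => n nn; move/eq_in_map : pw => /(_ n nn).
move=> [[hw sp] pw]; apply/history_event_cons; split => //.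
by rewrite -p0; apply/eq_in_map => n /pw.
Qed.

Lemma parents_event_null h Sv Kl p n : n \in new h Kl -> p n \notin Sv ->
  Pr (parents_event h Sv Kl p) = 0.
Proof.
move=> nn pnS.
have := step_law_history h Sv Kl p
  (C := fun=> setT) (fun=> measurableT) measurableT.
rewrite preimage_setT setIT (_ : _ `&` _ = parents_event h Sv Kl p); last first.
  apply/seteqP; split => w [E0w h']; split => // m mn.
    by have [] := h' m mn.
  by split => //; exact: h'.
move=> ->; apply: integral0_eq => w _.
by rewrite (bigD1_seq n) ?iota_uniq//= (negbTE pnS) !mul0r.
Qed.

(* Before the first iteration, resampling means a fresh draw from [pi]. *)
Definition history_kernel h n (x : config S) :
    {measure set (path_space S) -> \bar R} :=
  if h is _ :: h' then piz (fine (lev (on h') x), x n : path_space S) else pi.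

(** No level has been imposed before the first iteration, hence -oo. Later it is the level of the
    last iteration, read on the labels that were working before it, whose paths the iteration does
    not touch. *)
Definition history_level h (x : config S) : \bar R :=
  if h is _ :: h' then (fine (lev (on h') x))%:E else -oo.

(** The second clause makes the next level exceed the last one; without it the kernel in the first
    clause could not absorb a resampling at the next level. *)
Definition history_invariant h : Prop :=
  {in on h, forall n,
     resampling_invariant Pr (hev h) (conf h) n (history_kernel h n)} /\
  {ae Pr, forall w, hev h w -> forall m, m \in on h ->
     history_level h (conf h w) < Xi (conf h w m)}.

(** The kernel of the invariant absorbs a resampling at the next level: for the empty history
    because [pi] is invariant, afterwards because the levels increase. *)
Lemma resampling_invariant_split h Sv Kl n w0 : hev h w0 -> n \in Sv ->
  n \in on h -> history_invariant h ->
  resampling_invariant Pr (split_ev h Sv Kl) (conf h) n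
    (fun x => piz (fine (lev (on h) x), x n : path_space S)).
Proof.
move=> hw0 nS non [inv above].
have [onN _ _] := history_labels hw0.
have mconf := measurable_history_config h.
have mhev := measurable_history_event h.
have {}inv := inv n non.
case: h => [|[[Sv' Kl'] Pl'] h] in hw0 non inv above onN mconf mhev *.
  refine (resampling_invariant_splitting zmax mA mxi piz_law k_range
    (kappa := kernel_cst (config S) pi) (zeta := fun=> -oo) Kl onN mhev mconf nS
    _ above inv).
  by move=> x z _ F F0 mF; exact: pi_resample.
have [hw0' _ _] := (history_event_cons _ _ _ _ _ _ _ _ _ _ _ _ _).1 hw0.
have [onN' _ _] := history_labels hw0'.
refine (resampling_invariant_splitting zmax mA mxi piz_law k_range
  (kappa := kernel_precomp piz (measurable_level_replica mA mxi k_range n onN'))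
  (zeta := history_level ((Sv', Kl', Pl') :: h)) Kl onN mhev mconf nS _ above inv).
move=> x z /=; rewrite lte_fin => xz F F0 mF.
exact: (resampled_resample S_polish mA mxi piz_law (x n) (ltW xz) F0 mF).
Qed.

(** The parent survived, and resampling does not change whether the level is exceeded. *)
Lemma new_path_above h Sv Kl p w0 : hev h w0 ->
  {in new h Kl, forall n, p n \in Sv} ->
  {ae Pr, forall w, parents_event h Sv Kl p w -> forall j, j \in new h Kl ->
     lev (on h) (conf h w) < Xi (Y (size h) j w)}.
Proof.
move=> hw0 pS; have [onN _ _] := history_labels hw0.
suff : {ae Pr, forall w, forall j, parents_event h Sv Kl p w -> j \in new h Kl ->
     lev (on h) (conf h w) < Xi (Y (size h) j w)}.
  by apply: ae_imply => w hw pw j; exact: hw.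
apply: ae_foralln => j.
have [jn|jn] := boolP (j \in new h Kl); last by apply: aeW => w _.
have mconf := measurable_history_config h.
have mlev := measurable_level mA mxi k_range onN.
pose B : set (config S * path_space S) := [set u | (Xi u.2 <= lev (on h) u.1)%E].
have mB : measurable B.
  rewrite -[X in measurable X]setTI; apply: measurable_lee => //.
    exact: measurableT_comp (measurable_max_level mA mxi) measurable_snd.
  exact: measurableT_comp mlev measurable_fst.
have mYc : measurable_fun setT
    (fun w => (conf h w, Y (size h) j w) : config S * path_space S).
  by apply: measurable_fun_pair => //; exact: (measurable_resampled draws).
pose N := parents_event h Sv Kl p `&` (fun w => (conf h w, Y (size h) j w)) @^-1` B.
have mN : measurable N.
  apply: measurableI; first exact: (measurable_parents_event).
  by rewrite -[X in measurable X]setTI; exact: mYc.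
exists N; split => //; last first.
  move=> w /=; apply: contra_notP => nN pw _; rewrite ltNge; apply/negP => le.
  by apply: nN; split.
have := integral_new_path (Sv := Sv) (C := fun=> setT)
  (F := fun u => (\1_B u)%:E) jn pS (fun=> measurableT)
  (fun u => _ : 0 <= (\1_B u)%:E) (measurable_fun_EFin_indic mB).
rewrite (_ : others_event h Kl j (fun=> setT) = setT); last by apply/seteqP; split.
rewrite setIT => e.
transitivity (\int[Pr]_(w in parents_event h Sv Kl p)
    (\1_B (conf h w, Y (size h) j w))%:E).
  rewrite /N setIC -integral_indic//.
    exact: (measurable_parents_event).
  by rewrite -[X in measurable X]setTI; exact: mYc.
rewrite e; last by move=> u; rewrite lee_fin.
apply: integral0_eq => w [hw sp].
rewrite (_ : \int[_]_y _ = 0) ?mule0//.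
apply: ae_integral_cst; first exact: prob_kernel.
  exact: measurableT_comp (measurable_fun_EFin_indic mB) (pair1_measurable _).
have levE := splitting_level_fin k_range onN sp.
apply: ae_imply (resampled_level piz_law (fine (lev (on h) (conf h w))) (conf h w (p j))) => y.
rewrite !fineK// (splitting_survivor (pS _ jn) sp) => zy.
by rewrite indicE memNset// /B /= leNgt zy.
Qed.

Lemma indic_rectangle_update (C : nat -> set (path_space S)) (x : config S) n y :
  ((\1_(rectangle C) (update x n y : config S))%:E =
   (\1_(rectangle (update C n setT)) x)%:E * (\1_(C n) y)%:E :> \bar R).
Proof.
exact: (@measure_slice_rectangle R S (\d_y) C x n).
Qed.

(** Coordinates outside the initial labels are equal to [point], hence the condition on [C]
    there. *)
Lemma init_law (C : nat -> set (path_space S)) : (forall n, measurable (C n)) ->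
  (forall n, n \notin init_labels nrep -> C n point) ->
  Pr (conf [::] @^-1` rectangle C) =
  (\prod_(n <- init_labels nrep) fine (pi (C n)))%:E.
Proof.
move=> mC Cpt; rewrite -(init_iid draws mC); congr (Pr _).
apply/seteqP; split => w h n; first by move=> ni; have := h n; rewrite /= ni.
by rewrite /=; case: ifPn => [/h//|]; exact: Cpt.
Qed.

(** The initial replicas are independent with law [pi], so the factor of n can be pulled out of the
    product and read as a fresh draw. *)
Lemma history_invariant_nil : history_invariant [::].
Proof.
have hevT : hev [::] = setT by apply/seteqP; split.
have mconf := measurable_history_config [::].
split=> [n ni|]; last by apply: aeW => w _ m _ /=; exact: max_level_gtNy.
refine (@resampling_invariant_rectangle _ _ _ _ _ _ _ n (kernel_cst (config S) pi)
  (measurable_history_event [::]) mconf _) => C mC.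
rewrite hevT setTI.
have [Cpt|nCpt] := pselect (forall m, m \notin init_labels nrep -> C m point);
    last first.
  rewrite (_ : _ @^-1` _ = set0); last first.
    apply/seteqP; split => // w hC; apply: nCpt => m mi.
    by have := hC m; rewrite /= (negbTE mi).
  rewrite measure0; apply/esym; apply: integral0_eq => w _.
  rewrite indicE memNset ?mul0e// => hC; apply: nCpt => m mi.
  have := hC m; rewrite /= (negbTE mi) /update; case: eqP => // mn.
  by move: mi; rewrite mn ni.
have mCn := measurable_update_setT n mC.
rewrite init_law//.
rewrite (eq_integral (fun w => (fine (pi (C n)))%:E *
  (\1_(rectangle (update C n setT)) (conf [::] w))%:E)); last first.
  move=> w _; rewrite muleC; congr (_ * _).
  by rewrite fineK//; exact: fin_num_measure.
rewrite ge0_integralZl_EFin//; last 2 first.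
- exact: measurableT_comp (measurable_fun_EFin_indic (measurable_rectangle mCn)) mconf.
- exact: fine_ge0.
rewrite -[X in _ = _ * X]/(\int[Pr]_w
  (\1_(conf [::] @^-1` rectangle (update C n setT)) w)%:E).
rewrite -measure_integral_indic; last first.
  by apply: measurable_preimageT => //; exact: measurable_rectangle.
transitivity ((fine (pi (C n)))%:E *
    (\prod_(m <- init_labels nrep) fine (pi (update C n setT m)))%:E); last first.
  congr (_ * _); apply/esym/init_law => // m mi.
  by rewrite /update; case: eqP => // _; exact: Cpt.
rewrite -EFinM; congr (_%:E).
rewrite (bigD1_seq n) ?iota_uniq//=; congr (_ * _)%R.
rewrite [RHS](bigD1_seq n) ?iota_uniq//= {1}/update eqxx.
rewrite probability_setT /= mul1r; apply: eq_bigr => m /negbTE mn.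
by rewrite /update mn.
Qed.

Lemma history_invariant_empty h : hev h = set0 -> history_invariant h.
Proof.
move=> h0; split.
  by move=> n _ F F0 mF; rewrite h0 !integral_set0.
by apply: aeW => w; rewrite h0.
Qed.

(** Settles the histories in which some parent is not a survivor: their events are null and every
    integral over them vanishes. *)
Lemma history_invariant_null s h w0 : hev (s :: h) w0 ->
  Pr (hev (s :: h)) = 0 -> history_invariant (s :: h).
Proof.
case: s => [[Sv Kl] Pl] hw0 h0.
have mhev := measurable_history_event ((Sv, Kl, Pl) :: h).
have mconf := measurable_history_config ((Sv, Kl, Pl) :: h).
have [hw0' _ _] := (history_event_cons _ _ _ _ _ _ _ _ _ _ _ _ _).1 hw0.
have [onN _ _] := history_labels hw0'.
split; last first.
  exists (hev ((Sv, Kl, Pl) :: h)); split => // w /=.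
  by apply: contra_notP => nhw hw; case: nhw.
move=> n _; refine (@resampling_invariant_rectangle _ _ _ _ _ _ _ n
  (kernel_precomp piz (measurable_level_replica mA mxi k_range n onN))
  mhev mconf _) => C mC.
transitivity (0 : \bar R).
  apply: (subset_measure0 _ _ _ h0) => //.
  apply: measurableI => //; apply: measurable_preimageT => //.
  exact: measurable_rectangle.
rewrite null_set_integral//; apply: measurable_funTS; apply: emeasurable_funM.
  exact: measurableT_comp (measurable_fun_EFin_indic
    (measurable_rectangle (measurable_update_setT n mC))) mconf.
exact: measurableT_comp (measurable_kernel (kernel_precomp piz
  (measurable_level_replica mA mxi k_range n onN)) _ (mC n)) mconf.
Qed.

Lemma measurable_integral_new_path_factor h n (R0 : set (config S))
    (C : set (path_space S)) : size (on h) = nrep ->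
  measurable R0 -> measurable C ->
  measurable_fun setT (fun x : config S => (\1_R0 x)%:E *
    piz (fine (lev (on h) x), x n : path_space S) C).
Proof.
move=> onN mR mC; apply: emeasurable_funM; first exact: measurable_fun_EFin_indic.
exact: measurableT_comp (measurable_kernel piz _ mC)
  (measurable_level_replica mA mxi k_range n onN).
Qed.

Section iteration.
Variables (h : seq split_step) (Sv Kl Pl : seq nat) (w0 : Omega).
Hypothesis hw0 : hev ((Sv, Kl, Pl) :: h) w0.
Let p n := parent (size h) n w0.
Hypothesis pS : {in new h Kl, forall n, p n \in Sv}.
Hypothesis inv_h : history_invariant h.
Variable C : nat -> set (path_space S).
Hypothesis mC : forall n, measurable (C n).

Let h' := (Sv, Kl, Pl) :: h.
(** The constraints of [C] on the labels already present; those on the new labels cannot be read on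
    the configuration of h and turn into the factor [prodq]. *)
Let Cold n : set (path_space S) := if n \in new h Kl then setT else C n.
Let mCold n : measurable (Cold n).
Proof. by rewrite /Cold; case: ifP. Qed.

Let hw : hev h w0.
Proof. by have [] := (history_event_cons _ _ _ _ _ _ _ _ _ _ _ _ _).1 hw0. Qed.
Let onN : size (on h) = nrep.
Proof. by have [] := history_labels hw. Qed.
Let hevE : hev h' = parents_event h Sv Kl p.
Proof. exact: history_event_parents hw0. Qed.

Let conf_old w n : n \notin new h Kl -> conf h' w n = conf h w n.
Proof. exact: history_config_old. Qed.
Let conf_new w n : n \in new h Kl -> conf h' w n = Y (size h) n w.
Proof. exact: history_config_new. Qed.
Let lev_cons w : hev h w -> lev (on h) (conf h' w) = lev (on h) (conf h w).
Proof. exact: level_config_cons. Qed.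

Let prodq (x : config S) : R :=
  (\prod_(n <- new h Kl) (u_ Sv * new_prob h p C n x))%R.

Let prodq_ge0 x : (0 <= prodq x)%R.
Proof.
apply: prodr_ge0 => n _; apply: mulr_ge0 => //; exact: new_prob_ge0.
Qed.

Let mprodq : measurable_fun setT prodq.
Proof.
apply: (measurable_prod (h := fun n x => (u_ Sv * new_prob h p C n x)%R)) => n _.
apply: measurable_funM; first exact: measurable_cst.
exact: (measurable_new_prob p n onN mC).
Qed.

Let pzlev (x : config S) m B := piz (fine (lev (on h) x), x m : path_space S) B.

Lemma history_rectangle_law :
  Pr (hev h' `&` conf h' @^-1` rectangle C) =
  \int[Pr]_(w in split_ev h Sv Kl)
    ((\1_(rectangle Cold) (conf h w))%:E * (prodq (conf h w))%:E).
Proof.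
rewrite hevE.
transitivity (Pr (split_ev h Sv Kl `&` conf h @^-1` rectangle Cold `&`
   [set w | forall n, n \in new h Kl ->
     parent (size h) n w = p n /\ C n (Y (size h) n w)])).
  congr (Pr _); apply/seteqP; split => w.
    move=> [[E0w pw] Cw]; split.
      split => // n; rewrite /Cold; case: ifPn => // nn.
      by have := Cw n; rewrite conf_old.
    move=> n nn; split; first exact: pw.
    by have := Cw n; rewrite conf_new.
  move=> [[E0w Cw] pw]; split.
    by split => // n nn; have [] := pw n nn.
  move=> n; have [nn|nn] := boolP (n \in new h Kl).
    by rewrite conf_new//; have [] := pw n nn.
  by rewrite conf_old//; have := Cw n; rewrite /Cold (negbTE nn).
rewrite (step_law_history)//; last exact: measurable_rectangle.
rewrite integral_setI_indicl; apply: eq_integral => w _; congr (_ * _%:E).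
by rewrite /prodq !big_seq; apply: eq_bigr => n nn; rewrite pS.
Qed.

(* Here the invariance is the idempotence of resampling. *)
Lemma history_invariant_new n : n \in new h Kl ->
  \int[Pr]_(w in hev h')
    ((\1_(rectangle (update C n setT)) (conf h' w))%:E * pzlev (conf h' w) n (C n)) =
  \int[Pr]_(w in split_ev h Sv Kl)
    ((\1_(rectangle Cold) (conf h w))%:E * (prodq (conf h w))%:E).
Proof.
move=> nn.
pose F (u : config S * path_space S) : \bar R := (\1_(rectangle Cold) u.1)%:E *
  piz (fine (lev (on h) u.1), u.2) (C n).
have F0 u : 0 <= F u by apply: mule_ge0; rewrite ?lee_fin.
have mF : measurable_fun setT F.
  apply: emeasurable_funM.
    exact: measurableT_comp
      (measurable_fun_EFin_indic (measurable_rectangle mCold)) measurable_fst.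
  have ml : measurable_fun setT (fun u : config S * path_space S =>
      (fine (lev (on h) u.1) : measurableTypeR R)).
    exact: measurableT_comp (measurableT_comp (@fine_measurable R _ measurableT)
      (measurable_level mA mxi k_range onN)) measurable_fst.
  exact: measurableT_comp (measurable_kernel piz _ (mC n))
    (measurable_fun_pair ml measurable_snd).
(* The constraint on the new path n is freed; those on the other new paths go to [others_event],
   those on the older labels to [Cold]. *)
transitivity (\int[Pr]_(w in parents_event h Sv Kl p `&` others_event h Kl n C)
    F (conf h w, Y (size h) n w)).
  rewrite hevE [RHS]integral_setI_indicl; apply: eq_integral => w /set_mem[[hw' sp] pw].
  rewrite /F muleA [RHS]/= /pzlev (lev_cons hw')// conf_new//; congr (_ * _).
  rewrite !indicE -EFinM -natrM mulnb; congr ((_ : bool)%:R%:E).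
  apply/idP/idP.
    move=> /set_mem Cw; apply/andP; split; apply/mem_set.
      move=> m mn mnn; have := Cw m.
      by rewrite /update (negbTE mnn) conf_new.
    move=> m; rewrite /Cold; case: ifPn => // mn; have := Cw m.
    rewrite conf_old// /update; case: eqP => // e.
    by rewrite e nn in mn.
  move=> /andP[/set_mem ow /set_mem Cw]; apply/mem_set => m.
  rewrite /update; case: eqP => // /eqP mnn.
  have [mn|mn] := boolP (m \in new h Kl).
    by rewrite conf_new//; exact: ow.
  by rewrite conf_old//; have := Cw m; rewrite /Cold (negbTE mn).
rewrite (integral_new_path nn pS mC F0 mF).
apply: eq_integral => w _; rewrite /F /=.
have mpc : measurable_fun setT (fun y : path_space S =>
    piz (fine (lev (on h) (conf h w)), y) (C n)).
  exact: measurableT_comp (measurable_kernel piz _ (mC n)) (measurable_at_level _).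
rewrite ge0_integralZl_EFin//.
rewrite muleCA; congr (_ * _).
rewrite /prodq (others_probE _ _ _ _ nn) [RHS]EFinM; congr (_ * _).
rewrite /new_prob fineK; last exact: finite_kernel_measure (mC n).
rewrite [RHS]measure_integral_indic//.
apply: etrans (resampled_resample S_polish mA mxi piz_law _ (lexx _)
  (F := fun y => (\1_(C n) y)%:E) _ _) => //.
- by apply: eq_integral => y _; rewrite -measure_integral_indic.
- exact: measurable_fun_EFin_indic.
Qed.

(* For a surviving replica, resampling above the level changes neither the
   level nor the law of the draws made from it. *)
Lemma history_invariant_survivor n : n \in Sv ->
  \int[Pr]_(w in hev h')
    ((\1_(rectangle (update C n setT)) (conf h' w))%:E * pzlev (conf h' w) n (C n)) =
  \int[Pr]_(w in split_ev h Sv Kl)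
    ((\1_(rectangle Cold) (conf h w))%:E * (prodq (conf h w))%:E).
Proof.
move=> nS.
have sp0 : split_ev h Sv Kl w0.
  by move: hw0; rewrite -/h' hevE => -[].
have non : n \in on h by exact: split_survivor_on sp0 nS.
have nold : n \notin new h Kl by exact: history_on_notin_new hw non.
have mRn := measurable_rectangle (measurable_update_setT n mCold).
(* A replica attains the level and is killed, so there is a new label; singling out its path makes
   [integral_new_path] applicable. *)
have [j jn] : exists j, j \in new h Kl.
  have loo : lev (on h) (conf h w0) < +oo.
    have [_ sp] := sp0; have := splitting_level_fin k_range onN sp.
    by case: (lev _ _) => // r _; exact: ltry.
  have [m mK _] := level_attained k_range onN loo.
  exists (size (on h ++ history_off nrep h)).+1.
  rewrite /history_new; have : m \in Kl by have [_ [_ _ <-]] := sp0.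
  by case: (Kl) => // a l _ /=; rewrite inE eqxx.
pose G (x : config S) : \bar R := (\1_(rectangle Cold) x)%:E * (prodq x)%:E.
have G0 x : 0 <= G x by apply: mule_ge0; rewrite lee_fin.
have mG : measurable_fun setT G.
  apply: emeasurable_funM; last exact/measurable_EFinP.
  exact: measurable_fun_EFin_indic (measurable_rectangle mCold).
pose c (x : config S) : \bar R :=
  (\1_(rectangle (update Cold n setT)) x)%:E * pzlev x n (C n).
have mc : measurable_fun setT c.
  exact: measurable_integral_new_path_factor.
have c0 x : 0 <= c x by apply: mule_ge0; rewrite ?lee_fin.
(* Integrating out the new paths on the left leaves their probabilities [prodq] at the current
   configuration, next to the resampling of n in [c]. *)
transitivity (\int[Pr]_(w in split_ev h Sv Kl) ((prodq (conf h w))%:E * c (conf h w))).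
  pose F (u : config S * path_space S) : \bar R := c u.1 * (\1_(C j) u.2)%:E.
  have F0 u : 0 <= F u by apply: mule_ge0; rewrite ?lee_fin.
  have mF : measurable_fun setT F.
    apply: emeasurable_funM; first exact: measurableT_comp mc measurable_fst.
    exact: measurableT_comp (measurable_fun_EFin_indic (mC j)) measurable_snd.
  transitivity (\int[Pr]_(w in parents_event h Sv Kl p `&` others_event h Kl j C)
      F (conf h w, Y (size h) j w)).
    rewrite hevE [RHS]integral_setI_indicl.
    apply: eq_integral => w /set_mem[[hw' sp] pw].
    rewrite /F /c [RHS]/= /pzlev (lev_cons hw')//.  rewrite conf_old//.
    rewrite [_ * _ * (\1_(C j) _)%:E]muleAC muleA; congr (_ * _).
    rewrite !indicE -!EFinM -!natrM !mulnb; congr ((_ : bool)%:R%:E).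
    apply/idP/idP.
      move=> /set_mem Cw; apply/and3P; split; apply/mem_set.
      - move=> m mn mj; have := Cw m; rewrite /update conf_new//.
        by case: eqP => // e; move: nold; rewrite -e mn.
      - move=> m; rewrite /update; case: eqP => // /eqP mnn.
        rewrite /Cold; case: ifPn => // mn; have := Cw m.
        by rewrite /update (negbTE mnn) conf_old.
      - have := Cw j; rewrite /update conf_new//.
        by case: eqP => // e; move: nold; rewrite -e jn.
    move=> /and3P[/set_mem ow /set_mem Cw /set_mem Cj]; apply/mem_set => m.
    rewrite /update; case: eqP => // /eqP mnn.
    have [mn|mn] := boolP (m \in new h Kl).
      rewrite conf_new//; have [->//|/eqP mj] := eqVneq m j.
      by apply: ow => //; apply/eqP.
    rewrite conf_old//; have := Cw m.
    by rewrite /update (negbTE mnn) /Cold (negbTE mn).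
  rewrite (integral_new_path jn pS mC F0 mF).
  apply: eq_integral => w _; rewrite /F /=.
  rewrite ge0_integralZl//; last exact: measurable_fun_EFin_indic.
  rewrite -measure_integral_indic// muleCA muleC; congr (_ * _).
  rewrite /prodq (others_probE _ _ _ _ jn) [RHS]EFinM; congr (_ * _).
  by rewrite /new_prob fineK//; exact: finite_kernel_measure (mC j).
(* On the right the invariant of h redraws n above the level, inside [prodq] as well; the integrands
   are then compared for a fixed configuration. *)
rewrite [RHS](resampling_invariant_split Kl hw nS non inv_h G0 mG).
apply: eq_integral => w /set_mem[hw' sp].
move: sp; rewrite /preimage /=; move: (conf h w) => x sp.
have zfin := splitting_level_fin k_range onN sp.
have zx := splitting_survivor nS sp.
set z := fine (lev (on h) x).
have zE : lev (on h) x = z%:E by rewrite /z (fineK zfin).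
transitivity (\int[piz (z, x n)]_y
  ((prodq x)%:E * (\1_(rectangle (update Cold n setT)) x)%:E * (\1_(C n) y)%:E)).
  rewrite -EFinM ge0_integralZl_EFin//; last 2 first.
  - exact: measurable_fun_EFin_indic.
  - exact: mulr_ge0.
  by rewrite -measure_integral_indic// [in RHS]EFinM /c muleA.
apply: ae_eq_integral => //.
- rewrite -EFinM; apply: emeasurable_funM => //.
  exact: measurable_fun_EFin_indic.
- exact: measurableT_comp (measurableT_comp mG (@measurable_update S n))
    (pair1_measurable x).
have aeX := resampled_level piz_law z (x n).
have aeK := resampled_kernel S_polish mA piz_law z (x n).
(* The redrawn path y still exceeds the level, so the level is unchanged, and its resampling kernel
   is that of [x n]: the probabilities of the new paths are the same even if n is a parent. *)
apply: (ae_imply2 _ aeX aeK) => y ey ky _.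
have zy : lev (on h) x < Xi y by rewrite zE ey -zE.
have [_ ly] := splitting_update k_range onN nS sp zy.
rewrite /G indic_rectangle_update.
have -> : Cold n = C n by rewrite /Cold (negbTE nold).
rewrite [RHS]muleC muleA; congr (_%:E * _ * _).
apply: eq_bigr => m _; congr (_ * _)%R; rewrite /new_prob ly -/z; congr fine.
rewrite /update; case: eqP => // ->.
exact/esym/ky.
Qed.

End iteration.

Lemma history_invariant_cons s h : history_invariant h ->
  history_invariant (s :: h).
Proof.
case: s => [[Sv Kl] Pl] inv_h; set h' := _ :: h.
have [[w0 hw0]|/forallNP nE] := pselect (exists w, hev h' w); last first.
  by apply: history_invariant_empty; apply/seteqP; split => // w /nE.
pose p n := parent (size h) n w0.
have hevE : hev h' = parents_event h Sv Kl p by exact: history_event_parents hw0.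
have [pS|npS] := pselect {in new h Kl, forall n, p n \in Sv}; last first.
  apply: (history_invariant_null hw0).
  move: npS => /existsNP[n /not_implyP[nn /negP npS]].
  have h0 := parents_event_null nn npS.
  by rewrite -hevE in h0.
have [hw sp0 _] := (history_event_cons _ _ _ _ _ _ _ _ _ _ _ _ _).1 hw0.
have [onN _ _] := history_labels hw.
split.
  move=> n non; refine (@resampling_invariant_rectangle _ _ _ _ _ _ _ n
    (kernel_precomp piz (measurable_level_replica mA mxi k_range n onN))
    (measurable_history_event h')
    (measurable_history_config h') _) => C mC.
  rewrite (history_rectangle_law hw0 pS mC).
  move: non; rewrite mem_cat => /orP[nS|nn]; apply/esym.
    exact: history_invariant_survivor.
  exact: history_invariant_new.
apply: ae_imply (new_path_above hw pS) => w + hw' m; rewrite mem_cat => above.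
have [hwh sp _] := (history_event_cons _ _ _ _ _ _ _ _ _ _ _ _ _).1 hw'.
have levE := splitting_level_fin k_range onN sp.
have -> : history_level h' (conf h' w) = lev (on h) (conf h w).
  rewrite -(level_config_cons Sv Kl Pl hwh) /= fineK//.
  by move: levE; rewrite -(level_config_cons Sv Kl Pl hwh).
case/orP => [mS|mn]; last have {}mn : m \in new h Kl by [].
  rewrite history_config_old; first exact: splitting_survivor mS sp.
  have mo : m \in on h by exact: split_survivor_on (conj hwh sp) mS.
  exact: history_on_notin_new hwh mo.
rewrite history_config_new//; apply: above => //; by rewrite -hevE.
Qed.

Lemma history_invariantP h : history_invariant h.
Proof.
by elim: h => [|s h IH]; [exact: history_invariant_nil|exact: history_invariant_cons].
Qed.

(** * Mean of a function of a new path *)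

Lemma split_labels h Sv Kl w : split_ev h Sv Kl w ->
  [/\ uniq Sv, Sv != [::], {subset Sv <= on h} & (size Kl + size Sv)%N = nrep].
Proof.
move=> sp; have [hw [ns sE kE]] := sp; have [onN uon _] := history_labels hw.
have lfin := splitting_level_fin k_range onN sp.2.
split.
- by rewrite -sE filter_uniq//; move: uon; rewrite /= cat_uniq => /andP[].
- rewrite -size_eq0 -lt0n -sE; apply: survivors_neq0.
  by move: lfin; case: (lev _ _) => // r _; exact: ltry.
- by move=> n; exact: split_survivor_on sp.
- by rewrite -sE -kE size_killed_survivors.
Qed.

(** Given its parent i, path j is replica i resampled at the level, which by the invariant has the
    same mean on this event as replica i. The parents of the other new labels are fixed for the
    computation and then summed out. *)
Lemma integral_new_path_parent h Sv Kl j i (psi0 : path_space S -> \bar R) :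
  j \in new h Kl -> (forall y, 0 <= psi0 y) -> measurable_fun setT psi0 ->
  \int[Pr]_(w in split_ev h Sv Kl `&` parent (size h) j @^-1` [set i])
    psi0 (Y (size h) j w) =
  if i \in Sv then (u_ Sv)%:E * \int[Pr]_(w in split_ev h Sv Kl) psi0 (conf h w i)
  else 0.
Proof.
move=> jn psi_ge0 mpsi.
have [[w0 sp0]|/forallNP nE] := pselect (exists w, split_ev h Sv Kl w); last first.
  rewrite (_ : split_ev h Sv Kl = set0) ?set0I ?integral_set0 ?mule0 ?if_same//.
  by apply/seteqP; split => // w /nE.
have [uS S0 Son _] := split_labels sp0; have [hw0 _] := sp0.
have [onN _ _] := history_labels hw0.
have mX := measurable_parent draws (size h).
have mY := measurableT_comp mpsi (measurable_resampled draws (size h) j).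
have mE : measurable (split_ev h Sv Kl).
  exact: (measurable_split_event h Sv Kl).
have mEj : measurable (split_ev h Sv Kl `&` parent (size h) j @^-1` [set i]).
  by apply: measurableI => //; rewrite -[V in measurable V]setTI; exact: mX.
have mconfi : measurable_fun setT (fun x : config S => psi0 (x i)).
  exact: measurableT_comp mpsi (measurable_replica i).
set l := [seq n <- new h Kl | n != j].
have ul : uniq l by rewrite filter_uniq// iota_uniq.
refine (integral_uniform_draws uS S0 mX mY _ ul mEj _ _).
- by move=> w; exact: psi_ge0.
- case: (i \in Sv) => //; apply: mule_ge0; first by rewrite lee_fin.
  exact: integral_ge0.
rewrite /comp => p; pose p' := update p j i.
have setE : split_ev h Sv Kl `&` parent (size h) j @^-1` [set i] `&`
    [set w | forall n, n \in l -> parent (size h) n w = p n] =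
    parents_event h Sv Kl p'.
  apply/seteqP; split => w.
    move=> [[sp ij] pl]; split => // n nn; rewrite /p' /update.
    case: eqP => [->//|/eqP nj]; apply: pl; by rewrite mem_filter nj.
  move=> [sp pw]; split; [split => //|].
    by have := pw j jn; rewrite /p' /update eqxx.
  move=> n; rewrite mem_filter => /andP[/negbTE nj nn].
  by have := pw n nn; rewrite /p' /update nj.
rewrite setE.
have [pS|npS] := pselect {in new h Kl, forall n, p' n \in Sv}; last first.
  move: npS => /existsNP[n /not_implyP[nn /negP npS]].
  rewrite null_set_integral; last 3 first.
  - exact: (measurable_parents_event h Sv Kl p').
  - exact: measurable_funTS.
  - exact: (parents_event_null nn npS).
  move: npS; rewrite /p' /update; case: eqP => [_ /negbTE ->|/eqP nj npS].
    by rewrite mule0.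
  have nl : n \in l by rewrite mem_filter nj.
  by rewrite (bigD1_seq n)//= (negbTE npS) mul0r mul0e.
have iS : i \in Sv by have := pS j jn; rewrite /p' /update eqxx.
have othT : others_event h Kl j (fun=> setT) = setT by apply/seteqP; split.
have mF : measurable_fun setT (fun u : config S * path_space S => psi0 u.2).
  exact: measurableT_comp mpsi measurable_snd.
rewrite -[parents_event _ _ _ _]setIT -othT.
apply: etrans (integral_new_path (C := fun=> setT)
  (F := fun u : config S * path_space S => psi0 u.2) jn pS _ _ mF) _ => //.
(* The invariant is used on the right: replica i is replaced by its resampling, which is what the
   left side contains. *)
rewrite iS (resampling_invariant_split Kl hw0 iS (Son _ iS) (history_invariantP h)
  (F := fun x => psi0 (x i)))//.
rewrite muleA -EFinM.
rewrite [LHS](eq_integral (fun w => ((u_ Sv * \prod_(n <- l) u_ Sv)%R)%:E *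
   \int[piz (fine (lev (on h) (conf h w)), conf h w i)]_y psi0 y)); last first.
  move=> w _; congr (_%:E * _); last by rewrite /p' /update eqxx.
  congr (_ * _)%R; rewrite /l big_filter [RHS]big_mkcond; apply: eq_bigr => n _.
  case: (n == j) => //=; rewrite /new_prob.
  by rewrite prob_kernel mulr1.
rewrite [LHS]ge0_integralZl_EFin//; last 3 first.
- by move=> w _; exact: integral_ge0.
- apply: measurable_funTS.
  apply: (measurable_integral_kernel (F := fun u : Omega * path_space S => psi0 u.2)
    _ (f := fun w => ((fine (lev (on h) (conf h w)) : measurableTypeR R), conf h w i))).
  + exact: measurableT_comp (measurable_level_replica mA mxi k_range i onN)
      (measurable_history_config h).
  + by [].
  + exact: measurableT_comp mpsi measurable_snd.
- by apply: mulr_ge0 => //; apply: prodr_ge0.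
congr (_%:E * _); last first.
  apply: eq_integral => w _; apply: eq_integral => y _.
  by rewrite /update eqxx.
rewrite mulrC; congr (_ * _)%R; rewrite !big_seq; apply: eq_bigr => n.
rewrite mem_filter => /andP[/negbTE nj nn].
by have := pS n nn; rewrite /p' /update nj => ->.
Qed.

Lemma integral_new_path_mean h Sv Kl j (psi0 : path_space S -> \bar R) :
  j \in new h Kl -> (forall y, 0 <= psi0 y) -> measurable_fun setT psi0 ->
  \int[Pr]_(w in split_ev h Sv Kl) psi0 (Y (size h) j w) =
  \sum_(i <- Sv) (u_ Sv)%:E * \int[Pr]_(w in split_ev h Sv Kl) psi0 (conf h w i).
Proof.
move=> jn psi_ge0 mpsi.
have [[w0 sp0]|/forallNP nE] := pselect (exists w, split_ev h Sv Kl w); last first.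
  rewrite (_ : split_ev h Sv Kl = set0); last by apply/seteqP; split => // w /nE.
  by rewrite integral_set0 big1// => i _; rewrite integral_set0 mule0.
have [uS _ _ _] := split_labels sp0.
apply: (integral_nat_partition (X := parent (size h) j)) => //.
- exact: (measurable_split_event h Sv Kl).
- exact: (measurable_parent draws).
- exact: measurableT_comp mpsi (measurable_resampled draws (size h) j).
- by move=> i; exact: integral_new_path_parent.
Qed.

(** The function 1 in [integral_new_path_parent] gives probability 0 to each value of the parent
    outside [Sv], and there are countably many of them. *)
Lemma new_parent_survivor h Sv Kl j : j \in new h Kl ->
  {ae Pr, forall w, split_ev h Sv Kl w -> parent (size h) j w \in Sv}.
Proof.
move=> jn.
have mX := measurable_parent draws (size h) j.
have mE := measurable_split_event h Sv Kl.
pose N i : set Omega := if i \in Sv then set0 else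
  split_ev h Sv Kl `&` parent (size h) j @^-1` [set i].
have mN i : measurable (N i).
  rewrite /N; case: ifP => // _; apply: measurableI => //.
  by rewrite -[V in measurable V]setTI; exact: mX.
apply: (@negligibleS _ _ _ Pr (\bigcup_i N i)).
  move=> w /= /not_implyP[sp /negP/negbTE npS]; exists (parent (size h) j w) => //.
  by rewrite /N npS.
apply: negligible_bigcup => i; apply/negligibleP => //.
rewrite /N; case: ifPn => [|/negbTE iS]; first by rewrite measure0.
have := @integral_new_path_parent h Sv Kl j i (fun=> 1) jn (fun=> lee01)
  (measurable_cst _).
by rewrite iS integral_cst ?mul1e //; have := mN i; rewrite /N iS.
Qed.

(** * Measurability of the estimator and conservation of its mean *)

Implicit Types phi : path_space S -> R.

Lemma run_frozen r q w : (r <= q)%N -> halts r w -> run q w = run r w.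
Proof.
elim: q => [|q IH]; first by rewrite leqn0 => /eqP ->.
rewrite leq_eqVlt => /orP[/eqP -> //|]; rewrite ltnS => rq st.
by rewrite run_stable; rewrite (IH rq st).
Qed.

(** A run that is already frozen is described by the history at which it stopped. The countably many
    histories thus cover [Omega], which reduces measurability to one history at a time. *)
Lemma run_cover q w : exists h, [/\ (size h <= q)%N, hev h w,
  run q w = run (size h) w & size h = q \/ halts (size h) w].
Proof.
elim: q => [|q [h [hq hw rE]]]; first by exists [::]; split => //; left.
have [st _|ns] := boolP (halts (size h) w).
  exists h; split => //; [exact: leqW| |by right].
  by rewrite !(run_frozen _ st)//; exact: leqW.
case => [hqE|//].
have [nsr runE] := hw.
exists ((survivors A xi k (run q w), killed A xi k (run q w),
  [seq parent q n w | n <- crea q w]) :: h).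
split => /=; rewrite ?hqE ?ltnS//; last by left.
split => /= [r|]; last by rewrite hqE -[in run_history _ _ _ _ _ _ _ _ q]hqE runE.
rewrite hqE ltnS leq_eqVlt => /orP[/eqP ->|rq]; first by rewrite -hqE.
by apply: nsr; rewrite hqE.
Qed.

Definition halt_event h : set Omega := hev h `&` [set w | halts (size h) w].

Lemma measurable_halt_event h : measurable (halt_event h).
Proof.
have [[w0 hw0]|/forallNP nE] := pselect (exists w, hev h w); last first.
  by rewrite (_ : halt_event h = set0)//; apply/seteqP; split => // w [/nE].
have [onN _ _] := history_labels hw0.
rewrite (_ : halt_event h = hev h `&`
    conf h @^-1` [set x | zmax%:E < lev (on h) x]).
  apply: measurableI; first exact: (measurable_history_event h).
  apply: measurable_preimageT; first exact: (measurable_history_config h).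
  rewrite -[V in measurable V]setTI; apply: measurable_lte => //.
  exact: (measurable_level mA mxi k_range onN).
by apply/seteqP; split => w [hw hl]; split => //; move: hl;
  have [lE _ _ _] := history_levels hw; rewrite /= /stops lE.
Qed.

Lemma measurable_estimate_history h phi : measurable_fun setT phi ->
  measurable_fun (hev h) (fun w => estimate phi (run (size h) w)).
Proof.
move=> mphi.
have [[w0 hw0]|/forallNP nE] := pselect (exists w, hev h w); last first.
  rewrite (_ : hev h = set0); first exact: measurable_fun_set0.
  by apply/seteqP; split => // w /nE.
apply: (@eq_measurable_fun _ _ _ _ _
  (fun w => \sum_(n <- on h ++ history_off nrep h)
    weight (run (size h) w0) n * phi (conf h w n))%R).
  move=> w /set_mem hw; have [onE offE rE] := history_run hw.
  rewrite /estimate /labels onE offE !big_seq; apply: eq_bigr => n nl.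
  by rewrite (history_weights hw hw0) rE.
apply: measurable_funTS; apply: measurable_sum => n.
apply: measurable_funM; first exact: measurable_cst.
apply: (measurableT_comp mphi).
exact: measurableT_comp (measurable_replica n) (measurable_history_config h).
Qed.

Lemma measurable_estimate q phi : measurable_fun setT phi ->
  measurable_fun setT (fun w => estimate phi (run q w)).
Proof.
move=> mphi.
pose F (i : nat) : set Omega := if unpickle i is Some h then
  if size h == q then hev h else if (size h < q)%N then halt_event h else set0
  else set0.
have mF i : measurable (F i).
  rewrite /F; case: unpickle => [h|//]; case: eqP => _.
    exact: (measurable_history_event h).
  by case: ifP => // _; exact: measurable_halt_event.
have FT : \bigcup_i F i = setT.
  apply/seteqP; split => // w _; have [h [hq hw _ sth]] := run_cover q w.
  exists (pickle h) => //; rewrite /F pickleK; case: eqP => // /eqP hqn.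
  rewrite ltn_neqAle hqn hq; split => //; case: sth => // hqE.
  by rewrite hqE eqxx in hqn.
rewrite -FT; apply/(measurable_fun_bigcup _ mF) => i.
rewrite /F; case: unpickle => [h|]; last exact: measurable_fun_set0.
case: eqP => [<-|_]; first exact: measurable_estimate_history.
case: ifP => hq; last exact: measurable_fun_set0.
apply: (@eq_measurable_fun _ _ _ _ _ (fun w => estimate phi (run (size h) w))).
  by move=> w /set_mem[_ st]; rewrite (run_frozen (ltnW hq) st).
apply: (@measurable_funS _ _ _ _ (hev h)).
- exact: (measurable_history_event h).
- by move=> w [].
- exact: measurable_estimate_history.
Qed.

Lemma measurable_ams_estimator phi : measurable_fun setT phi ->
  measurable_fun setT (ams_estimator A xi zmax nrep k X0 parent Y phi).
Proof.
move=> mphi; set est := ams_estimator _ _ _ _ _ _ _ _ _.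
pose F (i : nat) : set Omega := if unpickle i is Some h then halt_event h else set0.
have mF i : measurable (F i).
  by rewrite /F; case: unpickle => [h|//]; exact: measurable_halt_event.
have mU : measurable (\bigcup_i F i) by exact: bigcup_measurable.
rewrite -(setUv (\bigcup_i F i)); apply/measurable_funU => //; first exact: measurableC.
split.
  apply/(measurable_fun_bigcup _ mF) => i.
  rewrite /F; case: unpickle => [h|]; last exact: measurable_fun_set0.
  apply: (@eq_measurable_fun _ _ _ _ _ (fun w => estimate phi (run (size h) w))).
    move=> w /set_mem[hw st]; rewrite /est /ams_estimator /num_iter.
    suff -> : first_time [set q | halts q w] = Some (size h) by [].
    apply/first_time_Some; split => // r rh; apply/negP.
    by have [ns _] := hw; exact: ns.
  apply: (@measurable_funS _ _ _ _ (hev h)).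
  - exact: (measurable_history_event h).
  - by move=> w [].
  - exact: measurable_estimate_history.
(* Off the halting events the algorithm never stops, and the estimator has its dummy value 0. *)
apply: (@eq_measurable_fun _ _ _ _ _ ((fun=> 0%R) : Omega -> R)); last exact: measurable_cst.
move=> w /set_mem nF; rewrite /est /ams_estimator /num_iter.
case qE : (first_time _) => [q|//]; exfalso; apply: nF.
move/first_time_Some: qE => [st ns].
have [h [hq hw _ sth]] := run_cover q w.
have hqE : size h = q.
  case: sth => // sth; apply/eqP; rewrite eqn_leq hq leqNgt; apply/negP => hq'.
  exact: ns sth.
by exists (pickle h) => //; rewrite /F pickleK; split => //=; rewrite hqE.
Qed.

(** The exceptional set is a countable union of null events, over all histories, splittings and new
    labels. *)
Lemma ae_parents_survive : {ae Pr, forall w, forall q, ps q w}.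
Proof.
pose Q (i : nat) w : Prop := if unpickle i is Some (h, Sv, Kl, j) then
  j \in new h Kl -> split_ev h Sv Kl w -> parent (size h) j w \in Sv else True.
have aeQ : {ae Pr, forall w, forall i, Q i w}.
  apply: ae_foralln => i; rewrite /Q; case: unpickle => [[[[h Sv] Kl] j]|]; last exact: aeW.
  have [jn|jn] := boolP (j \in new h Kl); last by apply: aeW => w.
  apply: ae_imply (new_parent_survivor Sv jn) => w H _; exact: H.
apply: ae_imply aeQ => w Qw q n nc.
have ns : ~~ halts q w.
  by apply/negP => st; move: nc; rewrite /created /new_labels st.
have sp := run_split_event ns.
have sz := size_run_history A xi zmax nrep k X0 parent Y q w.
set h := run_history _ _ _ _ _ _ _ _ q w in sp sz.
have [_ _ _ cE _] := split_survivors sp; rewrite sz in cE.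
have := Qw (pickle (h, survivors A xi k (run q w), killed A xi k (run q w), n)).
rewrite /Q pickleK sz; apply => //; by rewrite -cE.
Qed.

Lemma integral_scaled_sum (D : set Omega) (b : R) (l : seq nat)
    (f : nat -> Omega -> R) : measurable D -> (0 <= b)%R ->
  (forall n w, (0 <= f n w)%R) -> (forall n, measurable_fun setT (f n)) ->
  \int[Pr]_(w in D) (b * \sum_(n <- l) f n w)%R%:E =
  b%:E * \sum_(n <- l) \int[Pr]_(w in D) (f n w)%:E.
Proof.
move=> mD b0 f0 mf; under eq_integral do rewrite EFinM -sumEFin.
rewrite ge0_integralZl_EFin//; last 2 first.
- by move=> w _; apply: sume_ge0 => n _; rewrite lee_fin.
- by apply: emeasurable_sum => n; apply/measurable_EFinP; exact: measurable_funTS.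
rewrite ge0_integral_sum//.
- by move=> n; apply/measurable_EFinP; exact: measurable_funTS.
- by move=> n w _; rewrite lee_fin.
Qed.

Lemma estimate_ge0 q w phi : (forall y, (0 <= phi y)%R) ->
  (0 <= estimate phi (run q w))%R.
Proof.
by move=> p0; apply: sumr_ge0 => n _; apply: mulr_ge0 => //; exact: weight_ge0.
Qed.

(** [estimate_step] is integrated: each new path has the mean of the survivors, so the two
    correction terms have the same integral. The bound on [phi] makes it finite, so that it can be
    cancelled. *)
Lemma integral_estimate_split h Sv Kl phi M : measurable_fun setT phi ->
  (forall y, (0 <= phi y <= M)%R) ->
  \int[Pr]_(w in split_ev h Sv Kl) (estimate phi (run (size h).+1 w))%:E =
  \int[Pr]_(w in split_ev h Sv Kl) (estimate phi (run (size h) w))%:E.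
Proof.
move=> mphi phiM.
have phi0 y : (0 <= phi y)%R by case/andP: (phiM y).
have [[w0 sp0]|/forallNP nE] := pselect (exists w, split_ev h Sv Kl w); last first.
  rewrite (_ : split_ev h Sv Kl = set0) ?integral_set0//.
  by apply/seteqP; split => // w /nE.
have [uS S0 Son szKS] := split_labels sp0; have [hw0 _] := sp0.
have mE := measurable_split_event h Sv Kl.
set E0 := split_ev h Sv Kl in mE *.
have cw0 := common_weight_ge0 hw0.
have nrep0 : (nrep%:R != 0 :> R)%R.
  by rewrite pnatr_eq0 -lt0n; case/andP: k_range => _; exact: leq_trans.
have Sv0 : ((size Sv)%:R != 0 :> R)%R by rewrite pnatr_eq0 size_eq0.
have SvE : (nrep%:R - (size Kl)%:R = (size Sv)%:R :> R)%R.
  by apply/eqP; rewrite subr_eq -natrD addnC szKS.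
(* a is the weight lost by each survivor and c' the weight of each new path; the corrections match
   because K c' / (nrep - K) = a. *)
pose a : R := ((size Kl)%:R / nrep%:R * cw h)%R.
pose c' : R := ((size Sv)%:R / nrep%:R * cw h)%R.
have a0 : (0 <= a)%R by rewrite !mulr_ge0// invr_ge0.
have c'0 : (0 <= c')%R by rewrite !mulr_ge0// invr_ge0.
have mconf n : measurable_fun setT (fun w => phi (conf h w n)).
  apply: (measurableT_comp mphi).
  exact: measurableT_comp (measurable_replica n) (measurable_history_config h).
have mY n : measurable_fun setT (fun w => phi (Y (size h) n w)).
  exact: measurableT_comp mphi (measurable_resampled draws _ _).
pose s := \sum_(i <- Sv) \int[Pr]_(w in E0) (phi (conf h w i))%:E.
have sfin : s \is a fin_num.
  rewrite /s; apply/sum_fin_numP => i _ _.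
  exact: (integral_bounded_fin_num Pr mE (mconf i) (fun w => phiM (conf h w i))).
have A1 : \int[Pr]_(w in E0) (a * \sum_(n <- Sv) phi (conf h w n))%R%:E = a%:E * s.
  exact: integral_scaled_sum.
have B1 : \int[Pr]_(w in E0) (c' * \sum_(n <- new h Kl) phi (Y (size h) n w))%R%:E =
    a%:E * s.
  rewrite integral_scaled_sum//.
  rewrite (eq_big_seq (fun=> (u_ Sv)%:E * s)); last first.
    move=> j jn; rewrite /s -/E0 (integral_new_path_mean Sv jn
      (psi0 := fun y => (phi y)%:E))//.
    - rewrite ge0_sume_distrr// => i _; apply: integral_ge0 => w _.
      by rewrite lee_fin.
    - exact/measurable_EFinP.
  rewrite -(fineK sfin) -EFinM sumEFin -!EFinM big_const_seq count_predT size_iota.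
  rewrite iter_addr addr0 -[(_ *+ _)%R]mulr_natr /a /c'; congr (_%:E).
  by field; rewrite nrep0 Sv0.
have mest q : measurable_fun E0 (fun w => (estimate phi (run q w))%:E).
  by apply/measurable_EFinP; apply: measurable_funTS; exact: measurable_estimate.
have msum (l : seq nat) (b : R) (f : nat -> Omega -> R) :
    (forall n, measurable_fun setT (f n)) ->
    measurable_fun E0 (fun w => (b * \sum_(n <- l) f n w)%R%:E).
  move=> mf; apply/measurable_EFinP; apply: measurable_funTS.
  by apply: measurable_funM; [exact: measurable_cst|exact: measurable_sum].
have asfin : a%:E * s \is a fin_num by exact: fin_numM.
rewrite -[LHS](addeK _ asfin) -[RHS](addeK _ asfin); congr (_ - _).
rewrite -{1}A1 -B1 -!ge0_integralD//; first last.
- exact: msum.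
- by move=> w _; rewrite lee_fin mulr_ge0// sumr_ge0.
- by move=> w _; rewrite lee_fin estimate_ge0.
- exact: msum.
- by move=> w _; rewrite lee_fin mulr_ge0// sumr_ge0.
- by move=> w _; rewrite lee_fin estimate_ge0.
apply: ae_eq_integral => //.
- by apply: emeasurable_funD => //; exact: msum.
- by apply: emeasurable_funD => //; exact: msum.
apply: ae_imply ae_parents_survive => w pw sp.
rewrite -!EFinD; congr (_%:E).
have := estimate_step k_range phi sp (fun r _ => pw r); rewrite SvE; exact.
Qed.

Lemma integral_estimate_succ q phi M : measurable_fun setT phi ->
  (forall y, (0 <= phi y <= M)%R) ->
  \int[Pr]_w (estimate phi (run q.+1 w))%:E = \int[Pr]_w (estimate phi (run q w))%:E.
Proof.
move=> mphi phiM.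
have phi0 y : (0 <= phi y)%R by case/andP: (phiM y).
(* [pickle_inv] rather than [unpickle]: it has a value at i only if i is the code of that value,
   which makes the events disjoint. *)
pose F (i : nat) : set Omega := if pickle_inv i is Some (h, Sv, Kl) then
  if size h == q then split_ev h Sv Kl else set0 else set0.
have mF i : measurable (F i).
  rewrite /F; case: pickle_inv => [[[h Sv] Kl]|//]; case: eqP => // _.
  exact: (measurable_split_event h Sv Kl).
have mU : measurable (\bigcup_i F i) by exact: bigcup_measurable.
have FP i w : F i w -> pickle_inv i = Some (hist q w, survivors A xi k (run q w),
    killed A xi k (run q w)).
  rewrite /F; case: pickle_inv => [[[h Sv] Kl]|//]; case: eqP => // <- sp.
  have [_ -> -> _ _] := split_survivors sp.
  by have [[_ ->] _] := sp.
have UE : \bigcup_i F i = [set w | ~~ halts q w].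
  apply/seteqP; split => w.
    move=> [i _]; rewrite /F; case: pickle_inv => [[[h Sv] Kl]|//].
    by case: eqP => // <- /split_survivors[].
  move=> ns; exists (pickle (hist q w, survivors A xi k (run q w),
    killed A xi k (run q w))) => //.
  rewrite /F pickleK_inv size_run_history eqxx; exact: run_split_event.
have tF : trivIset setT F.
  move=> i j _ _ [w [/FP iE /FP jE]].
  have := @pickle_invK (seq split_step * seq nat * seq nat)%type i.
  have := @pickle_invK (seq split_step * seq nat * seq nat)%type j.
  by rewrite /ocancel /oapp iE jE => <- <-.
have mest r D : measurable_fun D (fun w => (estimate phi (run r w))%:E).
  by apply/measurable_EFinP; apply: measurable_funTS; exact: measurable_estimate.
have est0 r w : 0 <= (estimate phi (run r w))%:E by rewrite lee_fin estimate_ge0.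
have splitE r : \int[Pr]_w (estimate phi (run r w))%:E =
    \int[Pr]_(w in \bigcup_i F i) (estimate phi (run r w))%:E +
    \int[Pr]_(w in ~` (\bigcup_i F i)) (estimate phi (run r w))%:E.
  rewrite -ge0_integral_setU ?setUv//; first exact: measurableC.
  by rewrite disj_set2E setICr.
rewrite !splitE; congr (_ + _); last first.
  apply: eq_integral => w /set_mem; rewrite UE /= => /negP; rewrite negbK => st.
  by rewrite -/(run q.+1 w) run_stable.
rewrite !ge0_integral_bigcup//; apply: eq_eseriesr => i _.
rewrite /F; case: pickle_inv => [[[h Sv] Kl]|]; last by rewrite !integral_set0.
case: eqP => [<-|_]; last by rewrite !integral_set0.
exact: integral_estimate_split phiM.
Qed.

(** For q = 0, the invariant of the empty history gives each initial replica the mean pi(phi),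
    because resampling is then a draw from [pi]; the nrep weights add up to 1. *)
Lemma integral_estimate q phi M : measurable_fun setT phi ->
  (forall y, (0 <= phi y <= M)%R) ->
  \int[Pr]_w (estimate phi (run q w))%:E = \int[pi]_y (phi y)%:E.
Proof.
move=> mphi phiM.
have phi0 y : (0 <= phi y)%R by case/andP: (phiM y).
elim: q => [|q <-]; last exact: integral_estimate_succ phiM.
have nrep0 : (nrep%:R != 0 :> R)%R.
  by rewrite pnatr_eq0 -lt0n; case/andP: k_range => _; exact: leq_trans.
have mX n : measurable_fun setT (fun w => phi (X0 n w)).
  exact: measurableT_comp mphi (measurable_init draws n).
transitivity (\int[Pr]_w (nrep%:R^-1 * \sum_(n <- init_labels nrep) phi (X0 n w))%R%:E).
  by apply: eq_integral => w _; rewrite /estimate /labels /= cats0 mulr_sumr.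
rewrite integral_scaled_sum//.
rewrite (eq_big_seq (fun=> \int[pi]_y (phi y)%:E)); last first.
  move=> n ni.
  have [inv _] := history_invariantP [::].
  have := inv n ni (fun x => (phi (x n))%:E) (fun x => phi0 (x n)).
  have hevT : hev [::] = setT by apply/seteqP; split.
  rewrite hevT /= => /(_ _)/wrap[].
    by apply/measurable_EFinP; exact: measurableT_comp mphi (measurable_replica n).
  rewrite ni => ->.
  under eq_integral do under eq_integral do rewrite /update eqxx.
  rewrite integral_cst//; apply: etrans (congr1 _ (probability_setT Pr)) _.
  by rewrite mule1.
have : \int[pi]_y (phi y)%:E \is a fin_num.
  exact: (integral_bounded_fin_num pi measurableT mphi phiM).
move=> /fineK <-.
rewrite sumEFin -EFinM big_const_seq count_predT size_iota iter_addr addr0.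
by rewrite -(mulr_natl (fine _) nrep) mulKf.
Qed.

(** * Signed functions and the limit in q *)

Hypothesis Q_finite :
  {ae Pr, forall w, num_iter A xi zmax nrep k X0 parent Y w <> None}.
Variables (phi : path_space S -> R) (M : R).
Hypotheses (mphi : measurable_fun setT phi) (phiM : forall y, (`|phi y| <= M)%R).

(** The conservation of the mean is known for nonnegative functions; as the total weight is almost
    surely 1, adding M to [phi] adds M to the estimate. *)
Let psi0 y : R := (phi y + M)%R.

Let mpsi0 : measurable_fun setT psi0.
Proof. by apply: measurable_funD => //; exact: measurable_cst. Qed.

Let psi0_bounds y : (0 <= psi0 y <= M + M)%R.
Proof.
have := phiM y; rewrite ler_norml => /andP[lo hi].
by rewrite /psi0 -lerBlDr sub0r lo lerD2r.
Qed.

Let M0 : (0 <= M)%R. Proof. exact: le_trans (normr_ge0 _) (phiM point). Qed.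

Let estimate_shift q w : (forall r, (r < q)%N -> ps r w) ->
  estimate phi (run q w) = (estimate psi0 (run q w) - M)%R.
Proof.
move=> /(total_weight k_range) t1.
rewrite -[X in (_ - X)%R]mul1r -t1 mulr_suml -sumrB; apply: eq_bigr => n _.
by rewrite mulrDr addrK.
Qed.

Let estimate_bound q w : (forall r, (r < q)%N -> ps r w) ->
  (`|estimate phi (run q w)| <= M)%R.
Proof.
move=> /(total_weight k_range) t1; apply: le_trans (ler_norm_sum _ _ _) _.
rewrite -[leRHS]mul1r -t1 mulr_suml; apply: ler_sum => n _.
have w0 := weight_ge0 A xi zmax nrep k X0 parent Y q w n.
by rewrite normrM (ger0_norm w0) ler_wpM2l.
Qed.

Let integrable_cstM d' (T : measurableType d') (mu : probability T R) :
  mu.-integrable setT (EFin \o cst M).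
Proof.
exact: finite_measure_integrable_cst.
Qed.

Let integral_cstM d' (T : measurableType d') (mu : probability T R) :
  \int[mu]_x (cst M%:E) x = M%:E.
Proof.
rewrite integral_cst//; apply: etrans (congr1 _ (probability_setT mu)) _.
by rewrite mule1.
Qed.

Let integral_psi0 :
  \int[pi]_y (psi0 y)%:E = \int[pi]_y (phi y)%:E + M%:E.
Proof.
have iphi : pi.-integrable setT (EFin \o phi).
  apply: (le_integrable _ _ _ (integrable_cstM pi)) => //.
    exact/measurable_EFinP.
  by move=> y _; rewrite /= lee_fin (ger0_norm M0).
apply: etrans (integralD_EFin measurableT iphi (integrable_cstM pi)) _.
by congr (_ + _); exact: integral_cstM.
Qed.

Let integral_estimate_signed q :
  \int[Pr]_w (estimate phi (run q w))%:E = \int[pi]_y (phi y)%:E.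
Proof.
have mest (f : path_space S -> R) : measurable_fun setT f ->
    measurable_fun setT (fun w => (estimate f (run q w))%:E).
  by move=> mf; apply/measurable_EFinP; exact: (measurable_estimate).
have ipsi := integral_estimate q
  mpsi0 psi0_bounds.
have pfin := integral_bounded_fin_num pi measurableT mpsi0 psi0_bounds.
have iest : Pr.-integrable setT (EFin \o (fun w => estimate psi0 (run q w))).
  apply/integrableP; split; first exact: mest.
  rewrite (eq_integral (fun w => (estimate psi0 (run q w))%:E)); last first.
    move=> w _ /=; rewrite ger0_norm//; apply: estimate_ge0 => y.
    by case/andP: (psi0_bounds y).
  by rewrite ipsi ltey_eq pfin.
transitivity (\int[Pr]_w (estimate psi0 (run q w) - M)%R%:E).
  apply: ae_eq_integral => //; first exact: mest.
    apply/measurable_EFinP; apply: measurable_funB; last exact: measurable_cst.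
    exact: (measurable_estimate).
  apply: ae_imply (ae_parents_survive).
  by move=> w pw _; rewrite estimate_shift.
apply: etrans (integralB_EFin measurableT iest (integrable_cstM Pr)) _.
rewrite ipsi integral_psi0; apply: etrans (congr1 (fun x => _ - x) (integral_cstM Pr)) _.
by rewrite addeK.
Qed.

Lemma ams_unbiased : Pr.-integrable setT (EFin \o est phi) /\
  \int[Pr]_w (est phi w)%:E = \int[pi]_y (phi y)%:E.
Proof.
have aeps := ae_parents_survive.
have [||||| iest _ cv] := @dominated_convergence _ _ _ Pr setT measurableT
    (fun q w => (estimate phi (run q w))%:E) (EFin \o est phi) (EFin \o cst M).
- by move=> q; apply/measurable_EFinP; exact: (measurable_estimate).
- by apply/measurable_EFinP; exact: (measurable_ams_estimator).
(* Once stopped the run is frozen, so the sequence of estimates is eventually constant. *)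
- apply: ae_imply Q_finite => w; rewrite /= /ams_estimator.
  case qE : num_iter => [q0|] // _ _.
  move/first_time_Some: qE => [st _].
  apply: cvg_near_cst; exists q0 => // q /= q0q.
  by rewrite (run_frozen q0q st).
- exact: integrable_cstM.
- apply: ae_imply aeps => w pw q _; rewrite /= lee_fin; exact: estimate_bound.
split=> //; rewrite -(cvg_lim (@ereal_hausdorff R) cv).
under eq_fun do rewrite integral_estimate_signed.
by apply: (cvg_lim (@ereal_hausdorff R)); exact: cvg_cst.
Qed.

End draws.

Theorem mainTheorem2 (R : realType) (S : completePseudoMetricType R)
    (S_polish : polish S)
    (P : R.-pker (borel S) ~> (borel S)) (x0 : S) (A B : set (borel S))
    (mA : measurable A) (mB : measurable B) (AB : A `&` B = set0)
    (xi : borel S -> R) (mxi : measurable_fun setT xi)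
    (zmax : R) (Bxi : B `<=` xi @^-1` `]zmax, +oo[)
    (* the Markov chain and the law pi of the stopped chain *)
    (d' : measure_display) (Omega' : measurableType d')
    (Pr' : probability Omega' R) (X : nat -> Omega' -> borel S)
    (X_chain : markov_chain Pr' P x0 X)
    (pi : probability (path_space S) R)
    (pi_law : forall C : set (path_space S), measurable C ->
       pi C = Pr' [set w | C (stopped A (fun t => X t w))])
    (* the resampling kernel *)
    (piz : R.-pker (measurableTypeR R * path_space S)%type ~> (path_space S))
    (piz_law : resampling_kernel P A xi piz)
    (* a run of the algorithm *)
    (nrep k : nat) (k_range : (0 < k < nrep)%N)
    (d : measure_display) (Omega : measurableType d) (Pr : probability Omega R)
    (X0 : nat -> Omega -> path_space S) (parent : nat -> nat -> Omega -> nat)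
    (Y : nat -> nat -> Omega -> path_space S)
    (draws : ams_draws A xi zmax nrep k X0 parent Y Pr pi piz)
    (Q_finite :
       {ae Pr, forall w, num_iter A xi zmax nrep k X0 parent Y w <> None})
    (phi : path_space S -> R) (mphi : measurable_fun setT phi)
    (bphi : bounded_fun phi) :
  let phi_hat := ams_estimator A xi zmax nrep k X0 parent Y phi in
  Pr.-integrable setT (EFin \o phi_hat) /\ ('E_Pr[phi_hat] = 'E_pi[phi])%E.
Proof.
have [M Mphi] : exists M, forall y, `|phi y| <= M.
  (* [bounded_fun] gives as bounds all numbers above some N, in particular N + 1. *)
  by have [N [_ /(_ (N + 1))]] := bphi; rewrite ltrDl ltr01 => /(_ isT) h;
    exists (N + 1) => y; exact: h.
have [int_est est_mean] := ams_unbiased S_polish mA mxi piz_law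
  (law_resample S_polish mA mxi piz_law X_chain pi_law) k_range draws Q_finite mphi Mphi.
by split => //; rewrite unlock.
Qed.
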